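(* Let $k$ be an algebraically closed field (of any characteristic), $Q_5=\{z_0^2+z_1z_2+z_3z_4+z_5z_6=0\}\subset\mathbb P^6$ over $k$, and let $$A=\left(\begin{array}{cccccc} z_0^2&0&0&z_1^2&z_1z_3+z_0z_6&-z_0z_4+z_1z_5\\ 0&z_0^2&0&z_1z_3-z_0z_6&z_3^2&z_0z_2+z_3z_5\\ 0&0&z_0^2&z_0z_4+z_1z_5&-z_0z_2+z_3z_5&z_5^2\\ 0&z_0z_2-z_3z_5&z_3^2&-z_0z_3-z_2z_6&0&z_2^2\\ z_5^2&0&z_0z_4-z_1z_5&z_4^2&-z_2z_4-z_0z_5&0\\ -z_3^2&z_1z_3+z_0z_6&0&-z_6^2&0&-z_0z_3+z_2z_6\\ 0&z_5^2&-z_0z_2-z_3z_5&-z_2z_4+z_0z_5&z_2^2&0\\ z_1z_3-z_0z_6&-z_1^2&0&0&-z_6^2&z_0z_1+z_4z_6\\ z_0z_4+z_1z_5&0&-z_1^2&0&-z_0z_1+z_4z_6&-z_4^2\\ -z_2^2&-z_2z_4-z_0z_5&z_0z_3-z_2z_6&-z_0^2&0&0\\ z_2z_4-z_0z_5&z_4^2&z_0z_1+z_4z_6&0&z_0^2&0\\ -z_0z_3-z_2z_6&z_0z_1-z_4z_6&-z_6^2&0&0&-z_0^2 \end{array}\right),$$ a matrix which has rank $3$ at every point of $Q_5$. Regard $A$ as a morphism $\mathcal O_{Q_5}(-2)^6\to\mathcal O_{Q_5}^{12}$, let $\mathrm{Im}(A)$ be its image sheaf (a rank-$3$ vector bundle),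 and let $H=(\mathrm{Im}(A))^\vee(-1)$. Let $F$ (Tango's bundle on $Q_5$) be the cokernel of a nowhere vanishing section of $H$: $$0\to\mathcal O_{Q_5}\to H\to F\to0 .$$ Then $F\cong C(1)$, where $C$ is the Cayley bundle on $Q_5$; that is, $F(-1)$ is the cohomology of a monad $\mathcal O_{Q_5}(-1)\to S\to\mathcal O_{Q_5}$, with $S$ the spinor bundle.
   Context: $\mathcal O_{Q_5}(1)$ is the restriction of $\mathcal O_{\mathbb P^6}(1)$. Spinor bundle: $S$ is the rank-$4$ spinor bundle on $Q_5$, indecomposable and without intermediate cohomology (i.e. $H^i(Q_5,S(t))=0$ for $0<i<5$ and all $t$), normalized so that $S^\vee\cong S(1)$, $h^0(S)=0$, $h^0(S(1))=8$. Cayley bundle: $C$ is the rank-$2$ bundle on $Q_5=G_2/P(\alpha_1)$ ($\alpha_1$ the shortest root of $G_2$), irreducible $G_2$-homogeneous with maximal weight $\lambda_2-2\lambda_1$ ($\lambda_1,\lambda_2$ the fundamental weights), with Chern classes $(-1,1)$; it is the cohomology of a monad $\mathcal O_{Q_5}(-1)\to S\to\mathcal O_{Q_5}$ (first map injective as a bundle map, second map surjective, composition zero). Different choices of the monad (equivalently of $G_2\subset\mathrm{Aut}(Q_5)$) give bundles all called Cayley bundles, and the identification $F\cong C(1)$ is understood for such a choice. *)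

(* Defs.v *)
(* The quadric Q_5 over an algebraically closed field is treated as a classical
   variety: its points are the closed points, an open set is represented by its
   (scaling-invariant) preimage in the punctured affine cone over Q_5, and
   coherent sheaves are sheaves of modules over the sheaf of regular functions.
   Restriction to closed points identifies these with sheaves of modules on the
   scheme Q_5. *)
From HB Require Import structures.
From mathcomp Require Import all_boot all_order all_algebra.
From mathcomp Require Import boolp functions.
From mathcomp Require Import mpoly.

Set Implicit Arguments.
Unset Strict Implicit.
Unset Printing Implicit Defensive.

Import GRing.Theory.
Local Open Scope ring_scope.
Local Obligation Tactic := idtac.

Section Quadric.
Variable k : closedFieldType.

Local Notation vec := ('I_7 -> k).
Local Notation poly7 := {mpoly k[7]}.

Definition zvar (i : nat) : poly7 := 'X_(inord i).

Definition quadric : poly7 :=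
  zvar 0 ^+ 2 + zvar 1 * zvar 2 + zvar 3 * zvar 4 + zvar 5 * zvar 6.

Definition on_cone (x : vec) : Prop := (exists i, x i != 0) /\ quadric.@[x] = 0.

Definition zariski_open (U : vec -> Prop) : Prop :=
  exists E : poly7 -> Prop,
    (forall f, E f -> exists d, f \is d.-homog) /\
    (forall x, U x <-> on_cone x /\ exists2 f, E f & f.@[x] != 0).

Record zopen := ZOpen { zcar :> vec -> Prop; zopenP : zariski_open zcar }.
Implicit Types (U V W : zopen) (d e : int).

Definition zsub (V U : zopen) : Prop := forall x, V x -> U x.

Lemma zsub_refl (U : zopen) : zsub U U. Proof. by []. Qed.

Lemma zsub_trans (V U W : zopen) : zsub W V -> zsub V U -> zsub W U.
Proof. by move=> WV VU x /WV /VU. Qed.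

Lemma zfull_subproof : zariski_open on_cone.
Proof.
exists (eq 1); split=> [_ <-|x].
  by exists 0%N; exact: dhomog1.
by split=> [xQ|[]//]; split=> //; exists 1 => //; rewrite meval1 oner_eq0.
Qed.

Definition zfull : zopen := ZOpen zfull_subproof.

Lemma zmeet_subproof (U V : zopen) : zariski_open (fun x => U x /\ V x).
Proof.
case: U V => [U [E [hE EU]]] [V [F [hF FV]]] /=.
exists (fun f => exists g h, [/\ E g, F h & f = g * h]); split=> [f|x].
  move=> [g [h [/hE [d dg] /hF [e eh] ->]]].
  by exists (d + e)%N; exact: dhomogM.
split=> [[/EU [xQ [g Eg gx]] /FV [_ [h Fh hx]]]|[xQ [f [g [h [Eg Fh ->]]]]]].
  split=> //; exists (g * h); first by exists g, h.
  by rewrite mevalM mulf_neq0.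
rewrite mevalM mulf_eq0 negb_or => /andP[gx hx].
by split; [apply/EU|apply/FV]; split=> //; [exists g|exists h].
Qed.

Definition zmeet (U V : zopen) : zopen := ZOpen (zmeet_subproof U V).

Lemma zmeetl (U V : zopen) : zsub (zmeet U V) U. Proof. by move=> x []. Qed.
Lemma zmeetr (U V : zopen) : zsub (zmeet U V) V. Proof. by move=> x []. Qed.
Lemma zmeetS (U V W : zopen) : zsub V U -> zsub (zmeet V W) (zmeet U W).
Proof. by move=> VU x [/VU]. Qed.

(* The open set where all the coordinates z_(t j) are nonzero. *)
Lemma zcoord_subproof n (t : 'I_n -> 'I_7) :
  zariski_open (fun x => on_cone x /\ forall j, x (t j) != 0).
Proof.
exists (eq (\prod_(j < n) 'X_(t j))); split=> [_ <-|x].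
  elim/big_rec: _ => [|j f _ [d df]]; first by exists 0%N; exact: dhomog1.
  by exists (1 + d)%N; apply: dhomogM => //; rewrite dhomogX /= mdeg1.
have E : (\prod_(j < n) 'X_(t j) : poly7).@[x] = \prod_(j < n) x (t j).
  by rewrite rmorph_prod; apply: eq_bigr => j _; exact: mevalXU.
split=> [[xQ xt]|[xQ [_ <-]]].
  by split=> //; exists (\prod_(j < n) 'X_(t j)) => //; rewrite E; apply/prodf_neq0.
by rewrite E => /prodf_neq0 h; split=> // j; exact: h.
Qed.

Definition zcoord n (t : 'I_n -> 'I_7) : zopen := ZOpen (zcoord_subproof t).

Definition chart (i : 'I_7) : zopen := zcoord (fun _ : 'I_1 => i).

Definition pts (U : zopen) : Type := {x : vec | U x}.
Definition pt_in (V U : zopen) (VU : zsub V U) (x : pts V) : pts U :=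
  exist U (sval x) (VU _ (svalP x)).

(* Sections of O(d) over U: functions on the cone over U that are locally
   quotients of homogeneous polynomials with difference of degrees d. *)
Definition is_regular (d : int) (U : zopen) (f : pts U -> k) : Prop :=
  forall x : pts U, exists V : zopen, V (sval x) /\
  exists (m n : nat) (P Q : poly7),
    [/\ P \is m.-homog, Q \is n.-homog, m%:Z - n%:Z = d &
        forall y : pts U, V (sval y) ->
          Q.@[sval y] != 0 /\ f y = P.@[sval y] / Q.@[sval y]].

Lemma pts_inj (U : zopen) (x y : pts U) : sval x = sval y -> x = y.
Proof. by case: x y => x Ux [y Uy] /= e; exact: eq_exist. Qed.

Lemma zopen_cone (U : zopen) x : U x -> on_cone x.
Proof. by case: (zopenP U) => E [_ EU] /EU[]. Qed.

Lemma zsub_full U : zsub U zfull.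
Proof. by move=> x; exact: zopen_cone. Qed.

Lemma homogXn i n : ('X_i : poly7) ^+ n \is n.-homog.
Proof.
elim: n => [|n IH]; first by rewrite expr0 dhomog1.
by rewrite exprS; apply: (@dhomogM _ _ _ 1%N) => //; rewrite dhomogX /= mdeg1.
Qed.

Lemma regular_frac (m n : nat) (d : int) U (P Q : poly7) :
  P \is m.-homog -> Q \is n.-homog -> m%:Z - n%:Z = d ->
  (forall x, U x -> Q.@[x] != 0) ->
  is_regular d (fun x : pts U => P.@[sval x] / Q.@[sval x]).
Proof.
move=> hP hQ de hU x; exists U; split; first exact: svalP.
by exists m, n, P, Q; split=> // y Uy; split=> //; exact: hU.
Qed.

Lemma regular_local d U (f : pts U -> k) :
  (forall x : pts U, exists V (VU : zsub V U),
     V (sval x) /\ is_regular d (f \o pt_in VU)) ->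
  is_regular d f.
Proof.
move=> H x; have [V [VU [Vx]]] := H x.
move=> /(_ (exist V _ Vx)) [W [/= Wx [m [n [P [Q [hP hQ de e]]]]]]].
exists (zmeet V W); split; first by split.
exists m, n, P, Q; split=> // y [Vy Wy].
have [Qy /= <-] := e (exist V _ Vy) Wy.
by split=> //; congr (f _); exact: pts_inj.
Qed.

Lemma regular_res d U V (VU : zsub V U) f :
  is_regular d f -> is_regular d (f \o pt_in VU).
Proof.
move=> H x; have [W [Wx [m [n [P [Q [hP hQ de e]]]]]]] := H (pt_in VU x).
exists W; split=> //; exists m, n, P, Q; split=> // y Wy.
exact: (e (pt_in VU y)).
Qed.

Lemma regular_pow i (d : int) U :
  zsub U (chart i) -> is_regular d (fun x : pts U => sval x i ^ d).
Proof.
move=> Ui x; exists U; split; first exact: svalP.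
have nz (y : pts U) : sval y i != 0 by case: (Ui _ (svalP y)) => _ /(_ ord0).
case: d => n.
  exists n, 0%N, ('X_i ^+ n), 1; split; first exact: homogXn.
  - exact: dhomog1.
  - by rewrite subr0.
  by move=> y _; rewrite meval1 oner_eq0 divr1 rmorphXn /= mevalXU.
exists 0%N, n.+1, 1, ('X_i ^+ n.+1); split; first exact: dhomog1.
- exact: homogXn.
- by rewrite sub0r NegzE.
move=> y _; rewrite rmorphXn /= mevalXU meval1 div1r expf_neq0 //.
Qed.

Lemma regular0 d U : is_regular d (fun _ : pts U => 0).
Proof.
move=> x; have [[i xi] _] := zopen_cone (svalP x).
exists (chart i); split.
  by split; [exact: zopen_cone (svalP x)|].
case: d => n.
  exists n, 0%N, 0, 1; split; [exact: dhomog0|exact: dhomog1| |].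
    by rewrite subr0.
  by move=> y _; rewrite meval1 oner_eq0 meval0 mul0r.
exists 0%N, n.+1, 0, ('X_i ^+ n.+1); split.
- exact: dhomog0.
- exact: homogXn.
- by rewrite sub0r NegzE.
move=> y [_ /(_ ord0) yi].
by rewrite rmorphXn /= mevalXU meval0 mul0r expf_neq0.
Qed.

Lemma regularN d U f : @is_regular d U f -> is_regular d (- f).
Proof.
move=> H x; have [V [Vx [m [n [P [Q [hP hQ de e]]]]]]] := H x.
exists V; split=> //; exists m, n, (- P), Q; split=> //.
  by rewrite rpredN.
by move=> y /e[Qy fy]; rewrite mevalN mulNr -fy.
Qed.

Lemma regularD d U f g :
  @is_regular d U f -> is_regular d g -> is_regular d (f + g).
Proof.
move=> Hf Hg x.
have [V [Vx [m [n [P [Q [hP hQ de e]]]]]]] := Hf x.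
have [V' [Vx' [m' [n' [P' [Q' [hP' hQ' de' e']]]]]]] := Hg x.
exists (zmeet V V'); split=> //; exists (m + n')%N, (n + n')%N.
have mn : (m + n' = n + m')%N.
  by apply/eqP; rewrite -eqz_nat !PoszD -subr_eq0 opprD addrACA de
     -[n'%:Z - _]opprB de' subrr.
exists (P * Q' + P' * Q), (Q * Q'); split.
- by apply: dhomogD; [|rewrite mn addnC]; exact: dhomogM.
- exact: dhomogM.
- by rewrite !PoszD -de opprD addrACA subrr addr0.
move=> y [/e[Qy fy] /e'[Qy' fy']].
split; first by rewrite mevalM mulf_neq0.
by rewrite (_ : (f + g) y = f y + g y) // fy fy' addf_div // mevalD !mevalM.
Qed.

Lemma regularM d d' U f g :
  @is_regular d U f -> is_regular d' g -> is_regular (d + d') (f * g).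
Proof.
move=> Hf Hg x.
have [V [Vx [m [n [P [Q [hP hQ de e]]]]]]] := Hf x.
have [V' [Vx' [m' [n' [P' [Q' [hP' hQ' de' e']]]]]]] := Hg x.
exists (zmeet V V'); split=> //; exists (m + m')%N, (n + n')%N.
exists (P * P'), (Q * Q'); split; [exact: dhomogM|exact: dhomogM| |].
  by rewrite !PoszD -de -de' opprD addrACA.
move=> y [/e[Qy fy] /e'[Qy' fy']].
split; first by rewrite mevalM mulf_neq0.
by rewrite (_ : (f * g) y = f y * g y) // fy fy' mulf_div !mevalM.
Qed.

Record hfun (d : int) (U : zopen) :=
  HFun { hval :> pts U -> k; hvalP : `[< is_regular d hval >] }.
HB.instance Definition _ d U := [isSub of hfun d U for @hval d U].
HB.instance Definition _ d U := [Choice of hfun d U by <:].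

Lemma hfunP d U (f : hfun d U) : is_regular d f.
Proof. exact/asboolP/hvalP. Qed.

Definition mkhfun d U f (rf : @is_regular d U f) : hfun d U :=
  HFun (asboolT rf).

Lemma hfun_inj d U (f g : hfun d U) : f =1 g -> f = g.
Proof. by move=> e; apply: val_inj; apply/funext. Qed.

Lemma regular_zmod d U :
  zmod_closed ((fun f : pts U -> k => `[< is_regular d f >]) : {pred _}).
Proof.
split; first exact/asboolP/regular0.
move=> f g /asboolP Hf /asboolP Hg.
by apply/asboolP; apply: regularD => //; exact: regularN.
Qed.
HB.instance Definition _ d U :=
  GRing.SubChoice_isSubZmodule.Build _ _ (hfun d U) (@regular_zmod d U).

Definition hmul d d' e U (de : d + d' = e) (f : hfun d U) (g : hfun d' U) :
  hfun e U := mkhfun (eq_ind _ (fun e => is_regular e _)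
                        (regularM (hfunP f) (hfunP g)) _ de).

Definition hres d U V (VU : zsub V U) (f : hfun d U) : hfun d V :=
  mkhfun (regular_res VU (hfunP f)).

Lemma hfun_glue d U (I : Type) (V : I -> zopen) (VU : forall i, zsub (V i) U) :
  (forall x, U x -> exists i, V i x) ->
  forall f : forall i, hfun d (V i),
  (forall i j W (Wi : zsub W (V i)) (Wj : zsub W (V j)),
     hres Wi (f i) = hres Wj (f j)) ->
  exists s : hfun d U, forall i, hres (VU i) s = f i.
Proof.
move=> cov f fE.
pose c (x : pts U) := cid (cov _ (svalP x)).
pose F (x : pts U) := f (sval (c x)) (exist (V _) (sval x) (svalP (c x))).
have FE i (x : pts (V i)) : F (pt_in (VU i) x) = f i x.
  rewrite /F; set j := sval _; move: (svalP _) => Vjx.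
  pose y : pts (zmeet (V j) (V i)) := exist _ (sval x) (conj Vjx (svalP x)).
  have e := congr1 (fun h : hfun _ _ => h y)
    (fE j i (zmeet (V j) (V i)) (@zmeetl _ _) (@zmeetr _ _)).
  apply: etrans (etrans e _); first by congr (f j _); exact: pts_inj.
  by congr (f i _); exact: pts_inj.
have rF : is_regular d F.
  apply: regular_local => x; have [i Vi] := cov _ (svalP x).
  exists (V i), (VU i); split=> //.
  by rewrite (_ : _ \o _ = f i); [exact: hfunP|apply/funext=> y; exact: FE].
by exists (mkhfun rF) => i; apply: hfun_inj => x; exact: FE.
Qed.

Definition regfun (U : zopen) : Type := hfun 0 U.
HB.instance Definition _ U := GRing.Zmodule.on (regfun U).

Lemma regular_cst U (c : k) : is_regular 0 (fun _ : pts U => c).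
Proof.
move=> x; exists zfull; split; first exact: zopen_cone (svalP x).
exists 0%N, 0%N, (c *: 1), 1; split=> //; try exact: dhomog1.
  by rewrite rpredZ ?dhomog1.
by move=> y _; rewrite mevalZ meval1 oner_eq0 mulr1 divr1.
Qed.

Definition hcst U (c : k) : regfun U := mkhfun (@regular_cst U c).

Definition rmul U (f g : regfun U) : regfun U := hmul (addr0 0) f g.

Lemma rmulA U : associative (@rmul U).
Proof. by move=> f g h; apply: hfun_inj => x /=; exact: mulrA. Qed.
Lemma rmulC U : commutative (@rmul U).
Proof. by move=> f g; apply: hfun_inj => x /=; exact: mulrC. Qed.
Lemma rmul1 U : left_id (hcst U 1) (@rmul U).
Proof. by move=> f; apply: hfun_inj => x /=; exact: mul1r. Qed.
Lemma rmulD U : left_distributive (@rmul U) +%R.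
Proof. by move=> f g h; apply: hfun_inj => x /=; exact: mulrDl. Qed.
HB.instance Definition _ U := GRing.Zmodule_isComPzRing.Build (regfun U)
  (@rmulA U) (@rmulC U) (@rmul1 U) (@rmulD U).

Definition rres U V (VU : zsub V U) (f : regfun U) : regfun V := hres VU f.

(* The function (z_i)^e on an open set where z_i does not vanish. *)
Definition hpow i e U (Ui : zsub U (chart i)) : hfun e U :=
  mkhfun (@regular_pow i e U Ui).

Definition hscale d U (a : regfun U) (s : hfun d U) : hfun d U :=
  hmul (add0r d) a s.
Lemma hscaleA d U (a b : regfun U) (s : hfun d U) :
  hscale a (hscale b s) = hscale (a * b) s.
Proof. by apply: hfun_inj => x /=; exact: mulrA. Qed.
Lemma hscale1 d U : left_id 1 (@hscale d U).
Proof. by move=> f; apply: hfun_inj => x /=; exact: mul1r. Qed.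
Lemma hscaleDr d U : right_distributive (@hscale d U) +%R.
Proof. by move=> a f g; apply: hfun_inj => x /=; exact: mulrDr. Qed.
Lemma hscaleDl d U (s : hfun d U) : {morph (@hscale d U)^~ s : a b / a + b}.
Proof. by move=> f g; apply: hfun_inj => x /=; exact: mulrDl. Qed.
HB.instance Definition _ d U := GRing.Zmodule_isLmodule.Build (regfun U)
  (hfun d U) (@hscaleA d U) (@hscale1 d U) (@hscaleDr d U) (@hscaleDl d U).

Definition covers (I : Type) (V : I -> zopen) U : Prop :=
  (forall i, zsub (V i) U) /\ (forall x, U x -> exists i, V i x).

Record is_sheaf (sec : forall U : zopen, lmodType (regfun U))
    (res : forall U V, zsub V U -> sec U -> sec V) : Prop := IsSheaf {
  _ : forall U V (VU : zsub V U) a (s t : sec U),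
    res U V VU (a *: s + t) = rres VU a *: res U V VU s + res U V VU t;
  _ : forall U (UU : zsub U U) (s : sec U), res U U UU s = s;
  _ : forall U V W (VU : zsub V U) (WV : zsub W V) (WU : zsub W U) (s : sec U),
    res V W WV (res U V VU s) = res U W WU s;
  _ : forall U (I : Type) (V : I -> zopen), covers V U -> forall s t : sec U,
    (forall i (VU : zsub (V i) U), res U (V i) VU s = res U (V i) VU t) -> s = t;
  _ : forall U (I : Type) (V : I -> zopen), covers V U ->
    forall f : forall i, sec (V i),
    (forall i j W (Wi : zsub W (V i)) (Wj : zsub W (V j)),
       res (V i) W Wi (f i) = res (V j) W Wj (f j)) ->
    exists s : sec U, forall i (VU : zsub (V i) U), res U (V i) VU s = f i }.

Record omodule := OModule {
  sec :> forall U : zopen, lmodType (regfun U);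
  res : forall U V : zopen, zsub V U -> sec U -> sec V;
  omoduleP : is_sheaf res }.
Arguments res M {U V} VU s : rename.
Implicit Types (M N : omodule).

Record omor (M N : omodule) := OMor {
  omor_fun :> forall U : zopen, M U -> N U;
  omor_linear : forall U a (s t : M U),
    omor_fun (a *: s + t) = a *: omor_fun s + omor_fun t;
  omor_res : forall U V (VU : zsub V U) (s : M U),
    omor_fun (res M VU s) = res N VU (omor_fun s) }.

Definition oiso (M N : omodule) : Prop :=
  exists (f : omor M N) (g : omor N M),
    forall U, cancel (@f U) (@g U) /\ cancel (@g U) (@f U).

Section ModuleTheory.
Variable M : omodule.

Lemma res_linear U V (VU : zsub V U) a (s t : M U) :
  res M VU (a *: s + t) = rres VU a *: res M VU s + res M VU t.
Proof. by case: (omoduleP M). Qed.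

Lemma res_id U (UU : zsub U U) (s : M U) : res M UU s = s.
Proof. by case: (omoduleP M). Qed.

Lemma res_comp U V W (VU : zsub V U) (WV : zsub W V) (WU : zsub W U) (s : M U) :
  res M WV (res M VU s) = res M WU s.
Proof. by case: (omoduleP M). Qed.

Lemma sec_separated U (I : Type) (V : I -> zopen) :
  covers V U -> forall s t : M U,
  (forall i (VU : zsub (V i) U), res M VU s = res M VU t) -> s = t.
Proof. by case: (omoduleP M) => _ _ _ H _; exact: H. Qed.

Lemma sec_glue U (I : Type) (V : I -> zopen) :
  covers V U -> forall f : forall i, M (V i),
  (forall i j W (Wi : zsub W (V i)) (Wj : zsub W (V j)),
     res M Wi (f i) = res M Wj (f j)) ->
  exists s : M U, forall i (VU : zsub (V i) U), res M VU s = f i.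
Proof. by case: (omoduleP M) => _ _ _ _ H; exact: H. Qed.

Lemma rres1 U V (VU : zsub V U) : rres VU 1 = 1.
Proof. exact: hfun_inj. Qed.

Lemma rres_comp U V W (VU : zsub V U) (WV : zsub W V) (WU : zsub W U)
  (a : regfun U) : rres WV (rres VU a) = rres WU a.
Proof. by apply: hfun_inj => x; congr (a _); exact: pts_inj. Qed.

Lemma resD U V (VU : zsub V U) : {morph res M VU : s t / s + t}.
Proof.
by move=> s t; have := res_linear VU 1 s t; rewrite rres1 !scale1r.
Qed.

Lemma res0 U V (VU : zsub V U) : res M VU 0 = 0.
Proof. by apply: (addrI (res M VU 0)); rewrite -resD !addr0. Qed.

Lemma resN U V (VU : zsub V U) : {morph res M VU : s / - s}.
Proof. by move=> s; apply: (addrI (res M VU s)); rewrite -resD !subrr res0. Qed.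

Lemma resZ U V (VU : zsub V U) a s :
  res M VU (a *: s) = rres VU a *: res M VU s.
Proof. by rewrite -[a *: s]addr0 res_linear res0 addr0. Qed.

Lemma res_irr U V (VU VU' : zsub V U) s : res M VU s = res M VU' s.
Proof. by rewrite (Prop_irrelevance VU VU'). Qed.

Lemma sec_local U (s t : M U) :
  (forall x, U x ->
     exists V (VU : zsub V U), V x /\ res M VU s = res M VU t) -> s = t.
Proof.
move=> H; pose c (x : pts U) := cid (H _ (svalP x)).
apply: (sec_separated (V := fun x => sval (c x))).
  split=> [x|x Ux]; first by case: (svalP (c x)).
  by exists (exist U x Ux); case: (svalP (c (exist U x Ux))) => ? [].
move=> x VU; case: (svalP (c x)) => VU' [_ e].
by rewrite (res_irr VU VU' s) (res_irr VU VU' t).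
Qed.

Lemma omor0 N (f : omor M N) U : f U 0 = 0.
Proof.
have := omor_linear f 1 (0 : M U) 0; rewrite !scale1r addr0 => e.
by apply: (addrI (f U 0)); rewrite -e addr0.
Qed.
End ModuleTheory.

Lemma hfun_separated d U (I : Type) (V : I -> zopen) :
  covers V U -> forall s t : hfun d U,
  (forall i (VU : zsub (V i) U), hres VU s = hres VU t) -> s = t.
Proof.
move=> [VU cov] s t e; apply: hfun_inj => x.
have [i Vi] := cov _ (svalP x).
have := congr1 (fun h : hfun _ _ => h (exist (V i) _ Vi)) (e i (VU i)).
by rewrite /=; set y := pt_in _ _; rewrite (_ : y = x) //; exact: pts_inj.
Qed.

Lemma hfun_glue_cover d U (I : Type) (V : I -> zopen) :
  covers V U -> forall f : forall i, hfun d (V i),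
  (forall i j W (Wi : zsub W (V i)) (Wj : zsub W (V j)),
     hres Wi (f i) = hres Wj (f j)) ->
  exists s : hfun d U, forall i (VU : zsub (V i) U), hres VU s = f i.
Proof.
move=> [VU cov] f /(hfun_glue VU cov)[s sE].
by exists s => i VU'; rewrite -sE; apply: hfun_inj => x; congr (s _); exact: pts_inj.
Qed.

Program Definition OQ (d : int) : omodule :=
  @OModule (fun U => hfun d U) (fun U V VU s => hres VU s) _.
Next Obligation.
move=> d; split.
- by move=> U V VU a s t; exact: hfun_inj.
- by move=> U UU s; apply: hfun_inj => x; congr (s _); exact: pts_inj.
- by move=> U V W VU WV WU s; apply: hfun_inj => x; congr (s _); exact: pts_inj.
- exact: hfun_separated.
- exact: hfun_glue_cover.
Qed.

Program Definition osum (n : nat) (M : omodule) : omodule :=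
  @OModule (fun U => {ffun 'I_n -> M U})
  (fun U V VU s => [ffun i => res M VU (s i)]) _.
Next Obligation.
move=> n M; split.
- by move=> U V VU a s t; apply/ffunP=> i; rewrite !ffunE res_linear.
- by move=> U UU s; apply/ffunP=> i; rewrite ffunE res_id.
- by move=> U V W VU WV WU s; apply/ffunP=> i; rewrite !ffunE (res_comp VU WV WU).
- move=> U I V cov s t e; apply/ffunP=> i; apply: (sec_separated cov) => j VU.
  by have /ffunP/(_ i) := e j VU; rewrite !ffunE.
- move=> U I V cov f fE.
  have /choice[s sE] : forall i : 'I_n, exists s : M U,
      forall j (VU : zsub (V j) U), res M VU s = f j i.
    move=> i; apply: (sec_glue cov (f := fun j => f j i)) => j j' W Wj Wj'.
    by have /ffunP/(_ i) := fE j j' W Wj Wj'; rewrite !ffunE.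
  by exists [ffun i => s i] => j VU; apply/ffunP=> i; rewrite !ffunE.
Qed.

Program Definition obiprod (M N : omodule) : omodule :=
  @OModule (fun U => (M U * N U)%type : lmodType (regfun U))
  (fun U V VU s => (res M VU s.1, res N VU s.2)) _.
Next Obligation.
move=> M N; split.
- by move=> U V VU a s t; rewrite /= !res_linear.
- by move=> U UU [s t]; rewrite /= !res_id.
- by move=> U V W VU WV WU s; rewrite /= !(res_comp VU WV WU).
- move=> U I V cov [s s'] [t t'] e; congr pair; apply: (sec_separated cov) => j VU;
  by case: (e j VU).
- move=> U I V cov f fE.
  have [|s sE] := sec_glue cov (f := fun j => (f j).1).
    by move=> i j W Wi Wj; case: (fE i j W Wi Wj).
  have [|t tE] := sec_glue cov (f := fun j => (f j).2).
    by move=> i j W Wi Wj; case: (fE i j W Wi Wj).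
  by exists (s, t) => j VU; rewrite /= sE tE; case: (f j).
Qed.

Record subsheaf (M : omodule) := SubSheaf {
  smem : forall U, M U -> Prop;
  smem0 : forall U, smem (0 : M U);
  smem_linear : forall U a (s t : M U), smem s -> smem t -> smem (a *: s + t);
  smem_res : forall U V (VU : zsub V U) (s : M U), smem s -> smem (res M VU s);
  smem_local : forall U (s : M U),
    (forall x, U x -> exists V (VU : zsub V U), V x /\ smem (res M VU s)) ->
    smem s }.

Record ssec M (P : subsheaf M) U :=
  SSec { ssval :> M U; ssvalP : `[< smem P ssval >] }.
HB.instance Definition _ M P U := [isSub of @ssec M P U for @ssval M P U].
HB.instance Definition _ M P U := [Choice of @ssec M P U by <:].
Lemma ssec_submod M (P : subsheaf M) U :
  submod_closed ((fun s : M U => `[< smem P s >]) : {pred M U}).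
Proof.
split; first exact/asboolP/smem0.
by move=> a s t /asboolP Ps /asboolP Pt; apply/asboolP/smem_linear.
Qed.
HB.instance Definition _ M P U :=
  GRing.SubChoice_isSubLmodule.Build _ _ _ (@ssec M P U) (@ssec_submod M P U).

Lemma ssec_res M (P : subsheaf M) U V (VU : zsub V U) (s : ssec P U) :
  smem P (res M VU (ssval s)).
Proof. by apply: smem_res; apply/asboolP/ssvalP. Qed.

Program Definition osub M (P : subsheaf M) : omodule :=
  @OModule (fun U => ssec P U)
  (fun U V VU s => SSec (asboolT (ssec_res VU s))) _.
Next Obligation.
move=> M P; split.
- by move=> U V VU a s t; apply: val_inj; rewrite /= res_linear.
- by move=> U UU s; apply: val_inj; rewrite /= res_id.
- by move=> U V W VU WV WU s; apply: val_inj; rewrite /= (res_comp VU WV WU).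
- move=> U I V cov s t e; apply: val_inj; apply: (sec_separated cov) => i VU.
  by have /(congr1 val) := e i VU.
- move=> U I V cov f fE.
  have [|s sE] := sec_glue cov (f := fun i => ssval (f i)).
    by move=> i j W Wi Wj; have /(congr1 val) := fE i j W Wi Wj.
  have Ps : smem P s.
    apply: smem_local => x Ux; have [i Vi] := cov.2 x Ux.
    exists (V i), (cov.1 i); split=> //; rewrite sE.
    by apply/asboolP/ssvalP.
  by exists (SSec (asboolT Ps)) => i VU; apply: val_inj; exact: sE.
Qed.

(* [s] is locally the image of a section: membership in the image sheaf. *)
Definition in_image M N (f : omor M N) U (s : N U) : Prop :=
  forall x, U x -> exists V (VU : zsub V U),
    V x /\ exists t : M V, f V t = res N VU s.

Program Definition image_subsheaf M N (f : omor M N) : subsheaf N :=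
  @SubSheaf N (@in_image M N f) _ _ _ _.
Next Obligation.
move=> M N f.
by move=> U x Ux; exists U, (@zsub_refl U); split=> //; exists 0; rewrite omor0 res0.
Qed.
Next Obligation.
move=> M N f.
move=> U a s t Hs Ht x Ux.
have [V [VU [Vx [s' s'E]]]] := Hs x Ux.
have [W [WU [Wx [t' t'E]]]] := Ht x Ux.
pose Z := zmeet V W.
have ZU : zsub Z U := zsub_trans (@zmeetl V W) VU.
exists Z, ZU; split; first by split.
exists (rres ZU a *: res M (@zmeetl V W) s' + res M (@zmeetr V W) t').
by rewrite omor_linear !omor_res s'E t'E res_linear
  (res_comp VU (@zmeetl V W) ZU) (res_comp WU (@zmeetr V W) ZU).
Qed.
Next Obligation.
move=> M N f.
move=> U V VU s Hs x Vx; have [W [WU [Wx [t tE]]]] := Hs x (VU _ Vx).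
exists (zmeet V W), (@zmeetl V W); split; first by split.
exists (res M (@zmeetr V W) t); rewrite omor_res tE.
have ZU : zsub (zmeet V W) U := zsub_trans (@zmeetr V W) WU.
by rewrite (res_comp WU _ ZU) (res_comp VU _ ZU).
Qed.
Next Obligation.
move=> M N f.
move=> U s H x Ux; have [V [VU [Vx /(_ x Vx)[W [WV [Wx [t tE]]]]]]] := H x Ux.
exists W, (zsub_trans WV VU); split=> //.
by exists t; rewrite tE; apply: res_comp.
Qed.

Program Definition kernel_subsheaf M N (f : omor M N) : subsheaf M :=
  @SubSheaf M (fun U s => f U s = 0) _ _ _ _.
Next Obligation.
move=> M N f.
by move=> U; exact: omor0.
Qed.
Next Obligation.
move=> M N f.
move=> U a s t /= fs ft; by rewrite omor_linear fs ft scaler0 addr0.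
Qed.
Next Obligation.
move=> M N f.
by move=> U V VU s /= fs; rewrite omor_res fs res0.
Qed.
Next Obligation.
move=> M N f.
move=> U s H; apply: sec_local => x /H[V [VU [Vx e]]].
by exists V, VU; split=> //; rewrite -omor_res e res0.
Qed.

Definition oimage M N (f : omor M N) : omodule := osub (image_subsheaf f).
Definition okernel M N (f : omor M N) : omodule := osub (kernel_subsheaf f).

Record dsec M U := DSec {
  dval :> forall V, zsub V U -> M V -> regfun V;
  dval_linear : forall V (VU : zsub V U) a (s t : M V),
    dval VU (a *: s + t) = a * dval VU s + dval VU t;
  dval_res : forall V W (VU : zsub V U) (WV : zsub W V) (WU : zsub W U) (s : M V),
    dval WU (res M WV s) = rres WV (dval VU s) }.
HB.instance Definition _ M U := gen_eqMixin (dsec M U).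
HB.instance Definition _ M U := gen_choiceMixin (dsec M U).

Lemma dsec_inj M U (f g : dsec M U) :
  (forall V (VU : zsub V U) s, f V VU s = g V VU s) -> f = g.
Proof.
case: f g => [f fl fr] [g gl gr] /= e.
have {}e : f = g.
  by apply: functional_extensionality_dep => V;
     apply: functional_extensionality_dep => VU; apply/funext => s.
by case: g / e gl gr => gl gr; congr DSec; exact: Prop_irrelevance.
Qed.

Program Definition dzero M U : dsec M U :=
  @DSec _ _ (fun _ _ _ => 0) _ _.
Next Obligation.
move=> M U.
by move=> * /=; rewrite mulr0 addr0.
Qed.
Next Obligation.
move=> M U.
by move=> * /=; exact: hfun_inj.
Qed.

Program Definition dopp M U (f : dsec M U) : dsec M U :=
  @DSec _ _ (fun V VU s => - f V VU s) _ _.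
Next Obligation.
move=> M U f.
by move=> * /=; rewrite dval_linear opprD mulrN.
Qed.
Next Obligation.
move=> M U f.
by move=> V W VU WV WU s /=; rewrite (dval_res f VU WV WU); exact: hfun_inj.
Qed.

Program Definition dadd M U (f g : dsec M U) : dsec M U :=
  @DSec _ _ (fun V VU s => f V VU s + g V VU s) _ _.
Next Obligation.
move=> M U f g.
by move=> * /=; rewrite !dval_linear mulrDr addrACA.
Qed.
Next Obligation.
move=> M U f g.
by move=> V W VU WV WU s /=; rewrite !(dval_res _ VU WV WU); exact: hfun_inj.
Qed.

Program Definition dscale M U (a : regfun U) (f : dsec M U) : dsec M U :=
  @DSec _ _ (fun V VU s => rres VU a * f V VU s) _ _.
Next Obligation.
move=> M U a f.
by move=> * /=; rewrite dval_linear mulrDr mulrCA.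
Qed.
Next Obligation.
move=> M U a f.
move=> V W VU WV WU s /=; rewrite (dval_res f VU WV WU).
by apply: hfun_inj => x; congr (a _ * _); exact: pts_inj.
Qed.

Lemma daddA M U : associative (@dadd M U).
Proof. by move=> *; apply: dsec_inj => * /=; rewrite addrA. Qed.
Lemma daddC M U : commutative (@dadd M U).
Proof. by move=> *; apply: dsec_inj => * /=; rewrite addrC. Qed.
Lemma dadd0 M U : left_id (dzero M U) (@dadd M U).
Proof. by move=> *; apply: dsec_inj => * /=; rewrite add0r. Qed.
Lemma daddN M U : left_inverse (dzero M U) (@dopp M U) (@dadd M U).
Proof. by move=> *; apply: dsec_inj => * /=; rewrite addNr. Qed.
HB.instance Definition _ M U := GRing.isZmodule.Build (dsec M U)
  (@daddA M U) (@daddC M U) (@dadd0 M U) (@daddN M U).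

Lemma dscaleA M U (a b : regfun U) (f : dsec M U) :
  dscale a (dscale b f) = dscale (a * b) f.
Proof.
by apply: dsec_inj => V VU s /=; rewrite mulrA; congr (_ * _); exact: hfun_inj.
Qed.

Lemma dscale1 M U : left_id 1 (@dscale M U).
Proof. by move=> f; apply: dsec_inj => * /=; rewrite rres1 mul1r. Qed.
Lemma dscaleDr M U : right_distributive (@dscale M U) +%R.
Proof. by move=> *; apply: dsec_inj => * /=; rewrite mulrDr. Qed.
Lemma dscaleDl M U (f : dsec M U) : {morph (@dscale M U)^~ f : a b / a + b}.
Proof.
move=> a b; apply: dsec_inj => V VU s /=.
by rewrite -mulrDl; congr (_ * _); exact: hfun_inj.
Qed.
HB.instance Definition _ M U := GRing.Zmodule_isLmodule.Build (regfun U)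
  (dsec M U) (@dscaleA M U) (@dscale1 M U) (@dscaleDr M U) (@dscaleDl M U).

Program Definition dres M U V (VU : zsub V U) (f : dsec M U) : dsec M V :=
  @DSec _ _ (fun W WV => f W (zsub_trans WV VU)) _ _.
Next Obligation.
move=> M U V VU f.
by move=> * /=; exact: dval_linear.
Qed.
Next Obligation.
move=> M U V VU f.
by move=> * /=; exact: dval_res.
Qed.

Lemma dval_irr M U (f : dsec M U) V (VU VU' : zsub V U) s :
  f V VU s = f V VU' s.
Proof. by rewrite (Prop_irrelevance VU VU'). Qed.

Lemma covers_meet (I : Type) (V : I -> zopen) U W :
  covers V U -> zsub W U -> covers (fun i => zmeet W (V i)) W.
Proof.
move=> [VU cov] WU; split=> [i|x Wx]; first exact: zmeetl.
by have [i Vi] := cov x (WU _ Wx); exists i.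
Qed.

Program Definition odual (M : omodule) : omodule :=
  @OModule (fun U => dsec M U) (@dres M) _.
Next Obligation.
move=> M; split.
- move=> U V VU a s t; apply: dsec_inj => W WV f.
  by rewrite -[RHS]/(rres WV (rres VU a) * s W _ f + t W _ f)
    (rres_comp VU WV (zsub_trans WV VU)).
- by move=> U UU s; apply: dsec_inj => V VU f /=; exact: dval_irr.
- by move=> U V W VU WV WU s; apply: dsec_inj => Z ZW f /=; exact: dval_irr.
- move=> U I V cov f g e; apply: dsec_inj => W WU s.
  apply: (hfun_separated (covers_meet cov WU)) => i ZW.
  have ZV : zsub (zmeet W (V i)) (V i) := @zmeetr _ _.
  have ZU := zsub_trans ZW WU.
  have := congr1 (fun h : dsec M (V i) => h _ ZV (res M ZW s)) (e i (cov.1 i)).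
  rewrite /= !(dval_irr _ (zsub_trans _ _) ZU).
  by rewrite !(dval_res _ WU ZW ZU).
- move=> U I V cov f fE.
  have fE' i j W (Wi : zsub W (V i)) (Wj : zsub W (V j)) s :
      f i W Wi s = f j W Wj s.
    have := congr1 (fun h : dsec M W => h W (@zsub_refl W) s) (fE i j W Wi Wj).
    by rewrite /= (dval_irr (f i) _ Wi) (dval_irr (f j) _ Wj).
  have gP W (WU : zsub W U) (s : M W) : {a : regfun W |
      forall i Z (ZW : zsub Z W) (ZV : zsub Z (V i)),
        rres ZW a = f i Z ZV (res M ZW s)}.
    apply: cid.
    pose h i : regfun (zmeet W (V i)) :=
      f i _ (@zmeetr W (V i)) (res M (@zmeetl W (V i)) s).
    have [|a aE] := hfun_glue_cover (covers_meet cov WU) (f := h).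
      move=> i j Z Zi Zj.
      rewrite -[hres _ _]/(rres Zi _) -[hres Zj _]/(rres Zj _) /h.
      rewrite -(dval_res _ _ _ (zsub_trans Zi (@zmeetr _ _))).
      rewrite -(dval_res _ _ _ (zsub_trans Zj (@zmeetr _ _))).
      rewrite !(res_comp _ _ (zsub_trans Zi (@zmeetl _ _))).
      exact: fE'.
    exists a => i Z ZW ZV.
    have Zm : zsub Z (zmeet W (V i)) by move=> x Zx; split; [exact: ZW|exact: ZV].
    have := congr1 (rres Zm) (aE i (@zmeetl _ _)).
    rewrite /h -(dval_res _ _ _ ZV) (res_comp _ _ ZW) => <-.
    by apply: hfun_inj => x; congr (a _); exact: pts_inj.
  pose g W WU s := sval (gP W WU s).
  have gE W (WU : zsub W U) s : forall i Z (ZW : zsub Z W) (ZV : zsub Z (V i)),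
    rres ZW (g W WU s) = f i Z ZV (res M ZW s) := svalP (gP W WU s).
  have gl W (WU : zsub W U) a (s t : M W) :
      g W WU (a *: s + t) = a * g W WU s + g W WU t.
    apply: (hfun_separated (covers_meet cov WU)) => i ZW.
    rewrite -[LHS]/(rres ZW _) (gE _ _ _ _ _ _ (@zmeetr W (V i))).
    rewrite res_linear dval_linear -!(gE _ WU).
    exact: hfun_inj.
  have gr W Z (WU : zsub W U) (ZW : zsub Z W) (ZU : zsub Z U) (s : M W) :
      g Z ZU (res M ZW s) = rres ZW (g W WU s).
    apply: (hfun_separated (covers_meet cov ZU)) => i YZ.
    rewrite -[LHS]/(rres YZ _) (gE _ _ _ _ _ _ (@zmeetr Z (V i))).
    rewrite (res_comp _ _ (zsub_trans YZ ZW)) -(gE _ WU).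
    by rewrite -[RHS]/(rres YZ _) (rres_comp _ _ (zsub_trans YZ ZW)).
  exists (DSec gl gr) => i VU; apply: dsec_inj => W WV s /=.
  have := gE W (zsub_trans WV VU) s i W (@zsub_refl W) WV.
  rewrite res_id => <-; apply: hfun_inj => x.
  by congr (g _ _ _ _); exact: pts_inj.
Qed.

(* The function (z_j / z_i)^d. *)
Definition ratio d i j U (Ui : zsub U (chart i)) (Uj : zsub U (chart j)) :
  regfun U := hmul (subrr d) (hpow d Uj) (hpow (- d) Ui).

(* M(d) is glued from the sheaves M|_{z_i != 0} by means of the transition
   functions (z_j / z_i)^d: a section of M(d) is a family of sections s_i of M,
   to be thought of as s_i (x) z_i^d, with s_i = (z_j / z_i)^d s_j. *)
Record tsec M d U := TSec {
  tval :> forall i : 'I_7, M (zmeet U (chart i));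
  tvalP : forall i j W (Wi : zsub W (zmeet U (chart i)))
      (Wj : zsub W (zmeet U (chart j))),
    res M Wi (tval i) =
    ratio d (zsub_trans Wi (@zmeetr _ _)) (zsub_trans Wj (@zmeetr _ _)) *:
    res M Wj (tval j) }.
HB.instance Definition _ M d U := gen_eqMixin (tsec M d U).
HB.instance Definition _ M d U := gen_choiceMixin (tsec M d U).

Lemma tsec_inj M d U (s t : tsec M d U) : (forall i, s i = t i) -> s = t.
Proof.
case: s t => [s sP] [t tP] /= e.
have {}e : s = t by apply: functional_extensionality_dep.
by case: t / e tP => tP; congr TSec; exact: Prop_irrelevance.
Qed.

Program Definition tzero M d U : tsec M d U := @TSec M d U (fun i => 0) _.
Next Obligation. by move=> M d U i j W Wi Wj; rewrite !res0 scaler0. Qed.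

Program Definition topp M d U (s : tsec M d U) : tsec M d U :=
  @TSec M d U (fun i => - s i) _.
Next Obligation.
by move=> M d U s i j W Wi Wj; rewrite !resN (tvalP s Wi Wj) scalerN.
Qed.

Program Definition tadd M d U (s t : tsec M d U) : tsec M d U :=
  @TSec M d U (fun i => s i + t i) _.
Next Obligation.
move=> M d U s t i j W Wi Wj.
by rewrite !resD (tvalP s Wi Wj) (tvalP t Wi Wj) scalerDr.
Qed.

Program Definition tscale M d U (a : regfun U) (s : tsec M d U) : tsec M d U :=
  @TSec M d U (fun i => rres (@zmeetl U (chart i)) a *: s i) _.
Next Obligation.
move=> M d U a s i j W Wi Wj; have WU := zsub_trans Wi (@zmeetl _ _).
rewrite !resZ !(rres_comp _ _ WU) (tvalP s Wi Wj) !scalerA.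
by congr (_ *: _); exact: mulrC.
Qed.

Lemma taddA M d U : associative (@tadd M d U).
Proof. by move=> *; apply: tsec_inj => * /=; rewrite addrA. Qed.
Lemma taddC M d U : commutative (@tadd M d U).
Proof. by move=> *; apply: tsec_inj => * /=; rewrite addrC. Qed.
Lemma tadd0 M d U : left_id (tzero M d U) (@tadd M d U).
Proof. by move=> *; apply: tsec_inj => * /=; rewrite add0r. Qed.
Lemma taddN M d U : left_inverse (tzero M d U) (@topp M d U) (@tadd M d U).
Proof. by move=> *; apply: tsec_inj => * /=; rewrite addNr. Qed.
HB.instance Definition _ M d U := GRing.isZmodule.Build (tsec M d U)
  (@taddA M d U) (@taddC M d U) (@tadd0 M d U) (@taddN M d U).

Lemma tscaleA M d U (a b : regfun U) (s : tsec M d U) :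
  tscale a (tscale b s) = tscale (a * b) s.
Proof.
by apply: tsec_inj => i /=; rewrite scalerA; congr (_ *: _); exact: hfun_inj.
Qed.

Lemma tscale1 M d U : left_id 1 (@tscale M d U).
Proof. by move=> s; apply: tsec_inj => i /=; rewrite rres1 scale1r. Qed.
Lemma tscaleDr M d U : right_distributive (@tscale M d U) +%R.
Proof. by move=> *; apply: tsec_inj => i /=; rewrite scalerDr. Qed.
Lemma tscaleDl M d U (s : tsec M d U) : {morph (@tscale M d U)^~ s : a b / a + b}.
Proof.
move=> a b; apply: tsec_inj => i /=.
by rewrite -scalerDl; congr (_ *: _); exact: hfun_inj.
Qed.
HB.instance Definition _ M d U := GRing.Zmodule_isLmodule.Build (regfun U)
  (tsec M d U) (@tscaleA M d U) (@tscale1 M d U) (@tscaleDr M d U)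
  (@tscaleDl M d U).

Program Definition tres M d U V (VU : zsub V U) (s : tsec M d U) : tsec M d V :=
  @TSec M d V (fun i => res M (zmeetS VU) (s i)) _.
Next Obligation.
move=> M d U V VU s i j W Wi Wj.
rewrite (res_comp _ _ (zsub_trans Wi (zmeetS VU))).
rewrite (res_comp _ _ (zsub_trans Wj (zmeetS VU))).
rewrite (tvalP s (zsub_trans Wi (zmeetS VU)) (zsub_trans Wj (zmeetS VU))).
by congr (_ *: _); exact: hfun_inj.
Qed.

Program Definition twist (M : omodule) (d : int) : omodule :=
  @OModule (fun U => tsec M d U) (@tres M d) _.
Next Obligation.
move=> M d; split.
- move=> U V VU a s t; apply: tsec_inj => i /=.
  rewrite res_linear; congr (_ *: _ + _).
  have Vi : zsub (zmeet V (chart i)) U by move=> x [/VU].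
  by rewrite !(rres_comp _ _ Vi).
- by move=> U UU s; apply: tsec_inj => i /=; rewrite (res_irr _ (@zsub_refl _)) res_id.
- by move=> U V W VU WV WU s; apply: tsec_inj => i /=; exact: res_comp.
- move=> U I V cov s t e; apply: tsec_inj => i.
  apply: sec_local => x [Ux xi]; have [a Va] := cov.2 x Ux.
  exists (zmeet (V a) (chart i)), (zmeetS (cov.1 a)); split=> //.
  exact: (congr1 (fun h : tsec M d (V a) => tval h i) (e a (cov.1 a))).
- move=> U I V cov f fE.
  have fE' i a b W (Wa : zsub W (zmeet (V a) (chart i)))
      (Wb : zsub W (zmeet (V b) (chart i))) :
      res M Wa (f a i) = res M Wb (f b i).
    have Wm : zsub W (zmeet W (chart i)).
      by move=> x Wx; split=> //; exact: (Wa x Wx).2.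
    have := congr1 (fun h : tsec M d W => res M Wm (h i))
      (fE a b W (zsub_trans Wa (@zmeetl _ _)) (zsub_trans Wb (@zmeetl _ _))).
    by rewrite /= (res_comp _ _ Wa) (res_comp _ _ Wb).
  have covi i : covers (fun a => zmeet (V a) (chart i)) (zmeet U (chart i)).
    split=> [a|x [Ux xi]]; first exact: zmeetS (cov.1 a).
    by have [a Va] := cov.2 x Ux; exists a.
  pose g i := cid (sec_glue (covi i) (fE' i)).
  pose s i := sval (g i).
  have sE i a (Vi : zsub (zmeet (V a) (chart i)) (zmeet U (chart i))) :
    res M Vi (s i) = f a i := svalP (g i) a Vi.
  have sP i j W (Wi : zsub W (zmeet U (chart i)))
      (Wj : zsub W (zmeet U (chart j))) :
    res M Wi (s i) =
    ratio d (zsub_trans Wi (@zmeetr _ _)) (zsub_trans Wj (@zmeetr _ _)) *: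
    res M Wj (s j).
    apply: sec_local => x Wx; have [a Va] := cov.2 x (Wi x Wx).1.
    exists (zmeet W (V a)), (@zmeetl _ _); split=> //.
    have Zi : zsub (zmeet W (V a)) (zmeet (V a) (chart i)).
      by move=> y [/Wi[]].
    have Zj : zsub (zmeet W (V a)) (zmeet (V a) (chart j)).
      by move=> y [/Wj[]].
    rewrite resZ.
    rewrite (res_comp _ _ (zsub_trans Zi (zmeetS (cov.1 a)))).
    rewrite (res_comp _ _ (zsub_trans Zj (zmeetS (cov.1 a)))).
    rewrite -(res_comp (zmeetS (cov.1 a)) Zi) -(res_comp (zmeetS (cov.1 a)) Zj).
    rewrite !sE (tvalP (f a) Zi Zj).
    by congr (_ *: _); exact: hfun_inj.
  by exists (TSec sP) => a VU; apply: tsec_inj => i /=; exact: sE.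
Qed.

Definition locally_free (r : nat) (M : omodule) : Prop :=
  forall x, on_cone x -> exists V : zopen, V x /\
  exists e : 'I_r -> M V, forall W (WV : zsub W V) (s : M W),
    exists! c : {ffun 'I_r -> regfun W}, s = \sum_i c i *: res M WV (e i).

Definition indecomposable (M : omodule) : Prop :=
  ~ (forall U (s : M U), s = 0) /\
  forall N N' : omodule, oiso M (obiprod N N') ->
    (forall U (s : N U), s = 0) \/ (forall U (s : N' U), s = 0).

(* The value of s in the fibre of M at x is zero: s lies in m_x M_x. *)
Definition vanishes_at M U (s : M U) (x : vec) : Prop :=
  exists V (VU : zsub V U) (Vx : V x) (n : nat)
    (a : 'I_n -> regfun V) (t : 'I_n -> M V),
  (forall i, a i (exist _ x Vx) = 0) /\ res M VU s = \sum_i a i *: t i.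

Definition nowhere_vanishing M (s : M zfull) : Prop :=
  forall x, on_cone x -> ~ vanishes_at s x.

Definition injective_on_fibres M N (f : omor M N) : Prop :=
  forall U (s : M U) x, U x -> vanishes_at (f U s) x -> vanishes_at s x.

Definition osurjective M N (f : omor M N) : Prop :=
  forall U (s : N U), in_image f s.

Definition short_exact M N P (f : omor M N) (g : omor N P) : Prop :=
  [/\ forall U, injective (@f U),
      forall U (s : N U), g U s = 0 <-> in_image f s &
      osurjective g].

Program Definition section_mor M (s : M zfull) : omor (OQ 0) M :=
  @OMor (OQ 0) M
    (fun U (a : hfun 0 U) => (a : regfun U) *: res M (@zsub_full U) s) _ _.
Next Obligation.
move=> M s U a b c /=; rewrite scalerDl scalerA; congr (_ *: _ + _).
exact: hfun_inj.
Qed.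
Next Obligation.
move=> M s U V VU a /=; rewrite resZ (res_comp _ _ (@zsub_full V)).
by congr (_ *: _); exact: hfun_inj.
Qed.

Definition h0_eq M (n : nat) : Prop :=
  exists e : 'I_n -> M zfull, forall s : M zfull,
  exists! c : {ffun 'I_n -> k}, s = \sum_i hcst zfull (c i) *: e i.

(* Cech complex of the covering by the affine open sets z_i != 0, with cochains
   indexed by all the tuples of indices; it computes the cohomology of
   quasi-coherent sheaves. *)
Definition cochain M (p : nat) : Type :=
  forall t : 'I_p.+1 -> 'I_7, M (zcoord t).

Lemma zcoord_face p (t : 'I_p.+2 -> 'I_7) (j : 'I_p.+2) :
  zsub (zcoord t) (zcoord (t \o lift j)).
Proof. by move=> x [xQ xt]; split=> // i; exact: xt. Qed.

Definition coboundary M p (c : cochain M p) : cochain M p.+1 :=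
  fun t => \sum_(j < p.+2)
    (-1) ^+ j *: res M (@zcoord_face p t j) (c (t \o lift j)).

Definition cohomology_vanishes M (i : nat) : Prop :=
  forall c : cochain M i, (forall t, coboundary c t = 0) ->
  match i return cochain M i -> Prop with
  | 0 => fun c => forall t, c t = 0
  | p.+1 => fun c => exists b : cochain M p, forall t, c t = coboundary b t
  end c.

(* Up to isomorphism these properties single out one sheaf. The last one says
   that h^0(S) = 0 and h^0(S(1)) = 8. *)
Definition spinor_bundle (S : omodule) : Prop :=
  [/\ locally_free 4 S,
      indecomposable S,
      forall (i : nat) (t : int), (0 < i < 5)%N ->
        cohomology_vanishes (twist S t) i,
      oiso (odual S) (twist S 1) &
      h0_eq S 0 /\ h0_eq (twist S 1) 8].

Definition is_monad M N P (f : omor M N) (g : omor N P) : Prop :=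
  [/\ injective_on_fibres f, osurjective g & forall U (s : M U), g U (f U s) = 0].

(* C is isomorphic to ker g / im f. *)
Definition monad_cohomology M N P (f : omor M N) (g : omor N P) (C : omodule) :
  Prop :=
  exists pi : omor (okernel g) C, osurjective pi /\
    forall U (s : okernel g U), pi U s = 0 <-> in_image f (ssval s).

(* All these bundles are called Cayley bundles: the monad depends on the choice
   of an embedding of G_2 in Aut(Q_5). *)
Definition cayley_bundle (C : omodule) : Prop :=
  exists (S : omodule) (f : omor (OQ (-1)) S) (g : omor S (OQ 0)),
    [/\ spinor_bundle S, is_monad f g & monad_cohomology f g C].

Lemma regular_poly r U (P : poly7) :
  P \is r.-homog -> is_regular r (fun x : pts U => P.@[sval x]).
Proof.
move=> hP x; exists U; split; first exact: svalP.
exists r, 0%N, P, 1; split=> //; [exact: dhomog1|exact: subr0|].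
by move=> y _; rewrite meval1 oner_eq0 divr1.
Qed.

Definition hpoly r U (P : poly7) (hP : P \is r.-homog) : hfun r U :=
  mkhfun (@regular_poly r U P hP).

(* The morphism O(d)^n -> O(e)^m given by an m x n matrix of forms of degree
   r = e - d, acting on column vectors. *)
Program Definition matrix_mor m n (A : 'M[poly7]_(m, n)) r
    (hA : forall i j, A i j \is r.-homog) d e (de : r%:Z + d = e) :
    omor (osum n (OQ d)) (osum m (OQ e)) :=
  @OMor (osum n (OQ d)) (osum m (OQ e))
    (fun U (s : {ffun 'I_n -> hfun d U}) =>
       [ffun i => \sum_j hmul de (hpoly U (hA i j)) (s j)]) _ _.
Next Obligation.
move=> m n A r hA d e de U a s t /=; apply/ffunP=> i; rewrite !ffunE.
rewrite scaler_sumr -big_split; apply: eq_bigr => j _; rewrite !ffunE.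
by apply: hfun_inj => x /=; rewrite !fctE mulrDr mulrCA.
Qed.
Next Obligation.
move=> m n A r hA d e de U V VU s /=; apply/ffunP=> i; rewrite !ffunE /=.
rewrite -[RHS]/(res (OQ e) VU _).
elim/big_rec2: _ => [|j s1 s2 _ IH]; first by rewrite res0.
by rewrite resD -IH ffunE; congr (_ + _); exact: hfun_inj.
Qed.

Local Notation z := zvar.

Definition tango_matrix : 'M[poly7]_(12, 6) := \matrix_(i, j) nth 0 (nth [::]
  [::
   [:: z 0 ^+ 2; 0; 0; z 1 ^+ 2; z 1 * z 3 + z 0 * z 6;
       - (z 0 * z 4) + z 1 * z 5];
   [:: 0; z 0 ^+ 2; 0; z 1 * z 3 - z 0 * z 6; z 3 ^+ 2; z 0 * z 2 + z 3 * z 5];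
   [:: 0; 0; z 0 ^+ 2; z 0 * z 4 + z 1 * z 5; - (z 0 * z 2) + z 3 * z 5;
       z 5 ^+ 2];
   [:: 0; z 0 * z 2 - z 3 * z 5; z 3 ^+ 2; - (z 0 * z 3) - z 2 * z 6; 0;
       z 2 ^+ 2];
   [:: z 5 ^+ 2; 0; z 0 * z 4 - z 1 * z 5; z 4 ^+ 2;
       - (z 2 * z 4) - z 0 * z 5; 0];
   [:: - (z 3 ^+ 2); z 1 * z 3 + z 0 * z 6; 0; - (z 6 ^+ 2); 0;
       - (z 0 * z 3) + z 2 * z 6];
   [:: 0; z 5 ^+ 2; - (z 0 * z 2) - z 3 * z 5; - (z 2 * z 4) + z 0 * z 5;
       z 2 ^+ 2; 0];
   [:: z 1 * z 3 - z 0 * z 6; - (z 1 ^+ 2); 0; 0; - (z 6 ^+ 2);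
       z 0 * z 1 + z 4 * z 6];
   [:: z 0 * z 4 + z 1 * z 5; 0; - (z 1 ^+ 2); 0; - (z 0 * z 1) + z 4 * z 6;
       - (z 4 ^+ 2)];
   [:: - (z 2 ^+ 2); - (z 2 * z 4) - z 0 * z 5; z 0 * z 3 - z 2 * z 6;
       - (z 0 ^+ 2); 0; 0];
   [:: z 2 * z 4 - z 0 * z 5; z 4 ^+ 2; z 0 * z 1 + z 4 * z 6; 0; z 0 ^+ 2; 0];
   [:: - (z 0 * z 3) - z 2 * z 6; z 0 * z 1 - z 4 * z 6; - (z 6 ^+ 2); 0; 0;
       - (z 0 ^+ 2)]] i) j.

Lemma zvar_homog i : z i \is 1.-homog.
Proof. by rewrite dhomogX /= mdeg1. Qed.

Lemma tango_matrix_homog i j : tango_matrix i j \is 2.-homog.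
Proof.
have h1 a : z a ^+ 2 \is 2.-homog.
  by rewrite expr2; apply: (@dhomogM _ _ _ 1 _ 1); exact: zvar_homog.
have h2 a b : z a * z b \is 2.-homog.
  by apply: (@dhomogM _ _ _ 1 _ 1); exact: zvar_homog.
rewrite mxE; case: i => i lti; case: j => j ltj /=.
by do 12?[case: i lti => [|i] lti //];
   do 6?[case: j ltj => [|j] ltj //];
   rewrite /= ?(dhomog0, rpredD, rpredB, rpredN, h1, h2).
Qed.

Definition tango_mor : omor (osum 6 (OQ (-2))) (osum 12 (OQ 0)) :=
  matrix_mor tango_matrix_homog (addrN 2%:Z).

Definition tangoH : omodule := twist (odual (oimage tango_mor)) (-1).

End Quadric.

(* Main.v *)
(* Identify [k^7] with the imaginary split octonions, so that the norm is the equation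
   of Q_5 up to sign, and let [M(z)] be the matrix of left multiplication by [z]. Then
   [M^2 = q], so on Q_5 the kernel of [M] is its image, and the kernel of
   [M : O^8 -> O(1)^8] is the spinor bundle S: its cohomology is computed by dimension
   shifting along [0 -> S(d) -> O(d)^8 -> S(d + 1) -> 0], its endomorphisms come from
   constant 8 x 8 matrices and hence are scalars, and the bilinear form of the norm
   yields [S^v = S(1)].

   The octonion trace is a surjection [S -> O], whose kernel consists of the imaginary
   octonions annihilated by [z]. Six of their eight coordinates determine them, and
   identify this kernel with the image of the transpose of A, that is, with
   [Im(A)^v(-2) = H(-1)]. Composing the section [O(-1) -> H(-1)] with the inclusion
   [H(-1) -> S] gives the monad [O(-1) -> S -> O], whose cohomology is
   [H(-1) / O(-1) = F(-1)]. *)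
From HB Require Import structures.
From mathcomp Require Import all_boot all_order all_algebra.
From mathcomp Require Import boolp functions.
From mathcomp Require Import mpoly.
From mathcomp Require Import zify ring.
Require Import Defs.
Set Implicit Arguments.
Unset Strict Implicit.
Unset Printing Implicit Defensive.
Import GRing.Theory.
Local Open Scope ring_scope.
Local Obligation Tactic := idtac.
Arguments res {k} M {U V} VU s : rename.

(** All characteristics are treated at once: nothing divides by 2, and imaginary means of trace
    zero. Two devices carry the proof. The bundles are subsheaves of [O(d)^n] cut out by a linear
    condition on the value at each closed point ([PS]), so that morphisms become matrix identities
    on fibres. What makes such sheaves behave like bundles is, on each chart [z_i <> 0], a constant
    matrix [E_i] with [P E_i P = z_i^r P] ([splits]): for [M] it comes from the polarized octonion
    norm, for A from three pivots equal to [z_i^2] up to sign. It yields local preimages,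
    generators, duals, and the passage from a zero value to vanishing in the fibre. The other input
    is the cohomology of [O(d)] in degrees below 5. A regular function is only locally a quotient,
    so the Nullstellensatz is used to write a section over a coordinate open set with powers of the
    coordinates as denominator. The Čech complex then consists of Laurent polynomials, on which a
    homotopy acts monomial by monomial, and dividing out [q] costs one degree. *)

Lemma rmorph_mmap n (R : nzRingType) (S : comNzRingType) (T : comNzRingType) (f : {rmorphism R -> S})
    (g : {rmorphism S -> T}) (h : 'I_n -> S) (p : {mpoly R[n]}) :
  g (mmap f h p) = mmap (g \o f) (g \o h) p.
Proof.
rewrite /mmap rmorph_sum; apply: eq_bigr => m _.
rewrite rmorphM /mmap1 rmorph_prod; congr (_ * _).
by apply: eq_bigr => i _; rewrite rmorphXn.
Qed.

Lemma eq_mmap n (R : nzRingType) (S : nzRingType) (f f' : R -> S)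
    (h h' : 'I_n -> S) (p : {mpoly R[n]}) :
  f =1 f' -> h =1 h' -> mmap f h p = mmap f' h' p.
Proof.
move=> ef eh; rewrite /mmap; apply: eq_bigr => m _; rewrite ef; congr (_ * _).
exact: mmap1_eq.
Qed.

(** Reduction modulo [B] recovers the lowest digit. This is what makes the weights of Nagata's
    substitution below distinguish the monomials of a polynomial. *)
Lemma digits_inj B n (m m' : 'I_n -> nat) :
  (forall i, m i < B)%N -> (forall i, m' i < B)%N ->
  (\sum_(i < n) m i * B ^ i = \sum_(i < n) m' i * B ^ i)%N -> m =1 m'.
Proof.
elim: n m m' => [|n IH] m m' mB mB'; first by move=> _ [].
rewrite !big_ord_recl !expn0 !muln1.
have S (f : 'I_n.+1 -> nat) : (\sum_(i < n) f (lift ord0 i) * B ^ lift ord0 i =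
    (\sum_(i < n) f (lift ord0 i) * B ^ i) * B)%N.
  by rewrite big_distrl; apply: eq_bigr => i _; rewrite lift0 expnSr mulnA.
have B0 : (0 < B)%N by exact: leq_ltn_trans (mB ord0).
rewrite !S => e.
have e0 : m ord0 = m' ord0.
  have := congr1 (modn^~ B) e.
  by rewrite ![(_ + _ * B)%N]addnC !modnMDl !modn_small.
have /IH h : (\sum_(i < n) m (lift ord0 i) * B ^ i =
             \sum_(i < n) m' (lift ord0 i) * B ^ i)%N.
  by move: e; rewrite e0 => /addnI/eqP; rewrite eqn_pmul2r // => /eqP.
move=> i; have [j ->|->//] := unliftP ord0 i.
exact: h.
Qed.

(** * The weak Nullstellensatz, by elimination *)

Section Nullstellensatz.
Variable k : closedFieldType.

(** Nagata's change of variables: the first variable becomes ['X] and every other one is shifted by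
    ['X^(B ^ i)], so that for large [B] a nonzero polynomial becomes monic in ['X] up to a
    constant. *)
Definition nagata_var n (B : nat) (i : 'I_n.+1) : {poly {mpoly k[n]}} :=
  if unlift ord0 i is Some j then 'X^(B ^ i) + ('X_j)%:P else 'X.

Definition nagata n B : {mpoly k[n.+1]} -> {poly {mpoly k[n]}} :=
  mmap (polyC \o @mpolyC n k) (@nagata_var n B).

Lemma nagata_var_monic n B (i : 'I_n.+1) : (0 < B)%N ->
  nagata_var B i \is monic /\ size (nagata_var B i) = (B ^ i).+1.
Proof.
move=> B0; rewrite /nagata_var; case: unliftP => [j ->|->]; last first.
  by rewrite monicX size_polyX.
have sz : (size ('X_j : {mpoly k[n]})%:P < size ('X^(B ^ lift ord0 j) : {poly {mpoly k[n]}}))%N.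
  rewrite size_polyXn size_polyC ltnS; apply: leq_trans (leq_b1 _) _.
  by rewrite expn_gt0 B0.
by rewrite monicE lead_coefDl // lead_coefXn eqxx size_polyDl // size_polyXn.
Qed.

Lemma mmap1_nagata n B (m : 'X_{1..n.+1}) : (0 < B)%N ->
  mmap1 (@nagata_var n B) m \is monic /\
  size (mmap1 (@nagata_var n B) m) = (\sum_(i < n.+1) m i * B ^ i).+1.
Proof.
move=> B0; rewrite /mmap1.
have H i : nagata_var B i ^+ m i \is monic /\
    size (nagata_var B i ^+ m i : {poly {mpoly k[n]}}) = (m i * B ^ i).+1.
  have [mn sz] := nagata_var_monic i B0.
  have mX := monic_exp (m i) mn; split=> //.
  have := size_exp (nagata_var B i) (m i); rewrite sz -pred_Sn mulnC => <-.
  by rewrite prednK // size_poly_gt0 monic_neq0.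
split; first by apply: monic_prod => i _; case: (H i).
elim/big_rec2: _ => [|i p s _ IH]; first by rewrite size_poly1.
have [mn sz] := H i.
by rewrite size_monicM ?sz ?IH -?size_poly_gt0 ?IH //=; lia.
Qed.

(** If [B] exceeds all exponents of [p], distinct monomials are sent to monic polynomials of
    distinct degrees (digits in base [B]). The highest one cannot cancel, and its leading
    coefficient is a coefficient of [p]. *)
Lemma nagata_lead n (p : {mpoly k[n.+1]}) : p != 0 ->
  exists (B : nat) (c : k), c != 0 /\ lead_coef (nagata B p) = c%:MP.
Proof.
move=> p0; pose B := (\max_(m <- msupp p) \max_(i < n.+1) m i).+1.
pose w (m : 'X_{1..n.+1}) := (\sum_(i < n.+1) m i * B ^ i)%N.
have mB (m : 'X_{1..n.+1}) i : m \in msupp p -> (m i < B)%N.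
  move=> mp; rewrite ltnS.
  apply: leq_trans (leq_bigmax_seq (F := fun m : 'X_{1..n.+1} => \max_(i < n.+1) m i)%N m mp isT).
  exact: (leq_bigmax (F := fun i => m i)).
have winj : {in msupp p &, injective w}.
  move=> m m' mp mp' e; apply/mnmP => i.
  by apply: (@digits_inj B) => // j; exact: mB.
have [m0 m0p m0max] : exists2 m0, m0 \in msupp p & forall m, m \in msupp p -> (w m <= w m0)%N.
  have : msupp p != [::] by rewrite msupp_eq0.
  elim: (msupp p) => // m1 s IH _; have [->|/IH[m2 m2s h]] := eqVneq s [::].
    by exists m1; rewrite ?mem_head // => m; rewrite inE => /eqP->.
  have [le|lt] := leqP (w m1) (w m2).
    by exists m2; rewrite ?inE ?m2s ?orbT // => m; rewrite inE => /predU1P[->|/h].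
  exists m1; rewrite ?inE ?eqxx // => m; rewrite inE => /predU1P[->//|/h].
  by move=> /leq_trans; apply; exact: ltnW.
exists B, p@_m0; split; first by rewrite mcoeff_msupp in m0p.
pose P := \sum_(m <- msupp p) (p@_m)%:MP%:P * mmap1 (@nagata_var n B) m.
have E : nagata B p = P by [].
have sz m : m \in msupp p ->
    size ((p@_m)%:MP%:P * mmap1 (@nagata_var n B) m) = (w m).+1.
  move=> mp; have [mn s] := mmap1_nagata (B := B) m isT.
  by rewrite size_Mmonic ?s //= ?size_polyC ?polyC_eq0 ?mpolyC_eq0 -?mcoeff_msupp ?mp.
have coef : P`_(w m0) = (p@_m0)%:MP.
  rewrite coef_sum (bigD1_seq m0) ?msupp_uniq //= big1_seq ?addr0 => [|m /andP[ne mp]].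
    have [mn s] := mmap1_nagata (B := B) m0 isT.
    rewrite coefCM -[w m0]/(w m0).+1.-1 -s -lead_coefE.
    by rewrite (eqP mn) mulr1.
  apply: nth_default; rewrite sz // ltn_neqAle m0max // andbT.
  by apply: contra ne => /eqP/winj->.
have szP : size P = (w m0).+1.
  apply/eqP; rewrite eqn_leq; apply/andP; split.
    apply: leq_trans (size_sum _ _ _) _.
    by apply/bigmax_leqP_seq => m mp _; rewrite sz // ltnS m0max.
  rewrite ltnNge; apply: contraL m0p => /leq_sizeP/(_ _ (leqnn _)).
  by rewrite coef => /eqP; rewrite mpolyC_eq0 mcoeff_msupp negbK.
by rewrite E lead_coefE szP coef.
Qed.

(** Monic polynomials keep their size under a ring morphism, hence so does the Sylvester matrix. *)
Lemma map_resultant_monic (R S : comNzRingType) (f : {rmorphism R -> S}) (p q : {poly R}) :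
  p \is monic -> q \is monic ->
  f (resultant p q) = resultant (map_poly f p) (map_poly f q).
Proof.
move=> /eqP mp /eqP mq; rewrite /resultant /Sylvester_mx.
rewrite !size_map_poly_id0 ?mp ?mq ?rmorph1 ?oner_eq0 //.
rewrite -det_map_mx /= map_col_mx; congr (\det (col_mx _ _));
  by apply: map_lin1_mx => v; rewrite map_poly_rV rmorphM /= map_rVpoly.
Qed.

(** An element of least size generates the ideal by Euclidean division; it is not constant since 1
    is not in [I], so it has a root. *)
Lemma poly_ideal_root (I : {poly k} -> Prop) (F : {poly k}) :
  (forall u v, I u -> I v -> I (u + v)) -> (forall u v, I v -> I (u * v)) ->
  F != 0 -> I F -> ~ I 1 -> exists b, forall u, I u -> root u b.
Proof.
move=> ID IM F0 IF I1.
have ex : exists n, `[< exists2 g, g != 0 & I g /\ size g = n >].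
  by exists (size F); apply/asboolP; exists F.
have [n /asboolP[g g0 [Ig sg]] nmin] := ex_minnP ex.
have [/eqP/size_poly1P[c c0 gc]|g1] := eqVneq (size g) 1%N.
  case: I1; rewrite (_ : 1 = c^-1%:P * g); first exact: IM.
  by rewrite gc -polyCM mulVf.
have [b rb] := closed_rootP g g1; exists b => u Iu.
suff -> : u = u %/ g * g by rewrite rootM rb orbT.
rewrite {1}(divp_eq u g); suff -> : u %% g = 0 by rewrite addr0.
apply: contrapT => /eqP r0.
have Ir : I (u %% g).
  have -> : u %% g = u + (- (u %/ g)) * g.
    by rewrite {2}(divp_eq u g) mulNr addrAC subrr add0r.
  by apply: ID => //; exact: IM.
have := nmin (size (u %% g)); rewrite leqNgt -sg ltn_modp g0 /= => H.
by have : false by apply: H; apply/asboolP; exists (u %% g).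
Qed.

Variables (A : comNzRingType) (phi : {rmorphism k -> A}) (J : A -> Prop).
Hypotheses (JD : forall a b, J a -> J b -> J (a + b))
  (JM : forall a b, J b -> J (a * b)) (J1 : ~ J 1).

(* Elimination step: the resultant of a monic relation and any other relation
   is a relation between fewer generators. *)
Lemma weak_nullstellensatz n (y : 'I_n -> A) :
  exists a : 'I_n -> k, forall p, J (mmap phi y p) -> p.@[a] = 0.
Proof.
elim: n y => [|n IH] y.
  exists (fun _ => 0) => p; have [c ->] : exists c, p = c%:MP.
    by exists p@_0%MM; exact: nvar0_mpolyC.
  rewrite mmapC mevalC => Jc; apply: contrapT => /eqP c0.
  apply: J1; rewrite -(rmorph1 phi) -(mulVf c0) rmorphM.
  exact: JM.
(* If the generators satisfy no relation modulo [J], every point will do. *)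
case: (pselect (exists2 p, p != 0 & J (mmap phi y p))) => [[p p0 Jp]|H]; last first.
  exists (fun _ => 0) => p Jp; have [->|p0] := eqVneq p 0; first exact: meval0.
  by case: H; exists p.
have [B [c [c0 lc]]] := nagata_lead p0.
(* [y'] undoes the substitution: evaluating [nagata B q] at [y'] and [y ord0] gives back [q] at
   [y]. *)
pose y' (j : 'I_n) := y (lift ord0 j) - y ord0 ^+ (B ^ lift ord0 j).
have [a' a'P] := IH y'.
pose ev (h : {poly {mpoly k[n]}}) : A := (map_poly (mmap phi y') h).[y ord0].
have evD g h : ev (g + h) = ev g + ev h by rewrite /ev rmorphD hornerD.
have evM g h : ev (g * h) = ev g * ev h by rewrite /ev rmorphM hornerM.
have evC g : ev g%:P = mmap phi y' g by rewrite /ev map_polyC hornerC.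
have evX : ev 'X = y ord0 by rewrite /ev map_polyX hornerX.
have ev_nagata q : ev (nagata B q) = mmap phi y q.
  pose e : {rmorphism {poly {mpoly k[n]}} -> A} := horner_eval (y ord0) \o map_poly (mmap phi y').
  rewrite -[LHS]/(e _) /nagata rmorph_mmap; apply: eq_mmap => [b|i] /=.
    by rewrite /horner_eval map_polyC hornerC /= mmapC.
  rewrite -[LHS]/(ev _) /nagata_var; case: unliftP => [j ->|->//].
  rewrite evD evC mmapX mmap1U /y' /ev map_polyXn hornerXn.
  by rewrite addrC subrK.
pose f : {poly {mpoly k[n]}} := c^-1%:MP *: nagata B p.
have fmon : f \is monic.
  by rewrite monicE lead_coefZ lc -mpolyCM mulVf.
have Jf : J (ev f).
  by rewrite /f -mul_polyC evM; apply: JM; rewrite ev_nagata.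
have sf1 : (1 < size f)%N.
  rewrite ltnNge; apply/negP => /size1_polyC ef.
  apply: J1; suff <- : ev f = 1 by [].
  have <- : ev 1%:P = 1 by rewrite evC rmorph1.
  congr ev; rewrite ef; congr (_%:P).
  by move: fmon; rewrite monicE ef lead_coefC coefC => /eqP.
pose I u := exists2 h, J (ev h) & map_poly (meval a') h = u.
have [|||||b bP] := @poly_ideal_root I (map_poly (meval a') f).
- by move=> u v [g Jg <-] [h Jh <-]; exists (g + h); rewrite ?rmorphD // evD; exact: JD.
- move=> u v [h Jh <-]; exists (map_poly (@mpolyC n k) u * h).
    by rewrite evM; exact: JM.
  rewrite rmorphM; congr (_ * _).
  by apply/polyP => i; rewrite !coef_map /= mevalC.
- by rewrite monic_neq0 // monic_map.
- by exists f.
(* Adding a high multiple of [f] to [h] makes it monic, so the resultant commutes with evaluation at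
   [a']. It lies in [J], so it vanishes at [a'] by the choice of [a']; yet at [a'] the two
   polynomials become [F] and [1 + F 'X^M], which are coprime. *)
- move=> [h Jh h1]; pose M := (size h).+1; pose g : {poly {mpoly k[n]}} := h + f * 'X^M.
  have sg : (size h < size (f * 'X^M)%R)%N.
    by rewrite size_mulXn ?monic_neq0 // /M; lia.
  have gmon : g \is monic.
    by rewrite monicE lead_coefDr // lead_coefM lead_coefXn mulr1.
  have sg1 : (1 < size g)%N.
    by rewrite /g addrC size_polyDl // size_mulXn ?monic_neq0 // /M; lia.
  have Jg : J (ev g) by rewrite evD evM mulrC; apply: JD => //; exact: JM.
  have [[u v] /= _ e] := resultant_in_ideal sf1 sg1.
  have := a'P (resultant f g); rewrite -evC e evD !evM => /(_ (JD (JM _ Jf) (JM _ Jg))).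
  move=> /eqP; rewrite map_resultant_monic // resultant_eq0.
  rewrite ltnNge => /negP; apply.
  rewrite rmorphD rmorphM /= h1.
  set F := map_poly _ f; set G := map_poly _ _.
  rewrite -[X in (_ <= X)%N]/(1%N) leq_eqVlt; apply/orP; left.
  rewrite -/(coprimep _ _) addrC mulrC.
  by rewrite coprimep_addl_mul coprimep1.
(* The point [(b, a')] read back through Nagata's substitution. *)
exists (fun i => if unlift ord0 i is Some j then a' j + b ^+ (B ^ i) else b).
move=> q Jq; have /rootP : root (map_poly (meval a') (nagata B q)) b.
  by apply: bP; exists (nagata B q); rewrite ?ev_nagata.
pose e : {rmorphism {poly {mpoly k[n]}} -> k} := horner_eval b \o map_poly (meval a').
rewrite -[LHS]/(e _) /nagata rmorph_mmap => <-; rewrite /meval; apply: eq_mmap => [d|i] /=.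
  by rewrite /horner_eval map_polyC hornerC /= mevalC.
rewrite /nagata_var; case: unliftP => [j ->|_] /=.
  rewrite /horner_eval rmorphD /= map_polyXn map_polyC hornerD hornerXn hornerC /= mevalXU.
  exact: addrC.
by rewrite /horner_eval map_polyX hornerX.
Qed.
End Nullstellensatz.

(** * The strong Nullstellensatz *)

Section StrongNullstellensatz.
Variable k : closedFieldType.

Lemma mmap_id n (R : nzRingType) (p : {mpoly R[n]}) : mmap (@mpolyC n R) (fun i => 'X_i) p = p.
Proof.
rewrite -[RHS]comp_mpoly_id /comp_mpoly; apply: eq_mmap => // i.
by rewrite tnth_map tnth_ord_tuple.
Qed.

Lemma mpoly_var_ind n (R : nzRingType) (P : {mpoly R[n]} -> Prop) :
  (forall c, P c%:MP) -> (forall p q, P p -> P q -> P (p + q)) ->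
  (forall p i, P p -> P (p * 'X_i)) -> forall p, P p.
Proof.
move=> PC PD PX; have PXX p (m : 'X_{1..n}) : P p -> P (p * 'X_[m]).
  rewrite mpolyXE_id => Pp; elim/big_rec: _ p Pp => [|i q _ IH] p Pp.
    by rewrite mulr1.
  rewrite mulrA; apply: IH; elim: (m i) => [|d IH]; first by rewrite mulr1.
  by rewrite exprSr mulrA; exact: PX.
elim/mpolyind => [|c m p _ _ Pp]; first exact: PC.
by apply: PD => //; rewrite -mul_mpolyC; exact: PXX.
Qed.

Section Homogenize.
Variables (n : nat) (g : {mpoly k[n]}).
Implicit Types h u : {poly {mpoly k[n]}}.

(* [g ^+ N * h.[1 / g]] *)
Let hz N h := \sum_(j < N.+1) h`_j * g ^+ (N - j).

Let hzD N h u : hz N (h + u) = hz N h + hz N u.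
Proof. by rewrite /hz -big_split; apply: eq_bigr => j _; rewrite coefD mulrDl. Qed.

Let hzC N c h : hz N (c%:P * h) = c * hz N h.
Proof. by rewrite /hz mulr_sumr; apply: eq_bigr => j _; rewrite coefCM mulrA. Qed.

Let hzX N h : hz N.+1 (h * 'X) = hz N h.
Proof.
rewrite /hz big_ord_recl coefMX eqxx mul0r add0r.
by apply: eq_bigr => j _; rewrite coefMX lift0.
Qed.

Let hzS N M h : (size h <= N.+1)%N -> hz (N + M) h = g ^+ M * hz N h.
Proof.
move=> sh; rewrite /hz -addSn big_split_ord /= [X in _ + X]big1 ?addr0 => [|j _].
  rewrite mulr_sumr; apply: eq_bigr => j _; rewrite mulrCA -exprD.
  by congr (_ * _ ^+ _); rewrite addnC addnBA ?leq_ord -?ltnS // addnC.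
by rewrite nth_default ?mul0r // (leq_trans sh) // leq_addr.
Qed.

(* Rabinowitsch's trick. *)
Lemma nullstellensatz (I : {mpoly k[n]} -> Prop) :
  I 0 -> (forall a b, I a -> I b -> I (a + b)) -> (forall a b, I b -> I (a * b)) ->
  (forall x, (forall f, I f -> f.@[x] = 0) -> g.@[x] = 0) -> exists N, I (g ^+ N).
Proof.
move=> I0 ID IM zg; apply: contrapT => nI.
(* [J] consists of the [h] whose value at [T = 1 / g] falls into [I] after clearing denominators. It
   contains [I] and [1 - T g], and 1 lies in it exactly when a power of [g] lies in [I]. *)
pose J h := exists N, (size h <= N.+1)%N /\ I (hz N h).
have JS h N M : (size h <= N.+1)%N -> I (hz N h) -> I (hz (N + M) h).
  by move=> sh Ih; rewrite hzS //; exact: IM.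
have JD u v : J u -> J v -> J (u + v).
  move=> [N [su Iu]] [M [sv Iv]]; exists (N + M)%N; split.
    by apply: leq_trans (size_polyD _ _) _; rewrite geq_max; lia.
  by rewrite hzD; apply: ID; [|rewrite addnC]; exact: JS.
have JC c v : J v -> J (c%:P * v).
  move=> [N [sv Iv]]; exists N; split; last by rewrite hzC; exact: IM.
  apply: leq_trans (size_polyMleq _ _) _; rewrite size_polyC.
  by case: (c != 0); rewrite ?add1n ?add0n /= ?(leq_trans (leq_pred _)).
have J0 : J 0.
  exists 0%N; rewrite size_poly0; split=> //.
  by rewrite /hz big_ord1 coef0 mul0r.
pose y (i : 'I_n.+1) : {poly {mpoly k[n]}} :=
  if unlift ord0 i is Some j then ('X_j)%:P else 'X.
have [||a aP] := @weak_nullstellensatz k _ (polyC \o @mpolyC n k) J JD _ _ _ y.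
- move=> u v Jv; elim/poly_ind: u => [|u c IH]; first by rewrite mul0r.
  rewrite mulrDl mulrAC; apply: JD; last exact: JC.
  case: IH => N [s IN]; exists N.+1; rewrite hzX; split=> //.
  apply: leq_trans (size_polyMleq _ _) _; rewrite size_polyX addn2 ltnS; exact: s.
- move=> [N [_ IN]]; case: nI; exists N; move: IN.
  rewrite /hz big_ord_recl coef1 eqxx mul1r subn0 big1 ?addr0 // => j _.
  by rewrite coef1 lift0 mul0r.
pose ren := mmap (@mpolyC n.+1 k) (fun j : 'I_n => 'X_(lift ord0 j)).
have renE f : mmap (polyC \o @mpolyC n k) y (ren f) = f%:P.
  rewrite /ren rmorph_mmap -[in RHS](mmap_id f) rmorph_mmap.
  apply: eq_mmap => [c|j] /=; first by rewrite mmapC.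
  by rewrite mmapX mmap1U /y liftK.
have reneval f : (ren f).@[a] = f.@[a \o lift ord0].
  rewrite /ren rmorph_mmap; apply: eq_mmap => [c|j] /=; first by rewrite mevalC.
  by rewrite mevalXU.
have za f : I f -> f.@[a \o lift ord0] = 0.
  move=> If; rewrite -reneval; apply: aP; rewrite renE; exists 0%N.
  by rewrite size_polyC leq_b1 /hz big_ord1 coefC eqxx expr0 mulr1.
have := aP (1 - 'X_ord0 * ren g); rewrite mevalB meval1 mevalM reneval zg //.
rewrite mulr0 subr0 => H; suff /H/eqP : J (mmap (polyC \o @mpolyC n k) y (1 - 'X_ord0 * ren g)).
  by rewrite oner_eq0.
rewrite rmorphB rmorph1 rmorphM /= renE mmapX mmap1U /y unlift_none.
exists 1%N; split.
  apply: leq_trans (size_polyD _ _) _; rewrite geq_max size_poly1 size_polyN /=.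
  apply: leq_trans (size_polyMleq _ _) _; rewrite size_polyX size_polyC.
  by case: (g != 0).
rewrite /hz !big_ord_recl big_ord0 /= !coefB !coef1 !coefXM !coefC /= expr1 expr0.
by rewrite subr0 mul1r mulr1 sub0r addr0 subrr.
Qed.

(** For the zero ideal the Nullstellensatz says that a polynomial vanishing everywhere is
    nilpotent. *)
Lemma mpoly_nonzero_point : g != 0 -> exists x, g.@[x] != 0.
Proof.
move=> g0; apply: contrapT => H.
have [|||N /eqP] := @nullstellensatz (eq 0) erefl.
- by move=> a b <- <-; rewrite addr0.
- by move=> a b <-; rewrite mulr0.
- by move=> x _; apply: contrapT => /eqP gx; case: H; exists x.
by rewrite eq_sym expf_eq0 (negPf g0) andbF.
Qed.
End Homogenize.

(** * Divisibility by monomials *)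

Section Monomials.
Variable n : nat.
Implicit Types (f g q e : {mpoly k[n]}) (m : 'X_{1..n}).

Lemma dvd_monomialP f m :
  (exists g, f = g * 'X_[m]) <-> (forall m', m' \in msupp f -> (m <= m')%MM).
Proof.
split=> [[g ->] m'|H].
  rewrite (perm_mem (msuppMX g m)) => /mapP[m1 _ ->].
  by apply/mnm_lepP => i; rewrite mnmDE leq_addr.
exists (\sum_(m' <- msupp f) f@_m' *: 'X_[m' - m]).
rewrite {1}[f]mpolyE mulr_suml; apply: eq_big_seq => m' /H le.
by rewrite -scalerAl -mpolyXD submK.
Qed.

Definition kill (j : 'I_n) : {mpoly k[n]} -> {mpoly k[n]} :=
  mmap (@mpolyC n k) (fun i => if i == j then 0 else 'X_i).

HB.instance Definition _ j := GRing.RMorphism.on (kill j).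

Lemma killE j f : exists g, f = kill j f + g * 'X_j.
Proof.
elim/mpoly_var_ind: f => [c|p q [g pE] [h qE]|p i [g pE]].
- by exists 0; rewrite /kill mmapC mul0r addr0.
- by exists (g + h); rewrite {1}pE {1}qE rmorphD mulrDl addrACA.
have kX : kill j 'X_i = if i == j then 0 else 'X_i by rewrite /kill mmapX mmap1U.
rewrite rmorphM /= kX; have [->|ne] := eqVneq i j.
  by exists p; rewrite mulr0 add0r.
by exists (g * 'X_i); rewrite {1}pE mulrDl mulrAC.
Qed.

Lemma kill_dvd j g : kill j (g * 'X_j) = 0.
Proof. by rewrite rmorphM /= /kill (mmapX _ _ U_(j)) mmap1U eqxx mulr0. Qed.

(** The hypothesis says that no variable divides [q]. Variables are prime, setting one of them to 0
    being a morphism to a domain, so they can be moved from the product to [e] one at a time. *)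
Lemma dvd_monomial_cancel q : (forall j, kill j q != 0) ->
  forall m e g, q * e = g * 'X_[m] -> exists g', e = g' * 'X_[m].
Proof.
move=> qj m; have [d] := ubnP (mdeg m); elim: d m => // d IH m md e g qe.
have [->|m0] := eqVneq m 0%MM; first by exists e; rewrite mpolyX0 mulr1.
have [j mj] : exists j, m j != 0%N.
  apply: contrapT => H; case/eqP: m0; apply/mnmP => j; rewrite mnm0E.
  by apply: contrapT => /eqP mj; case: H; exists j.
have le : (U_(j) <= m)%MM.
  by apply/mnm_lepP => i; rewrite mnm1E; case: eqP => // <-; rewrite lt0n.
have mE := submK le; pose m1 := (m - U_(j))%MM.
have [||e1 e1E] := IH m1 _ e (g * 'X_j).
- by move: md; rewrite -{1}mE mdegD mdeg1 addn1 ltnS.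
- by rewrite qe -{1}mE mpolyXD mulrA mulrAC.
have X0 : 'X_[m1] != 0 :> {mpoly k[n]} by rewrite -msupp_eq0 msuppX.
have qe1 : q * e1 = g * 'X_j.
  apply: (mulIf X0); rewrite -mulrA -e1E qe.
  by rewrite -mulrA -mpolyXD addmC mE.
have [e2 e2E] := killE j e1.
have k1 : kill j e1 = 0.
  apply/eqP; have /eqP := congr1 (kill j) qe1.
  by rewrite kill_dvd rmorphM mulf_eq0 (negPf (qj j)).
exists e2; rewrite e1E e2E k1 add0r -mulrA -mpolyXD.
by rewrite addmC mE.
Qed.
End Monomials.
End StrongNullstellensatz.

(** * Polynomials and regular functions on the quadric *)

Section QuadricAlgebra.
Variable k : closedFieldType.
Local Notation vec := ('I_7 -> k).
Local Notation poly7 := {mpoly k[7]}.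
Local Notation q := (quadric k).
Implicit Types (x y : vec).

Lemma quadricE x : q.@[x] = x (inord 0) ^+ 2 + x (inord 1) * x (inord 2) +
  x (inord 3) * x (inord 4) + x (inord 5) * x (inord 6).
Proof. by rewrite /quadric /zvar !mevalD !mevalM !mevalXU expr2. Qed.

Lemma quadric_homog : q \is 2.-homog.
Proof.
rewrite /quadric expr2.
by rewrite !rpredD //; apply: (@dhomogM _ _ _ 1 _ 1); exact: zvar_homog.
Qed.

Lemma kill_eval (j : 'I_7) (f : poly7) x :
  (kill j f).@[x] = f.@[fun i => if i == j then 0 else x i].
Proof.
rewrite /kill rmorph_mmap; apply: eq_mmap => [c|i] /=; first by rewrite mevalC.
by case: eqP => _; rewrite ?meval0 ?mevalXU.
Qed.

Lemma inord_neq (i j : nat) : (i < 7)%N -> (j < 7)%N -> i <> j -> (inord i == inord j :> 'I_7) = false.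
Proof. by move=> hi hj ne; apply/eqP => /(congr1 val) /=; rewrite !inordK. Qed.

Lemma kill_quadric j : kill j q != 0.
Proof.
have [->|j0] := eqVneq j (inord 0).
  apply/eqP => /(congr1 (meval (fun i => ((i == inord 1) || (i == inord 2))%:R))).
  rewrite kill_eval quadricE meval0 -!val_eqE /= !inordK //= => /eqP.
  by rewrite expr0n mul1r mulr0 add0r !addr0 oner_eq0.
apply/eqP => /(congr1 (meval (fun i => (i == inord 0)%:R))).
rewrite kill_eval quadricE meval0 (eq_sym _ j) (negPf j0).
rewrite -!val_eqE /= !inordK //= !if_same !mul0r !addr0 expr1n => /eqP.
by rewrite oner_eq0.
Qed.

Lemma quadric_neq0 : q != 0.
Proof. by apply: contraNneq (kill_quadric ord0) => ->; rewrite rmorph0. Qed.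

(** Division by [q], which is monic of degree 2 in [z_0]. *)
Lemma quadric_normal_form (f : poly7) : exists g a b : poly7,
  [/\ f = g * q + a + b * zvar k 0, kill (inord 0) a = a & kill (inord 0) b = b].
Proof.
elim/mpoly_var_ind: f => [c|f f' [g [a [b [-> ha hb]]]] [g' [a' [b' [-> ha' hb']]]]|f i [g [a [b [-> ha hb]]]]].
- by exists 0, c%:MP, 0; rewrite !mul0r add0r addr0 rmorph0 /kill mmapC.
- exists (g + g'), (a + a'), (b + b'); split; first ring.
    by rewrite rmorphD /= ha ha'.
  by rewrite rmorphD /= hb hb'.
pose w : poly7 := zvar k 1 * zvar k 2 + zvar k 3 * zvar k 4 + zvar k 5 * zvar k 6.
have kX j : kill (inord 0) ('X_j : poly7) = if j == inord 0 then 0 else 'X_j.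
  by rewrite /kill mmapX mmap1U.
have [->|i0] := eqVneq i (inord 0).
  exists (g * zvar k 0 + b), (- b * w), a; split=> //.
    rewrite -/(zvar k 0) /quadric /w; ring.
  by rewrite rmorphM rmorphN !rmorphD !rmorphM /= hb !kX !inord_neq.
exists (g * 'X_i), (a * 'X_i), (b * 'X_i); split; first ring.
  by rewrite rmorphM /= ha kX (negPf i0).
by rewrite rmorphM /= hb kX (negPf i0).
Qed.

(* A remainder [a + b z_0] vanishing on the quadric satisfies
   [a^2 = - b^2 (z_1 z_2 + z_3 z_4 + z_5 z_6)], which is impossible for reasons of
   parity of the degree in [z_1] unless [a = b = 0]. *)
Lemma quadric_dvd_affine (f : poly7) :
  (forall x, q.@[x] = 0 -> f.@[x] = 0) -> exists g, f = g * q.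
Proof.
have [g [a [b [-> ha hb]]]] := quadric_normal_form f => H.
pose w : poly7 := zvar k 1 * zvar k 2 + zvar k 3 * zvar k 4 + zvar k 5 * zvar k 6.
have abw x : a.@[x] ^+ 2 + b.@[x] ^+ 2 * w.@[x] = 0.
  (* A square root [s] of [- w] lifts the point to the quadric. There [a = - b s], and squaring
     removes [s], which works in characteristic 2 as well. *)
  have [s sE] : exists s, s ^+ 2 = - w.@[x].
    have [s] := @solve_monicpoly k 2 (fun i => if i == 0%N then - w.@[x] else 0) isT.
    rewrite big_ord_recl big_ord1 /= expr0 mulr1 mul0r addr0 => sE.
    by exists s.
  pose x' i := if i == inord 0 then s else x i.
  have ev p : kill (inord 0) p = p -> p.@[x'] = p.@[x].
    move=> hp; rewrite -hp !kill_eval; apply: meval_eq => i.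
    by rewrite /x'; case: eqP.
  have wE : w.@[x'] = w.@[x].
    apply: ev; have kX j : kill (inord 0) ('X_j : poly7) = if j == inord 0 then 0 else 'X_j.
      by rewrite /kill mmapX mmap1U.
    by rewrite /w !rmorphD !rmorphM /= !kX !inord_neq.
  have qx : q.@[x'] = 0.
    have -> : q = zvar k 0 ^+ 2 + w by rewrite /quadric /w; ring.
    rewrite mevalD wE rmorphXn /= mevalXU {1}/x' eqxx sE; exact: addNr.
  have := H x' qx; rewrite mevalD mevalM mevalXU mevalD mevalM qx mulr0 add0r.
  rewrite !ev // {1}/x' eqxx => /eqP; rewrite addr_eq0 => /eqP ->.
  by rewrite sqrrN exprMn sE mulrN addNr.
have b0 : b = 0.
  apply: contrapT => /eqP b0.
  (* Restriction to the line through [x] in the direction of [z_1]: as [x_2] is nonzero, [w] has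
     degree exactly 1 there, so [a^2] and [b^2 w] have degrees of different parity. *)
  have [x] : exists x, (b * zvar k 2).@[x] != 0.
    apply: mpoly_nonzero_point; rewrite mulf_neq0 //.
    by rewrite -msupp_eq0 msuppX.
  rewrite mevalM mevalXU mulf_eq0 negb_or => /andP[bx x2].
  pose u t i := if i == inord 1 then t else x i.
  pose sg (p : poly7) : {poly k} := mmap polyC (fun i => if i == inord 1 then 'X else (x i)%:P) p.
  have sgE p t : (sg p).[t] = p.@[u t].
    rewrite -[LHS]/(horner_eval t (sg p)) /sg rmorph_mmap; apply: eq_mmap => [c|i] /=.
      by rewrite /horner_eval hornerC.
    by rewrite /horner_eval /u; case: eqP => _; rewrite ?hornerX ?hornerC.
  have ext (r : {poly k}) : (forall t, r.[t] = 0) -> r = 0.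
    move=> h; apply: contrapT => /eqP /closed_nonrootP[t]; rewrite /root h eqxx //.
  have E : sg a ^+ 2 = - (sg b ^+ 2 * sg w).
    apply/eqP; rewrite -addr_eq0; apply/eqP/ext => t.
    by rewrite hornerD horner_exp hornerM horner_exp !sgE abw.
  have wE : sg w = (x (inord 2))%:P * 'X + (x (inord 3) * x (inord 4) + x (inord 5) * x (inord 6))%:P.
    rewrite /sg /w !rmorphD !rmorphM /= /zvar !mmapX !mmap1U -!val_eqE /= !inordK //=.
    by ring.
  have wsz : size (sg w) = 2%N.
    by rewrite wE size_MXaddC polyC_eq0 (negPf x2) /= size_polyC x2.
  have sb : sg b != 0.
    apply/eqP => /(congr1 (horner^~ (x (inord 1)))); rewrite sgE horner0 => /eqP.
    rewrite (meval_eq (v2 := x)) ?(negPf bx) // => i.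
    by rewrite /u; case: eqP => // ->.
  have [sa|sa] := eqVneq (sg a) 0.
    have sw : sg w != 0 by rewrite -size_poly_eq0 wsz.
    move/eqP: E; rewrite sa expr0n eq_sym oppr_eq0 mulf_eq0.
    by rewrite expf_eq0 (negPf sb) (negPf sw).
  have := congr1 (fun r : {poly k} => odd (size r)) E.
  rewrite size_polyN !expr2 !size_mul ?mulf_neq0 // ?wsz -?size_poly_eq0 ?wsz //.
  move: sa sb; rewrite -!size_poly_gt0.
  case: (size (sg a)) (size (sg b)) => [//|sa] [//|sb] _ _.
  by rewrite !addSn !addnS !addn0 /= negbK !addnn !odd_double.
have a0 : a = 0.
  apply: contrapT => /eqP /mpoly_nonzero_point[x].
  by have /eqP := abw x; rewrite b0 meval0 expr0n mul0r addr0 expf_eq0 /= => ->.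
by exists g; rewrite a0 b0 mul0r !addr0.
Qed.

(** Multiplied by the monomial and by [z_0], [f] vanishes on the whole affine cone, including its
    vertex, which [on_cone] excludes. The monomial then cancels because no variable divides [q]. *)
Lemma quadric_dvd (f : poly7) (m : 'X_{1..7}) :
  (forall x, on_cone x -> 'X_[m].@[x] != 0 -> f.@[x] = 0) -> exists g, f = g * q.
Proof.
move=> H; have [g] : exists g, f * 'X_[m + U_(ord0)] = g * q.
  apply: quadric_dvd_affine => x qx; rewrite mpolyXD !mevalM mevalXU.
  have [->|x0] := eqVneq (x ord0) 0; first by rewrite !mulr0.
  have [->|mx] := eqVneq ('X_[m].@[x]) 0; first by rewrite mul0r mulr0.
  by rewrite H ?mul0r //; split=> //; exists ord0.
move=> e; have [g' gE] := dvd_monomial_cancel kill_quadric (etrans (mulrC q g) (esym e)).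
exists g'; have X0 : 'X_[m + U_(ord0)] != 0 :> poly7 by rewrite -msupp_eq0 msuppX.
by apply: (mulIf X0); rewrite e gE mulrAC.
Qed.

Lemma homog_eval_scale n (d : nat) (f : {mpoly k[n]}) (c : k) (x : 'I_n -> k) :
  f \is d.-homog -> f.@[fun i => c * x i] = c ^+ d * f.@[x].
Proof.
move=> /dhomogP hf; rewrite !mevalE mulr_sumr; apply: eq_big_seq => m /hf <-.
rewrite mulrCA; congr (_ * _); rewrite [X in c ^+ X]mdegE expr_sum -big_split /=.
by apply: eq_bigr => i _; rewrite exprMn.
Qed.

Lemma on_cone_scale (c : k) x : c != 0 -> on_cone x -> on_cone (fun i => c * x i).
Proof.
move=> c0 [[i xi] qx]; split; first by exists i; rewrite mulf_neq0.
by rewrite (homog_eval_scale _ _ quadric_homog) qx mulr0.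
Qed.

Lemma zopen_scale (U : zopen k) (c : k) x : c != 0 -> U x -> U (fun i => c * x i).
Proof.
move=> c0; case: (zopenP U) => E [hE UE] /UE[xQ [f Ef fx]].
apply/UE; split; first exact: on_cone_scale.
have [d df] := hE f Ef; exists f => //.
by rewrite (homog_eval_scale _ _ df) mulf_neq0 ?expf_neq0.
Qed.

Lemma regular_scale (d : int) (U : zopen k) (f : pts U -> k) (c : k) (c0 : c != 0) (x y : pts U) :
  is_regular d f -> (forall i, sval y i = c * sval x i) -> f y = c ^ d * f x.
Proof.
move=> rf yE; have [V [Vx [m [n [P [Q [hP hQ <- e]]]]]]] := rf x.
have {}yE : sval y = (fun i => c * sval x i) by apply/funext.
have Vy : V (sval y) by rewrite yE; exact: zopen_scale.
have [Qx ->] := e x Vx; have [Qy ->] := e y Vy.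
rewrite yE (homog_eval_scale _ _ hP) (homog_eval_scale _ _ hQ).
by rewrite invfM mulrACA expfzDr // -exprnN.
Qed.

Definition zmon (T : {set 'I_7}) (N : nat) : 'X_{1..7} :=
  [multinom if i \in T then N else 0%N | i < 7].

Lemma zmon_eval T N x : 'X_[zmon T N].@[x] = \prod_(i in T) x i ^+ N.
Proof.
rewrite mevalX [RHS]big_mkcond; apply: eq_bigr => i _.
by rewrite mnmE; case: ifP.
Qed.

Lemma zmon_deg T N : mdeg (zmon T N) = (#|T| * N)%N.
Proof.
rewrite mdegE -sum_nat_const [RHS]big_mkcond; apply: eq_bigr => i _.
by rewrite mnmE.
Qed.

Definition idx p (t : 'I_p -> 'I_7) : {set 'I_7} := [set t j | j : 'I_p].

Lemma zcoord_mon p (t : 'I_p -> 'I_7) x N : zcoord k t x -> 'X_[zmon (idx t) N].@[x] != 0.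
Proof.
move=> [_ xt]; rewrite zmon_eval; apply/prodf_neq0 => i /imsetP[j _ ->].
by rewrite expf_neq0.
Qed.

Lemma mon_zcoord p (t : 'I_p -> 'I_7) x : on_cone x -> 'X_[zmon (idx t) 1].@[x] != 0 -> zcoord k t x.
Proof.
rewrite zmon_eval => xQ /prodf_neq0 h; split=> // j.
by rewrite -[x _]expr1; apply: h; apply: imset_f.
Qed.

(** The polynomials [h] such that [h f] is polynomial form an ideal without zeros on the open set,
    so it contains a power of the product of the coordinates in [t]. Homogeneity of [f] then allows
    the numerator to be replaced by one homogeneous component. *)
Lemma regular_zcoord (d : int) p (t : 'I_p.+1 -> 'I_7) (f : pts (zcoord k t) -> k) :
  is_regular d f -> exists N0 : nat, forall N, (N0 <= N)%N ->
  exists (D : nat) (P : poly7), [/\ P \is D.-homog, D%:Z = d + (#|idx t| * N)%:Z &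
    forall x : pts (zcoord k t), f x * 'X_[zmon (idx t) N].@[sval x] = P.@[sval x]].
Proof.
move=> rf; pose T := idx t; pose g : poly7 := 'X_[zmon T 1].
pose I (h : poly7) := exists P : poly7, forall x : pts (zcoord k t), h.@[sval x] * f x = P.@[sval x].
have IM (a b : poly7) : I b -> I (a * b).
  by move=> [P PE]; exists (a * P) => x; rewrite !mevalM -mulrA PE.
have [||//||N [P0 PE0]] := @nullstellensatz k _ g I.
- by exists 0 => x; rewrite meval0 mul0r.
- by move=> a b [P PE] [P' PE']; exists (P + P') => x; rewrite !mevalD mulrDl PE PE'.
- move=> x Ix; apply: contrapT => /eqP gx.
  have qx : q.@[x] = 0.
    by apply: Ix; exists 0 => y; rewrite (zopen_cone (svalP y)).2 meval0 mul0r.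
  have xQ : on_cone x.
    split=> //; exists (t ord0); apply: contraNneq gx => e.
    rewrite zmon_eval (bigD1 (t ord0)) /= ?e ?expr1 ?mul0r //.
    exact: imset_f.
  have [V [Vx [m [n [P [Q [hP hQ _ e]]]]]]] := rf (exist _ x (mon_zcoord xQ gx)).
  have [E [hE VE]] := zopenP V; have /VE[_ [u Eu ux]] := Vx.
  suff /Ix/eqP : I (u * Q).
    have [Qx _] := e (exist _ x (mon_zcoord xQ gx)) Vx.
    by rewrite mevalM mulf_eq0 (negPf ux) (negPf Qx).
  (* The factor [u] vanishes wherever [P / Q] is not known to represent [f]. *)
  exists (u * P) => y; rewrite !mevalM.
  have [->|uy] := eqVneq u.@[sval y] 0; first by rewrite !mul0r.
  have [|Qy ->] := e y.
    by apply/VE; split; [exact: zopen_cone (svalP y)|exists u].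
  by rewrite -mulrA [_ * (_ / _)]mulrC divfK.
exists (N + `|d|)%N => M NM.
have T0 : (0 < #|T|)%N by apply/card_gt0P; exists (t ord0); exact: imset_f.
have [D DE] : exists D : nat, D%:Z = d + (#|T| * M)%:Z.
  exists `|(d + (#|T| * M)%:Z)%R|%N.
  have : (M <= #|T| * M)%N by rewrite leq_pmull.
  by lia.
have [P PE] : exists P : poly7, forall x : pts (zcoord k t), f x * 'X_[zmon T M].@[sval x] = P.@[sval x].
  have : I (g ^+ M).
    rewrite (_ : M = (M - N) + N)%N; last by lia.
    by rewrite exprD; apply: IM; exists P0.
  move=> [P PE]; exists P => x; rewrite mulrC -PE; congr (_ * _).
  rewrite /g mpolyXn; congr (_.@[_]); congr 'X_[_]; apply/mnmP => i.
  by rewrite mulmnE !mnmE; case: ifP => _; rewrite ?mul1n ?mul0n.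
exists D, (pihomog mdeg D P); split=> // [|x]; first exact: pihomogP.
rewrite PE; set K := (msize P).
have PK : P = \sum_(i < K) pihomog mdeg i P by exact: pihomog_partitionE.
(* Along the line through [x], all components of [P] together equal [P(x) c^D] for every nonzero
   [c]. So [r] has all nonzero scalars as roots, and the factor ['X] below takes care of [c = 0]. *)
pose r : {poly k} := \sum_(i < K) (pihomog mdeg i P).@[sval x] *: 'X^i - P.@[sval x] *: 'X^D.
have r0 : r = 0.
  suff : r * 'X = 0 by move/eqP; rewrite mulf_eq0 polyX_eq0 orbF => /eqP.
  apply: contrapT => /eqP /closed_nonrootP[c]; rewrite /root hornerM hornerX.
  have [->|c0] := eqVneq c 0; first by rewrite mulr0 eqxx.
  suff -> : r.[c] = 0 by rewrite mul0r eqxx.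
  pose y : pts (zcoord k t) := exist _ (fun i => c * sval x i) (zopen_scale c0 (svalP x)).
  have := PE y; rewrite (regular_scale c0 (x := x) rf) //= mevalX.
  rewrite -mevalX (@homog_eval_scale _ (#|T| * M)%N); last first.
    by rewrite dhomogX /= zmon_deg.
  rewrite mulrACA PE [c ^+ _]exprnP -expfzDr // -DE -exprnP {2}PK raddf_sum /= => e.
  rewrite /r hornerD hornerN horner_sum hornerZ hornerXn mulrC e.
  apply/eqP; rewrite subr_eq0; apply/eqP; apply: eq_bigr => i _.
  by rewrite hornerZ hornerXn (homog_eval_scale _ _ (pihomogP _ _ _)) mulrC.
have /eqP := congr1 (fun r : {poly k} => r`_D) r0.
rewrite /r coefB coef_sum coefZ coefXn eqxx mulr1 coef0 subr_eq0 => /eqP <-.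
have [lt|ge] := ltnP D K.
  rewrite (bigD1 (Ordinal lt)) //= coefZ coefXn eqxx mulr1 big1 ?addr0 // => i ne.
  rewrite coefZ coefXn; case: eqP => [e|_]; last by rewrite mulr0.
  by case/eqP: ne; apply: val_inj.
rewrite big1 => [|i _].
  rewrite (_ : pihomog _ _ _ = 0) ?meval0 //.
  rewrite /pihomog big1_seq // => m /andP[/eqP mD mP].
  have := msize_mdeg_lt mP; rewrite -/K => lt.
  by have := leq_trans lt ge; rewrite -mD ltnn.
rewrite coefZ coefXn; case: eqP => [e|_]; last by rewrite mulr0.
by move: (ltn_ord i); rewrite -e ltnNge ge.
Qed.
End QuadricAlgebra.

(** * Čech complexes of Laurent polynomials *)

Section Cech.
Variable k : closedFieldType.
Local Notation poly7 := {mpoly k[7]}.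
Local Notation q := (quadric k).

(** Coboundary of cochains with values in one fixed space: once all sections share a common
    denominator, the restriction maps disappear. *)
Definition cob (V : lmodType k) p (F : ('I_p -> 'I_7) -> V) (t : 'I_p.+1 -> 'I_7) : V :=
  \sum_(j < p.+1) (-1) ^+ j *: F (t \o lift j).

Lemma cobB (V : lmodType k) p (F G : ('I_p -> 'I_7) -> V) t :
  cob (fun s => F s - G s) t = cob F t - cob G t.
Proof. by rewrite /cob -sumrB; apply: eq_bigr => j _; rewrite scalerBr. Qed.

Lemma bump_lift_comp n (j : 'I_n.+2) (i : 'I_n.+1) (l : 'I_n) : (i < j)%N ->
  lift j (lift i l) = lift (inord i) (lift (inord j.-1) l).
Proof.
move=> ij; apply: val_inj => /=; rewrite /bump !inordK; have := ltn_ord j; have := ltn_ord i; lia.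
Qed.

Lemma cob_cob (V : lmodType k) p (F : ('I_p -> 'I_7) -> V) t : cob (cob F) t = 0.
Proof.
rewrite /cob (eq_bigr (fun j : 'I_p.+2 => \sum_(i < p.+1) (-1) ^+ (j + i) *: F (t \o lift j \o lift i))); last first.
  by move=> j _; rewrite scaler_sumr; apply: eq_bigr => i _; rewrite scalerA exprD.
rewrite pair_bigA /= (bigID (fun u : 'I_p.+2 * 'I_p.+1 => (u.2 < u.1)%N)) /=.
(* Omitting [i] after [j], for [i < j], is the same as omitting [j - 1] after [i]. The default
   [(1, 0)] keeps the remaining pairs out of the reindexed sum. *)
pose h (u : 'I_p.+2 * 'I_p.+1) : 'I_p.+2 * 'I_p.+1 :=
  if (u.2 < u.1)%N then (inord u.2, inord u.1.-1) else (inord 1, ord0).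
have hP u : ~~ ((h u).2 < (h u).1)%N = (u.2 < u.1)%N.
  case: u => j i; have hj := ltn_ord j; have hi := ltn_ord i; rewrite /h /=.
  by case: ifP => /= H; rewrite !inordK; lia.
rewrite [X in _ + X](reindex h) /=; last first.
  exists (fun u : 'I_p.+2 * 'I_p.+1 => (inord u.2.+1, inord u.1)) => u; rewrite inE => H.
    rewrite hP in H; rewrite /h H; case: u H => j i /= H.
    have hj := ltn_ord j; have hi := ltn_ord i.
    by congr pair; apply: val_inj; rewrite /= !inordK; lia.
  case: u H => j i /= H; have hj := ltn_ord j; have hi := ltn_ord i.
  rewrite /h /= !inordK ?ifT; [|lia..].
  by congr pair; apply: val_inj; rewrite /= !inordK; lia.
rewrite -[X in _ + X]opprK -sumrN; apply/eqP; rewrite subr_eq0; apply/eqP.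
apply: eq_big => [u|[j i] /= ij]; first by rewrite hP.
rewrite /h /= ij.
have hj := ltn_ord j; have hi := ltn_ord i.
rewrite !inordK; [|lia..]; rewrite -scaleNr; congr (_ *: F _).
  rewrite -[RHS]mulN1r -exprS; congr (_ ^+ _); lia.
by apply/funext => l /=; rewrite bump_lift_comp.
Qed.

Definition consi p (j : 'I_7) (s : 'I_p -> 'I_7) (i : 'I_p.+1) : 'I_7 :=
  if unlift ord0 i is Some l then s l else j.

Lemma consi_lift0 p j (s : 'I_p -> 'I_7) : consi j s \o lift ord0 = s.
Proof. by apply/funext => i; rewrite /consi /= liftK. Qed.

Lemma consi_lift p j (s : 'I_p.+1 -> 'I_7) l :
  consi j s \o lift (lift ord0 l) = consi j (s \o lift l).
Proof.
apply/funext => i; rewrite /consi /=.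
have [i' ->|->] := unliftP ord0 i.
  rewrite (_ : lift _ _ = lift ord0 (lift l i')) ?liftK //.
  by apply: val_inj; rewrite /= !bumpS.
by rewrite (_ : lift _ _ = ord0) ?unlift_none //; apply: val_inj.
Qed.

Lemma idx_consi p j (s : 'I_p -> 'I_7) : idx (consi j s) = j |: idx s.
Proof.
apply/setP => i; rewrite in_setU1; apply/imsetP/predU1P => [[l _ ->]|[->|/imsetP[l _ ->]]].
- by rewrite /consi; case: unliftP => [l' _|_]; [right; exact: imset_f|left].
- by exists ord0 => //; rewrite /consi unlift_none.
- by exists (lift ord0 l) => //; rewrite /consi liftK.
Qed.

Lemma idx_lift p (t : 'I_p.+1 -> 'I_7) j : idx (t \o lift j) \subset idx t.
Proof. by apply/subsetP => i /imsetP[l _ ->]; exact: imset_f. Qed.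

(** Prepending an index is a contracting homotopy: for a cocycle the left side is 0. It introduces a
    pole along [z_j], however, which the projections [proj j] below remove. *)
Lemma cob_consi (V : lmodType k) p (F : ('I_p.+1 -> 'I_7) -> V) j (t : 'I_p.+1 -> 'I_7) :
  cob F (consi j t) = F t - cob (fun s => F (consi j s)) t.
Proof.
rewrite /cob big_ord_recl expr0 scale1r consi_lift0 -sumrN; congr (_ + _).
by apply: eq_bigr => l _; rewrite consi_lift lift0 exprS mulN1r scaleNr.
Qed.

Section Homotopy.
Variable N : nat.
Implicit Types (T : {set 'I_7}) (f : poly7).

(* Sections of O over the open set where the z_j, j in T, do not vanish, written
   with the common denominator (z_0 ... z_6)^N. *)
Definition laurent T f := forall m : 'X_{1..7}, m \in msupp f -> forall i, i \notin T -> (N <= m i)%N.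

Lemma laurentP T f : laurent T f <-> exists g, f = g * 'X_[zmon (~: T) N].
Proof.
rewrite dvd_monomialP; split=> H m /H => [h|/mnm_lepP h i iT].
  by apply/mnm_lepP => i; rewrite mnmE inE; case: ifP => // /h.
by have := h i; rewrite mnmE inE iT.
Qed.

Lemma laurentS T T' f : T \subset T' -> laurent T f -> laurent T' f.
Proof. by move=> TT' H m /H h i iT; apply: h; apply: contra iT; exact: (subsetP TT'). Qed.

Lemma laurent_sum T (I : Type) (r : seq I) P (F : I -> poly7) :
  (forall i, laurent T (F i)) -> laurent T (\sum_(i <- r | P i) F i).
Proof.
move=> H; elim/big_ind: _ => //; first by move=> m; rewrite msupp0.
by move=> f g hf hg m /msuppD_le; rewrite mem_cat => /orP[/hf|/hg].
Qed.

Lemma laurentZ T c f : laurent T f -> laurent T (c *: f).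
Proof. by move=> H m /msuppZ_le /H. Qed.

Lemma laurentM T f g : laurent T f -> laurent T (g * f).
Proof. by move=> /laurentP[h ->]; apply/laurentP; exists (g * h); rewrite mulrA. Qed.

Lemma laurent_cancel T f : laurent T (f * q) -> laurent T f.
Proof.
move=> /laurentP[g e]; apply/laurentP.
exact: (dvd_monomial_cancel (kill_quadric k) (etrans (mulrC _ _) e)).
Qed.

Lemma laurent_cob p (F : ('I_p -> 'I_7) -> poly7) :
  (forall t, laurent (idx t) (F t)) -> forall t, laurent (idx t) (cob F t).
Proof.
move=> H t; apply: laurent_sum => j; apply: laurentZ; apply: laurentS (H _).
exact: idx_lift.
Qed.

(** A coordinate along which the monomial, divided by [(z_0 ... z_6)^N], has no pole. Monomials with
    poles along all seven coordinates have none; they account for the top cohomology of the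
    projective space. *)
Definition first_index (m : 'X_{1..7}) := [pick i | (N <= m i)%N].

Definition proj j f := \sum_(m <- msupp f | first_index m == Some j) f@_m *: 'X_[m].

Lemma proj_coef j f m : (proj j f)@_m = if first_index m == Some j then f@_m else 0.
Proof.
rewrite /proj raddf_sum /=; have [mf|mf] := boolP (m \in msupp f).
  rewrite big_mkcond (bigD1_seq m) ?msupp_uniq //= big1 ?addr0 => [|m' ne].
    by case: ifP => // _; rewrite mcoeffZ mcoeffX eqxx mulr1.
  by case: ifP => // _; rewrite mcoeffZ mcoeffX (negPf ne) mulr0.
rewrite big_seq_cond big1 => [|m' /andP[m'f _]].
  by move: mf; rewrite -mcoeff_eq0 => /eqP->; case: ifP.
rewrite mcoeffZ mcoeffX; case: eqP => [e|_]; last by rewrite mulr0.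
by rewrite -e m'f in mf.
Qed.

Lemma proj_linear j : linear (proj j).
Proof.
move=> c f g; apply/mpolyP => m; rewrite mcoeffD mcoeffZ !proj_coef mcoeffD mcoeffZ.
by case: ifP; rewrite ?mulr0 ?addr0.
Qed.
HB.instance Definition _ j := GRing.isLinear.Build k poly7 poly7 *:%R (proj j) (proj_linear j).

Lemma sum_proj T f : T != setT -> laurent T f -> \sum_j proj j f = f.
Proof.
move=> TT H; apply/mpolyP => m; rewrite raddf_sum /=.
have [mf|mf] := boolP (m \in msupp f); last first.
  rewrite big1 => [|j _]; first by move: mf; rewrite -mcoeff_eq0 => /eqP.
  by rewrite proj_coef; move: mf; rewrite -mcoeff_eq0 => /eqP->; case: ifP.
have [i iT] : exists i, i \notin T.
  apply: contrapT => h; case/eqP: TT; apply/setP => i; rewrite inE.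
  by apply: contrapT => /negP iT; case: h; exists i.
rewrite (eq_bigr (fun j => if first_index m == Some j then f@_m else 0)); last first.
  by move=> j _; exact: proj_coef.
rewrite /first_index; case: pickP => [j _|/(_ i)]; last by rewrite (H m mf i iT).
rewrite -big_mkcond (bigD1 j) //= big1 ?addr0 // => l /andP[/eqP[->]].
by rewrite eqxx.
Qed.

Lemma laurent_proj T j f : laurent (j |: T) f -> laurent T (proj j f).
Proof.
move=> H m; rewrite mcoeff_msupp proj_coef /first_index.
case: pickP => [j' jm|_]; last by rewrite eqxx.
case: (Some j' =P Some j) => [[e]|_]; last by rewrite eqxx.
rewrite -mcoeff_msupp => mf i iT.
have [->|ne] := eqVneq i j; first by rewrite -e.
by apply: H mf _ _; rewrite in_setU1 negb_or ne.
Qed.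

(** On the monomials attributed to [j], prepending [j] is a legitimate homotopy. These parts add up
    to [F t], since a tuple of at most six indices leaves one of the seven coordinates free of
    poles. *)
Lemma cech_poly p (F : ('I_p.+1 -> 'I_7) -> poly7) : (p < 6)%N ->
  (forall t, laurent (idx t) (F t)) -> (forall t, cob F t = 0) ->
  exists b : ('I_p -> 'I_7) -> poly7,
    (forall s, laurent (idx s) (b s)) /\ forall t, F t = cob b t.
Proof.
move=> p6 LF dF; exists (fun s => \sum_j proj j (F (consi j s))); split=> [s|t].
  by apply: laurent_sum => j; apply: laurent_proj; rewrite -idx_consi.
have tT : idx t != setT.
  apply: contraTneq p6 => e; rewrite -leqNgt -ltnS.
  by have := leq_imset_card t 'I_p.+1; rewrite -/(idx t) e cardsT !card_ord.
transitivity (\sum_j proj j (cob (fun s => F (consi j s)) t)).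
  rewrite -{1}(sum_proj tT (LF t)); apply: eq_bigr => j _; congr (proj j _).
  by apply/eqP; rewrite -subr_eq0 -cob_consi dF.
rewrite /cob; under eq_bigr => j _ do rewrite raddf_sum.
rewrite exchange_big; apply: eq_bigr => l _; rewrite scaler_sumr.
by apply: eq_bigr => j _ /=; rewrite linearZ.
Qed.

(** The sequence [0 -> O(-2) -> O -> O_Q -> 0] made explicit: if [cob F = e q], then [e] is a
    cocycle because [q] is not a zero divisor, so [e = cob b'] and [F - b' q] is a cocycle. Solving
    for [e] one degree higher is what lowers the bound to 5. *)
Lemma cech_quadric p (F : ('I_p.+1 -> 'I_7) -> poly7) : (p < 5)%N ->
  (forall t, laurent (idx t) (F t)) -> (forall t, exists e, cob F t = e * q) ->
  exists (b : ('I_p -> 'I_7) -> poly7) (b' : ('I_p.+1 -> 'I_7) -> poly7),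
    [/\ forall s, laurent (idx s) (b s), forall t, laurent (idx t) (b' t) &
        forall t, F t = cob b t + b' t * q].
Proof.
move=> p5 LF /choice[e eE].
have cobM n (G : ('I_n -> 'I_7) -> poly7) t : cob (fun s => G s * q) t = cob G t * q.
  by rewrite /cob mulr_suml; apply: eq_bigr => j _; rewrite scalerAl.
have [||b' [Lb' eb']] := @cech_poly p.+1 e p5.
- by move=> t; apply: laurent_cancel; rewrite -eE; exact: laurent_cob.
- move=> t; apply: (mulIf (quadric_neq0 k)); rewrite mul0r -cobM -(cob_cob F t).
  by congr (cob _ t); apply/funext => s; rewrite eE.
pose G t := F t - b' t * q.
have [||b [Lb Gb]] := @cech_poly p G (ltnW p5).
- move=> t; rewrite /G -[F t]scale1r -scaleN1r.
  move=> m /msuppD_le; rewrite mem_cat => /orP[]; apply: laurentZ => //.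
  by rewrite mulrC; exact: laurentM.
- by move=> t; rewrite /G cobB cobM -eb' eE subrr.
by exists b, b'; split=> // t; rewrite -Gb subrK.
Qed.
End Homotopy.
End Cech.

(** * Sections and cohomology of line bundles *)

Section LineBundles.
Variable k : closedFieldType.
Local Notation poly7 := {mpoly k[7]}.
Local Notation q := (quadric k).

Lemma pihomogM n (D e : nat) (f h : {mpoly k[n]}) : h \is e.-homog ->
  pihomog mdeg D (f * h) = if (e <= D)%N then pihomog mdeg (D - e) f * h else 0.
Proof.
move=> hh; rewrite {1}(pihomog_partitionE (mf := mdeg) (leqnn (msize f))) mulr_suml raddf_sum /=.
have hom i : pihomog mdeg i f * h \is (i + e).-homog by apply: dhomogM => //; exact: pihomogP.
case: leqP => eD; last first.
  rewrite big1 // => i _; rewrite (pihomog_ne0 _ (hom i)) //.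
  by rewrite neq_ltn (leq_trans eD) ?orbT // leq_addl.
have [lt|ge] := ltnP (D - e) (msize f).
  rewrite (bigD1 (Ordinal lt)) //= pihomog_dE; last by rewrite -{2}(subnK eD).
  rewrite big1 ?addr0 // => i ne; rewrite (pihomog_ne0 _ (hom i)) //.
  by apply: contra ne => /eqP E; rewrite -val_eqE /= -E addnK.
rewrite big1 => [|i _].
  rewrite (_ : pihomog _ _ f = 0) ?mul0r //.
  rewrite /pihomog big1_seq // => m /andP[/eqP mD mf].
  by have := leq_trans (msize_mdeg_lt mf) ge; rewrite -mD ltnn.
rewrite (pihomog_ne0 _ (hom i)) // neq_ltn; apply/orP; left.
by rewrite -(subnK eD) ltn_add2r (leq_trans (ltn_ord i)).
Qed.

Lemma pihomogM_quadric D (f : poly7) x : on_cone x -> (pihomog mdeg D (f * q)).@[x] = 0.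
Proof.
move=> [_ qx]; rewrite (pihomogM _ _ (quadric_homog k)).
by case: ifP => _; rewrite ?meval0 // mevalM qx mulr0.
Qed.

Lemma zmon_split (T T' : {set 'I_7}) N : T \subset T' ->
  zmon (~: T) N = (zmon (~: T') N + zmon (T' :\: T) N)%MM.
Proof.
move=> TT'; apply/mnmP => i; rewrite mnmDE !mnmE !inE.
have := subsetP TT' i; case: (i \in T); case: (i \in T') => //= h; [|by rewrite addn0].
by have := h isT.
Qed.

Lemma zmonT (T : {set 'I_7}) N : zmon setT N = (zmon T N + zmon (~: T) N)%MM.
Proof.
by apply/mnmP => i; rewrite mnmDE !mnmE !inE; case: (i \in T) => //=; rewrite addn0.
Qed.

(* The tuples [t] form an infinite type only because equality of functions is
   not decidable. *)
Lemma tuple_bound p (P : ('I_p -> 'I_7) -> nat -> Prop) :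
  (forall t, exists N0 : nat, forall N, (N0 <= N)%N -> P t N) ->
  exists N0 : nat, forall N, (N0 <= N)%N -> forall t, P t N.
Proof.
move=> /choice[n nP]; exists (\max_(f : {ffun 'I_p -> 'I_7}) n f) => N NN t.
have <- : [ffun i => t i] = t :> ('I_p -> 'I_7) by apply/funext => i; rewrite ffunE.
apply: nP; apply: leq_trans NN.
exact: (leq_bigmax (F := fun f : {ffun 'I_p -> 'I_7} => n f)).
Qed.

Definition zface p (t : 'I_p.+1 -> 'I_7) j : zsub (zcoord k t) (zcoord k (t \o lift j)).
Proof. by move=> x [xQ xt]; split=> // i; exact: xt. Defined.

Lemma regular_common_denominator p (d : int) (c : forall t : 'I_p.+1 -> 'I_7, hfun d (zcoord k t)) :
  exists N : nat, (`|d| <= N)%N /\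
  exists P : ('I_p.+1 -> 'I_7) -> poly7, forall t,
    [/\ exists2 D : nat, P t \is D.-homog & D%:Z = d + (#|idx t| * N)%:Z &
      forall x : pts (zcoord k t), c t x * 'X_[zmon (idx t) N].@[sval x] = (P t).@[sval x]].
Proof.
have [t|N0 NP] := @tuple_bound p.+1 (fun t N => exists (D : nat) (P : poly7),
   [/\ P \is D.-homog, D%:Z = d + (#|idx t| * N)%:Z &
    forall x : pts (zcoord k t), c t x * 'X_[zmon (idx t) N].@[sval x] = P.@[sval x]]).
  exact: regular_zcoord (hfunP (c t)).
exists (N0 + `|d|)%N; split; first exact: leq_addl.
have /choice[P PP] : forall t, exists P : poly7,
    [/\ exists2 D : nat, P \is D.-homog & D%:Z = d + (#|idx t| * (N0 + `|d|))%:Z &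
      forall x : pts (zcoord k t), c t x * 'X_[zmon (idx t) (N0 + `|d|)].@[sval x] = P.@[sval x]].
  move=> t; have [D [P [hP DE PE]]] := NP _ (leq_addr `|d| N0) t.
  by exists P; split=> //; exists D.
by exists P.
Qed.

Lemma hfun_sum d (U : zopen k) I (r : seq I) P (F : I -> hfun d U) x :
  (\sum_(i <- r | P i) F i) x = \sum_(i <- r | P i) F i x.
Proof. by elim/big_rec2: _ => // i y s _ <-. Qed.

(* Čech 0- and higher cocycles of O(d) at once: for [p = 0] the cochain [b] is a
   single form of degree [d], i.e. [c] extends to a global section. *)
Lemma cech_regular p (d : int) (c : forall t : 'I_p.+1 -> 'I_7, hfun d (zcoord k t)) : (p < 5)%N ->
  (forall t (x : pts (zcoord k t)), \sum_(j < p.+2) (-1) ^+ j * c (t \o lift j) (pt_in (zface j) x) = 0) ->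
  exists (N : nat) (b : ('I_p -> 'I_7) -> poly7), [/\ (`|d| <= N)%N,
    forall s, b s \is `|(d + (#|idx s| * N)%:Z)%R|%N.-homog,
    forall s, d + (#|idx s| * N)%:Z < 0 -> b s = 0 &
    forall t (x : pts (zcoord k t)), c t x =
      \sum_(j < p.+1) (-1) ^+ j * ((b (t \o lift j)).@[sval x] / 'X_[zmon (idx (t \o lift j)) N].@[sval x])].
Proof.
move=> p5 dc; have [N [dN [P PP]]] := regular_common_denominator c.
pose w T : poly7 := 'X_[zmon (~: T) N].
have w0 T : w T != 0 by rewrite /w -msupp_eq0 msuppX.
pose F t := P t * w (idx t).
have FE t (x : pts (zcoord k t)) : (F t).@[sval x] = c t x * 'X_[zmon setT N].@[sval x].
  have [_ PE] := PP t; rewrite /F /w (zmonT (idx t)) mpolyXD [in RHS]mevalM mulrA.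
  by rewrite PE mevalM.
have [||b [b' [Lb Lb' Fb]]] := @cech_quadric k N p F p5.
- by move=> t; apply/laurentP; exists (P t).
- move=> t; apply: (@quadric_dvd k _ (zmon (idx t) 1)) => x xQ xt.
  pose y : pts (zcoord k t) := exist _ x (mon_zcoord xQ xt).
  rewrite /cob raddf_sum /=.
  transitivity ('X_[zmon setT N].@[x] * \sum_(j < p.+2) (-1) ^+ j * c (t \o lift j) (pt_in (zface j) y)).
    rewrite mulr_sumr; apply: eq_bigr => j _; rewrite mevalZ (FE _ (pt_in (zface j) y)).
    by rewrite [RHS]mulrCA; congr (_ * _); exact: mulrC.
  by rewrite dc mulr0.
have /choice[h hE] : forall s, exists g, b s = g * w (idx s) by move=> s; apply/laurentP.
have /choice[h' hE'] : forall t, exists g, b' t = g * w (idx t) by move=> t; apply/laurentP.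
pose deg p (s : 'I_p -> 'I_7) : int := d + (#|idx s| * N)%:Z.
pose B s : poly7 := if deg _ s < 0 then 0 else pihomog mdeg `|deg _ s| (h s).
exists N, B; split=> //.
(* Only the component of the expected degree is kept. In negative degree this is 0, so the absolute
   value is never read there. *)
- by move=> s; rewrite /B; case: ifP => _; [exact: dhomog0|exact: pihomogP].
- by move=> s; rewrite /B /deg => ->.
move=> t x; have [[D hP DE] PE] := PP t.
pose m j := zmon (idx t :\: idx (t \o lift j)) N.
have wE j : w (idx (t \o lift j)) = w (idx t) * 'X_[m j].
  by rewrite /w (zmon_split _ (idx_lift t j)) mpolyXD.
have {}Fb : P t = \sum_(j < p.+1) (-1) ^+ j *: (h (t \o lift j) * 'X_[m j]) + h' t * q.
  apply: (mulIf (w0 (idx t))); rewrite -[LHS]/(F t) Fb mulrDl mulr_suml hE' mulrAC.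
  congr (_ + _); apply: eq_bigr => j _; rewrite hE wE -scalerAl; congr (_ *: _).
  by rewrite mulrAC mulrA.
(* In degree [D] the multiple of [q] contributes again a multiple of [q], which vanishes on the
   cone. *)
have {}Fb : P t = \sum_(j < p.+1) (-1) ^+ j *: (B (t \o lift j) * 'X_[m j]) + pihomog mdeg D (h' t * q).
  rewrite -(pihomog_dE (mf := mdeg) hP) {1}Fb raddfD /= raddf_sum /=; congr (_ + _).
  apply: eq_bigr => j _; rewrite linearZ /=; congr (_ *: _).
  have hm : ('X_[m j] : poly7) \is (mdeg (m j)).-homog by rewrite dhomogX.
  have sub := subset_leq_card (idx_lift t j).
  have mdegE : mdeg (m j) = ((#|idx t| - #|idx (t \o lift j)|) * N)%N.
    rewrite zmon_deg cardsD (setIidPr _) //; exact: idx_lift.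
  have DE' : D%:Z = deg _ (t \o lift j) + (mdeg (m j))%:Z.
    rewrite DE /deg -addrA -PoszD; congr (_ + Posz _).
    by rewrite mdegE -mulnDl addnC subnK.
  rewrite (pihomogM _ _ hm) /B; have [Hd|Hd] := boolP (deg _ (t \o lift j) < 0).
    by rewrite ifF ?mul0r //; apply/negP; lia.
  have eD : `|deg p (t \o lift j)|%N = (D - mdeg (m j))%N.
    by move: Hd DE'; rewrite -[p.+1.-1]/p; move: (deg p _) => u; lia.
  rewrite eD ifT //; move: Hd DE'; rewrite -[p.+1.-1]/p; move: (deg p _) => u; lia.
have X0 := zcoord_mon N (svalP x).
apply: (mulIf X0); rewrite PE Fb mevalD (pihomogM_quadric _ _ (zopen_cone (svalP x))) addr0.
rewrite raddf_sum mulr_suml; apply: eq_bigr => j _; rewrite /= mevalZ mevalM -mulrA.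
congr (_ * _); rewrite mulrAC -mulrA; congr (_ * _).
have X0' := zcoord_mon N (svalP (pt_in (zface j) x)).
apply: (mulIf X0'); rewrite divfK // -mevalM -mpolyXD; congr (_.@[_]); congr 'X_[_].
apply/mnmP => i; rewrite mnmDE !mnmE !inE.
have := subsetP (idx_lift t j) i.
case: (i \in idx (t \o lift j)); case: (i \in idx t) => //= hi; rewrite ?addn0 //.
by have := hi isT.
Qed.

(** The case of 0-cocycles: the cochain is then indexed by the empty tuple, whose denominator is
    1. *)
Lemma global_regular (d : int) (f : hfun d (zfull k)) :
  exists2 P : poly7, if d is Posz n then P \is n.-homog else P = 0 &
    forall x, f x = P.@[sval x].
Proof.
pose c (t : 'I_1 -> 'I_7) : hfun d (zcoord k t) := hres (@zsub_full k _) f.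
have [t x|N [b [dN hb hb0 cE]]] := @cech_regular 0 d c isT.
  rewrite !big_ord_recl big_ord0 addr0 expr0 mul1r expr1 mulN1r /=.
  by rewrite (_ : pt_in _ _ = pt_in (@zsub_full k _) (pt_in (zface (lift ord0 ord0)) x)) ?subrr //; exact: pts_inj.
pose s : 'I_0 -> 'I_7 := fun _ => ord0.
have s0 : idx s = set0.
  by apply/setP => i; rewrite inE; apply/negP => /imsetP[[]].
exists (b s).
  have := hb s; have := hb0 s; rewrite s0 cards0 mul0n addr0.
  by case: d {f c hb hb0 cE dN} => // n ->.
move=> x; have [[i xi] xQ] := zopen_cone (svalP x).
pose y : pts (zcoord k (fun _ : 'I_1 => i)) := exist _ (sval x) (conj (zopen_cone (svalP x)) (fun _ => xi)).
have := cE _ y; rewrite big_ord1 expr0 mul1r /= => e.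
rewrite (_ : x = pt_in (@zsub_full k _) y); last exact: pts_inj.
rewrite [LHS]e (_ : _ \o _ = s); last by apply/funext => -[].
rewrite s0 zmon_eval big_set0 divr1 //.
Qed.

Lemma regfun_signE U j (x : pts U) : ((-1) ^+ j : regfun U) x = (-1) ^+ j :> k.
Proof. by elim: j => [//|j IH]; rewrite !exprS /= -IH. Qed.

Lemma OQ_coboundaryE d p (c : cochain (OQ k d) p) t (x : pts (zcoord k t)) :
  (coboundary c t : hfun d _) x = \sum_(j < p.+2) (-1) ^+ j * c (t \o lift j) (pt_in (zface j) x).
Proof.
rewrite /coboundary hfun_sum; apply: eq_bigr => j _.
rewrite -[LHS]/(((-1) ^+ j : regfun _) x * c (t \o lift j) (pt_in (@zcoord_face _ _ t j) x)).
by rewrite regfun_signE; congr (_ * c _ _); exact: pts_inj.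
Qed.

Lemma OQ_cohomology (i : nat) (d : int) : (0 < i < 5)%N -> cohomology_vanishes (OQ k d) i.
Proof.
case: i => // p /= p5 c dc.
have [t x|N [b [dN hb hb0 cE]]] := @cech_regular p.+1 d c p5.
  by rewrite -OQ_coboundaryE dc.
have B_ex : forall s : 'I_p.+1 -> 'I_7, exists B : hfun d (zcoord k s),
    forall x, B x = (b s).@[sval x] / 'X_[zmon (idx s) N].@[sval x].
  move=> s; pose D := `|(d + (#|idx s| * N)%:Z)%R|%N.
  have idx0 : (0 < #|idx s|)%N by apply/card_gt0P; exists (s ord0); exact: imset_f.
  have DE : D%:Z - (#|idx s| * N)%:Z = d.
    have : (N <= #|idx s| * N)%N by rewrite leq_pmull.
    by rewrite /D; lia.
  have hX : ('X_[zmon (idx s) N] : poly7) \is (#|idx s| * N).-homog.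
    by rewrite dhomogX /= zmon_deg.
  by exists (mkhfun (regular_frac (hb s) hX DE (fun x => @zcoord_mon k _ s x N))).
exists (fun s => sval (cid (B_ex s))) => t; apply: hfun_inj => x.
rewrite OQ_coboundaryE (cE t x).
by apply: eq_bigr => j _; rewrite (svalP (cid (B_ex _))).
Qed.
End LineBundles.

(** * Isomorphisms, twists and duals of sheaves of modules *)

Section Sheaves.
Variable k : closedFieldType.
Local Notation vec := ('I_7 -> k).
Local Notation poly7 := {mpoly k[7]}.
Implicit Types (U V W : zopen k) (M N : omodule k).

Lemma oiso_sym M N : oiso M N -> oiso N M.
Proof. by move=> [f [g fg]]; exists g, f => U; have [] := fg U. Qed.

Program Definition ocomp M N P (g : omor N P) (f : omor M N) : omor M P :=
  @OMor k M P (fun U s => g U (f U s)) _ _.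
Next Obligation. by move=> M N P g f U a s t /=; rewrite (omor_linear f) (omor_linear g). Qed.
Next Obligation. by move=> M N P g f U V VU s /=; rewrite (omor_res f) (omor_res g). Qed.

Lemma oiso_trans M N P : oiso M N -> oiso N P -> oiso M P.
Proof.
move=> [f [g fg]] [f' [g' fg']]; exists (ocomp f' f), (ocomp g g') => U.
have [c1 c2] := fg U; have [c1' c2'] := fg' U.
by split=> s /=; rewrite ?c1' ?c1 ?c2 ?c2'.
Qed.

Lemma omorD M N (f : omor M N) U (s t : M U) : f U (s + t) = f U s + f U t.
Proof. by have := omor_linear f 1 s t; rewrite !scale1r. Qed.

Lemma omorN M N (f : omor M N) U (s : M U) : f U (- s) = - f U s.
Proof. by apply: (addrI (f U s)); rewrite -omorD !subrr omor0. Qed.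

Lemma omorZ M N (f : omor M N) U a (s : M U) : f U (a *: s) = a *: f U s.
Proof. by have := omor_linear f a s 0; rewrite omor0 !addr0. Qed.

Lemma omor_sum M N (f : omor M N) U I (r : seq I) P (F : I -> M U) :
  f U (\sum_(i <- r | P i) F i) = \sum_(i <- r | P i) f U (F i).
Proof.
elim/big_rec2: _ => [|i y s _ <-]; [exact: omor0|exact: omorD].
Qed.

Lemma res_sum M U V (VU : zsub V U) I (r : seq I) P (F : I -> M U) :
  res M VU (\sum_(i <- r | P i) F i) = \sum_(i <- r | P i) res M VU (F i).
Proof.
elim/big_rec2: _ => [|i y s _ <-]; [exact: res0|exact: resD].
Qed.

Lemma bij_oiso M N (f : omor M N) : (forall U, injective (@f U)) ->
  (forall U (t : N U), exists s, f U s = t) -> oiso M N.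
Proof.
move=> inj surj; pose g U t := sval (cid (surj U t)).
have gK U t : f U (g U t) = t := svalP (cid (surj U t)).
have gl U a s t : g U (a *: s + t) = a *: g U s + g U t.
  by apply: inj; rewrite omor_linear !gK.
have gr U V (VU : zsub V U) s : g V (res N VU s) = res M VU (g U s).
  by apply: inj; rewrite omor_res !gK.
exists f, (OMor gl gr) => U; split=> s /=; last exact: gK.
by apply: inj; rewrite gK.
Qed.

(** Local preimages are unique, so they agree on overlaps and glue. *)
Lemma inj_surj M N (f : omor M N) : (forall U, injective (@f U)) ->
  osurjective f -> forall U (t : N U), exists s, f U s = t.
Proof.
move=> inj surj U t.
pose c (x : pts U) := cid (surj U t _ (svalP x)); pose V x := sval (c x).
have VP x : {VU : zsub (V x) U | V x (sval x) /\ exists s, f _ s = res N VU t}.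
  exact: cid (svalP (c x)).
pose VU x := sval (VP x).
have sP x : {s | f _ s = res N (VU x) t} by exact: cid (svalP (VP x)).2.
have cov : covers V U.
  split=> [x|x Ux]; first exact: VU.
  by exists (exist _ x Ux); have [] := svalP (VP (exist _ x Ux)).
have [|s sE] := sec_glue cov (f := fun x => sval (sP x)).
  move=> x y W Wx Wy; apply: inj; rewrite !omor_res !(svalP (sP _)).
  by rewrite !(res_comp _ _ (zsub_trans Wx (VU x))).
exists s; apply: (sec_separated cov) => x Vx.
by rewrite -omor_res sE (svalP (sP x)); exact: res_irr.
Qed.

Lemma local_oiso M N (f : omor M N) : (forall U, injective (@f U)) ->
  osurjective f -> oiso M N.
Proof. by move=> inj surj; apply: (bij_oiso inj); exact: inj_surj. Qed.

Lemma inj_omor M N (f : omor M N) U : (forall s, f U s = 0 -> s = 0) -> injective (@f U).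
Proof.
move=> H s t e; apply/eqP; rewrite -subr_eq0; apply/eqP/H.
by rewrite omorD omorN e subrr.
Qed.

Program Definition twist_map M N (f : omor M N) d : omor (twist M d) (twist N d) :=
  @OMor k (twist M d) (twist N d)
    (fun U (s : tsec M d U) => @TSec k N d U (fun i => f _ (s i)) _) _ _.
Next Obligation.
by move=> M N f d U s i j W Wi Wj; rewrite -!omor_res (tvalP s Wi Wj) omorZ.
Qed.
Next Obligation.
by move=> M N f d U a s t; apply: tsec_inj => i /=; rewrite omor_linear.
Qed.
Next Obligation.
by move=> M N f d U V VU s; apply: tsec_inj => i /=; rewrite omor_res.
Qed.

Lemma oiso_twist M N d : oiso M N -> oiso (twist M d) (twist N d).
Proof.
move=> [f [g fg]]; exists (twist_map f d), (twist_map g d) => U.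
by split=> s; apply: tsec_inj => i /=; have [c1 c2] := fg (zmeet U (chart k i)); rewrite ?c1 ?c2.
Qed.

Program Definition dual_map M N (f : omor M N) : omor (odual N) (odual M) :=
  @OMor k (odual N) (odual M)
    (fun U (p : dsec N U) => @DSec k M U (fun V VU s => p V VU (f V s)) _ _) _ _.
Next Obligation. by move=> M N f U p V VU a s t /=; rewrite omor_linear dval_linear. Qed.
Next Obligation.
by move=> M N f U p V W VU WV WU s /=; rewrite omor_res (dval_res p VU WV WU).
Qed.
Next Obligation. by move=> M N f U a s t; exact: dsec_inj. Qed.
Next Obligation. by move=> M N f U V VU s; exact: dsec_inj. Qed.

Lemma oiso_dual M N : oiso M N -> oiso (odual M) (odual N).
Proof.
move=> [f [g fg]]; exists (dual_map g), (dual_map f) => U.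
split=> p; apply: dsec_inj => V VU s /=; have [c1 c2] := fg V; rewrite ?c1 ?c2 //.
Qed.

Lemma hfun_pt d U (f : hfun d U) (x y : pts U) : sval x = sval y -> f x = f y.
Proof. by move=> /pts_inj ->. Qed.

Lemma chart_neq0 i x : chart k i x -> x i != 0.
Proof. by case=> _ /(_ ord0). Qed.

Lemma chartP i x : on_cone x -> x i != 0 -> chart k i x.
Proof. by []. Qed.

Lemma ratioE d i j U (Ui : zsub U (chart k i)) (Uj : zsub U (chart k j)) (x : pts U) :
  ratio d Ui Uj x = (sval x j / sval x i) ^ d.
Proof.
rewrite /ratio /= [LHS](_ : _ = sval x j ^ d * sval x i ^ (- d)) //.
by rewrite exprzMl ?unitfE ?invr_eq0 ?(chart_neq0 (Ui _ (svalP x))) ?(chart_neq0 (Uj _ (svalP x))) //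
   -exprz_inv.
Qed.

(** The comparison map sends [s] to the family [(z_j / z_i)^d s], with [j] the chart of the outer
    twist and [i] that of the inner one. The entries with [i = j] recover [s]. *)
Lemma twist_twist M d e : d + e = 0 -> oiso M (twist (twist M d) e).
Proof.
move=> de; have eE : e = - d by apply/eqP; rewrite -subr_eq0 opprK addrC de.
pose A U j i := zmeet (zmeet U (chart k j)) (chart k i).
have Aj U j i : zsub (A U j i) (chart k j) by move=> x [[]].
have Ai U j i : zsub (A U j i) (chart k i) by move=> x [].
have AU U j i : zsub (A U j i) U by move=> x [[]].
pose cmp U j i (s : M U) : M (A U j i) := ratio d (Ai U j i) (Aj U j i) *: res M (AU U j i) s.
have cmpP U j (s : M U) i i' W (Wi : zsub W (A U j i)) (Wi' : zsub W (A U j i')) :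
    res M Wi (cmp U j i s) =
    ratio d (zsub_trans Wi (@zmeetr _ _ _)) (zsub_trans Wi' (@zmeetr _ _ _)) *: res M Wi' (cmp U j i' s).
  rewrite !resZ !(res_comp _ _ (zsub_trans Wi (AU U j i))) scalerA; congr (_ *: _).
  apply: hfun_inj => x.
  rewrite -[RHS]/(ratio d _ _ x * ratio d _ _ (pt_in Wi' x)) -[LHS]/(ratio d _ _ (pt_in Wi x)) !ratioE /=.
  have xi := chart_neq0 (Ai _ _ _ _ (Wi _ (svalP x))); have xi' := chart_neq0 (Ai _ _ _ _ (Wi' _ (svalP x))).
  have xj := chart_neq0 (Aj _ _ _ _ (Wi' _ (svalP x))).
  rewrite -exprzMl ?unitfE ?mulf_neq0 ?invr_eq0 //; congr (_ ^ _).
  by rewrite [RHS]mulrC mulrA divfK.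
pose cmp1 U j s : tsec M d (zmeet U (chart k j)) := TSec (@cmpP U j s).
have cmp1P U (s : M U) j j' W (Wj : zsub W (zmeet U (chart k j))) (Wj' : zsub W (zmeet U (chart k j'))) :
    tres Wj (cmp1 U j s) =
    (ratio e (zsub_trans Wj (@zmeetr _ _ _)) (zsub_trans Wj' (@zmeetr _ _ _)) : regfun W) *:
      (tres Wj' (cmp1 U j' s) : twist M d W).
  apply: tsec_inj => i /=; rewrite !resZ.
  have WU : zsub (zmeet W (chart k i)) U by move=> x [/Wj[]].
  rewrite !(res_comp _ _ WU) scalerA; congr (_ *: _).
  apply: hfun_inj => x.
  have xW := svalP x; have xi := chart_neq0 xW.2.
  have xj := chart_neq0 (Wj _ xW.1).2; have xj' := chart_neq0 (Wj' _ xW.1).2.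
  rewrite -[RHS]/(ratio e _ _ (pt_in (@zmeetl _ _ _) x) * ratio d _ _ (pt_in _ x)).
  rewrite -[LHS]/(ratio d _ _ (pt_in _ x)) !ratioE /=.
  rewrite eE -exprz_inv -exprzMl ?unitfE ?invr_eq0 ?mulf_neq0 ?invr_eq0 //; congr (_ ^ _).
  by field; rewrite xi xj xj'.
pose F U s : tsec (twist M d) e U := @TSec k (twist M d) e U (fun j => cmp1 U j s) (@cmp1P U s).
have Fl U a (s t : M U) : F U (a *: s + t) = (a : regfun U) *: (F U s : twist (twist M d) e U) + F U t.
  apply: tsec_inj => j; apply: tsec_inj => i /=; rewrite /cmp res_linear scalerDr !scalerA; congr (_ *: _ + _).
  by rewrite mulrC (rres_comp _ _ (AU U j i)).
have Fr U V (VU : zsub V U) (s : M U) : F V (res M VU s) = tres VU (F U s : twist (twist M d) e U).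
  apply: tsec_inj => j; apply: tsec_inj => i /=; rewrite /cmp resZ.
  by rewrite (res_comp _ _ (zsub_trans (AU V j i) VU)) (res_comp _ _ (zsub_trans (AU V j i) VU));
     congr (_ *: _); apply: hfun_inj => x.
have ratio1 U i (h h' : zsub U (chart k i)) : ratio d h h' = 1.
  by apply: hfun_inj => x; rewrite ratioE divff ?exp1rz // (chart_neq0 (h _ (svalP x))).
pose f : omor M (twist (twist M d) e) := @OMor k M (twist (twist M d) e) F Fl Fr.
apply: (local_oiso (f := f)) => [U|U s x Ux].
  apply: inj_omor => s /= Fs; apply: sec_local => x Ux.
  have [[i xi] _] := zopen_cone Ux.
  exists (A U i i), (AU U i i); have ci : chart k i x by split=> //; exact: zopen_cone Ux.
  split; first by [].
  have := congr1 (fun h : tsec (twist M d) e U => h i i) Fs.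
  by rewrite /= /cmp ratio1 scale1r res0.
have [[i xi] _] := zopen_cone Ux; exists (A U i i), (AU U i i).
have ci : chart k i x by split=> //; exact: zopen_cone Ux.
have Ax : A U i i x by [].
split=> //; exists (s i i); apply: tsec_inj => j; apply: tsec_inj => l.
rewrite -[LHS]/(ratio d (Ai (A U i i) j l) (Aj _ j l) *: res M (AU _ j l) (s i i)).
set B := A (A U i i) j l; have Bii : zsub B (A U i i) := AU _ j l.
have Bi : zsub B (zmeet (zmeet U (chart k i)) (chart k l)) by move=> y [[[[Uy yi] _] yj] yl].
have Bj : zsub B (zmeet (zmeet U (chart k j)) (chart k l)) by move=> y [[[[Uy yi] _] yj] yl].
have e1 := tvalP (s i) Bii Bi.
pose W := zmeet (A U i i) (chart k j).
have Wi : zsub W (zmeet U (chart k i)) by move=> y [[[Uy yi] _] yj].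
have Wj : zsub W (zmeet U (chart k j)) by move=> y [[[Uy yi] _] yj].
have BW : zsub B (zmeet W (chart k l)) by move=> y [].
have e2 := congr1 (fun h : tsec M d W => res M BW (h l)) (tvalP s Wi Wj).
move: e2; rewrite /= resZ !(res_comp _ _ Bi) !(res_comp _ _ Bj) => e2.
rewrite [RHS](res_irr _ Bj) (res_irr _ Bii) e1 e2 !scalerA -[RHS]scale1r; congr (_ *: _).
apply: hfun_inj => y.
have By := svalP y; have yl := chart_neq0 By.2; have yi := chart_neq0 (Bi _ By).1.2.
have yj := chart_neq0 (Bj _ By).1.2.
rewrite -[LHS]/(ratio d _ _ y * ratio d _ _ y * ratio e _ _ (pt_in _ (pt_in BW y))) !ratioE /=.
rewrite eE -exprz_inv -!exprzMl ?unitfE ?invr_eq0 ?mulf_neq0 ?invr_eq0 ?invr_eq0 //.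
rewrite [X in X ^ _](_ : _ = 1) ?exp1rz //.
by field; rewrite yl yi yj.
Qed.

Lemma cohomology_iso M N i : oiso M N -> cohomology_vanishes M i -> cohomology_vanishes N i.
Proof.
move=> [f [g fg]] H c dc.
have fgK U (s : N U) : f U (g U s) = s by have [_] := fg U.
have cobf p (A B : omodule k) (u : omor A B) (e : cochain A p) t :
    coboundary (fun t => u _ (e t)) t = u _ (coboundary e t).
  by rewrite /coboundary omor_sum; apply: eq_bigr => j _; rewrite omorZ omor_res.
have := H (fun t => g _ (c t)); case: i c dc {H} => [|p] c dc H.
  have {}H : forall t, g _ (c t) = 0.
    by apply: H => t; rewrite cobf dc omor0.
  by move=> t; rewrite -[c t]fgK H omor0.
have [|b bE] := H; first by move=> t; rewrite cobf dc omor0.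
by exists (fun t => f _ (b t)) => t; rewrite cobf -bE fgK.
Qed.

Lemma h0_iso M N n : oiso M N -> h0_eq M n -> h0_eq N n.
Proof.
move=> [f [g fg]] [e eP]; exists (fun i => f _ (e i)) => s.
have [c1 c2] := fg (zfull k).
have sumE (c : {ffun 'I_n -> k}) :
    \sum_i hcst (zfull k) (c i) *: f _ (e i) = f _ (\sum_i hcst (zfull k) (c i) *: e i).
  by rewrite omor_sum; apply: eq_bigr => i _; rewrite omorZ.
have [c [cE cU]] := eP (g _ s); exists c; split=> [|c' c'E].
  by rewrite sumE -cE c2.
by apply: cU; rewrite c'E sumE c1.
Qed.

Lemma vanishes_omor M N (f : omor M N) U (s : M U) x : vanishes_at s x -> vanishes_at (f U s) x.
Proof.
move=> [V [VU [Vx [n [a [t [a0 e]]]]]]]; exists V, VU, Vx, n, a, (fun i => f V (t i)).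
by split=> //; rewrite -omor_res e omor_sum; apply: eq_bigr => i _; rewrite omorZ.
Qed.
End Sheaves.

(** * Subsheaves of [O(d)^n] defined by conditions on values *)

Section Fibres.
Variable k : closedFieldType.
Local Notation vec := ('I_7 -> k).
Local Notation poly7 := {mpoly k[7]}.
Implicit Types (U V W : zopen k).

Definition evmx m n (P : 'M[poly7]_(m, n)) (x : vec) : 'M[k]_(m, n) := map_mx (meval x) P.

Definition homog_mx r m n (P : 'M[poly7]_(m, n)) := forall i j, P i j \is r.-homog.

Lemma evmx_tr m n (P : 'M[poly7]_(m, n)) x : evmx P^T x = (evmx P x)^T.
Proof. by rewrite /evmx map_trmx. Qed.

Lemma regular_sum d U (I : Type) (r : seq I) (F : I -> pts U -> k) :
  (forall i, is_regular d (F i)) -> is_regular d (fun x => \sum_(i <- r) F i x).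
Proof.
move=> H; elim: r => [|i r IH].
  rewrite (_ : (fun _ => _) = fun=> 0); first exact: regular0.
  by apply/funext => x; rewrite big_nil.
rewrite (_ : (fun _ => _) = F i + (fun x => \sum_(j <- r) F j x)); first exact: regularD.
by apply/funext => x; rewrite big_cons.
Qed.

Lemma regular_mul d d' e U (f g : pts U -> k) : d + d' = e ->
  is_regular d f -> is_regular d' g -> is_regular e (fun x => f x * g x).
Proof. by move=> <- hf hg; exact: (regularM hf hg). Qed.

Definition regular_vec n d U (v : pts U -> 'cV[k]_n) :=
  forall i, is_regular d (fun x => v x i 0).

Lemma regular_vec_mx r m n d e U (P : 'M[poly7]_(m, n)) (v : pts U -> 'cV[k]_n) :
  homog_mx r P -> r%:Z + d = e -> regular_vec d v ->
  regular_vec e (fun x => evmx P (sval x) *m v x).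
Proof.
move=> hP de hv i; rewrite (_ : (fun _ => _) = fun x => \sum_j (P i j).@[sval x] * v x j 0).
  by apply: regular_sum => j; apply: (regular_mul de); [exact: regular_poly|exact: hv].
by apply/funext => x; rewrite mxE; apply: eq_bigr => j _; rewrite mxE.
Qed.

Lemma regular_vec_cmx m n d U (C : 'M[k]_(m, n)) (v : pts U -> 'cV[k]_n) :
  regular_vec d v -> regular_vec d (fun x => C *m v x).
Proof.
move=> hv i; rewrite (_ : (fun _ => _) = fun x => \sum_j C i j * v x j 0).
  by apply: regular_sum => j; apply: (regular_mul (add0r d)); [exact: regular_cst|exact: hv].
by apply/funext => x; rewrite mxE.
Qed.

Lemma regular_vec_pow n d d' e U i (v : pts U -> 'cV[k]_n) : zsub U (chart k i) -> d' + d = e ->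
  regular_vec d v -> regular_vec e (fun x => sval x i ^ d' *: v x).
Proof.
move=> Ui de hv j; rewrite (_ : (fun _ => _) = fun x => sval x i ^ d' * v x j 0).
  by apply: (regular_mul de); [exact: regular_pow|exact: hv].
by apply/funext => x; rewrite mxE.
Qed.

Lemma regular_vec_cst n U (v : 'cV[k]_n) : regular_vec 0 (fun _ : pts U => v).
Proof. by move=> i; exact: regular_cst. Qed.

Definition vval n d U (s : {ffun 'I_n -> hfun d U}) (x : pts U) : 'cV[k]_n := \col_i s i x.

Lemma vval_inj n d U (s t : {ffun 'I_n -> hfun d U}) : (forall x, vval s x = vval t x) -> s = t.
Proof.
move=> e; apply/ffunP => i; apply: hfun_inj => x.
by have /colP/(_ i) := e x; rewrite !mxE.
Qed.

Lemma regular_vval n d U (s : {ffun 'I_n -> hfun d U}) : regular_vec d (vval s).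
Proof.
move=> i; rewrite (_ : (fun _ => _) = s i); first exact: hfunP.
by apply/funext => x; rewrite mxE.
Qed.

Definition mkvec n d U (v : pts U -> 'cV[k]_n) (hv : regular_vec d v) : {ffun 'I_n -> hfun d U} :=
  [ffun i => mkhfun (hv i)].

Lemma vval_mkvec n d U (v : pts U -> 'cV[k]_n) (hv : regular_vec d v) x : vval (mkvec hv) x = v x.
Proof. by apply/colP => i; rewrite mxE ffunE. Qed.

(** Kernels and images of matrices of forms both give such a family of subspaces, so a single
    construction [PS], the vectors of regular functions with values in the family, serves for
    both. *)
Record fibres n := Fibres {
  fib :> vec -> 'cV[k]_n -> Prop;
  fib0 : forall x, fib x 0;
  fib_linear : forall x a v w, fib x v -> fib x w -> fib x (a *: v + w) }.

Lemma vval_linear n d U a (s t : osum n (OQ k d) U) x :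
  vval (a *: s + t : osum n (OQ k d) U) x = a x *: vval s x + vval t x.
Proof. by apply/colP => i; rewrite !mxE !ffunE. Qed.

Lemma vval_res n d U V (VU : zsub V U) (s : osum n (OQ k d) U) x :
  vval (res (osum n (OQ k d)) VU s : {ffun _}) x = vval s (pt_in VU x).
Proof. by apply/colP => i; rewrite !mxE ffunE. Qed.

Program Definition psub n d (L : fibres n) : subsheaf (osum n (OQ k d)) :=
  @SubSheaf k (osum n (OQ k d)) (fun U s => forall x, L (sval x) (vval s x)) _ _ _ _.
Next Obligation.
move=> n d L U x; rewrite (_ : vval _ _ = 0); first exact: fib0.
by apply/colP => i; rewrite !mxE ffunE.
Qed.
Next Obligation.
by move=> n d L U a s t Ls Lt x; rewrite vval_linear; exact: fib_linear.
Qed.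
Next Obligation.
move=> n d L U V VU s Ls x; rewrite vval_res; exact: (Ls (pt_in VU x)).
Qed.
Next Obligation.
move=> n d L U s H x; have [V [VU [Vx Ls]]] := H _ (svalP x).
have := Ls (exist _ _ Vx); rewrite vval_res /=.
by rewrite (_ : pt_in _ _ = x) //; exact: pts_inj.
Qed.

Definition PS n d (L : fibres n) : omodule k := osub (psub d L).

Section PSTheory.
Variables (n : nat) (d : int) (L : fibres n).

Definition pval U (s : PS d L U) (x : pts U) : 'cV[k]_n := vval (ssval s) x.

Lemma pval_fib U (s : PS d L U) x : L (sval x) (pval s x).
Proof. by have /asboolP h := ssvalP s; exact: h. Qed.

Lemma pval_inj U (s t : PS d L U) : (forall x, pval s x = pval t x) -> s = t.
Proof. by move=> e; apply: val_inj; exact: vval_inj. Qed.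

Lemma pval_regular U (s : PS d L U) : regular_vec d (pval s).
Proof. exact: regular_vval. Qed.

Definition mkPS U (v : pts U -> 'cV[k]_n) (hv : regular_vec d v)
    (Lv : forall x, L (sval x) (v x)) : PS d L U :=
  @SSec k _ (psub d L) U (mkvec hv) (asboolT (fun x => eq_ind_r (L (sval x)) (Lv x) (vval_mkvec hv x))).

Lemma pval_mkPS U (v : pts U -> 'cV[k]_n) (hv : regular_vec d v) Lv x :
  pval (@mkPS U v hv Lv) x = v x.
Proof. exact: vval_mkvec. Qed.

Lemma pval_linear U a (s t : PS d L U) x : pval (a *: s + t) x = a x *: pval s x + pval t x.
Proof. exact: vval_linear. Qed.

Lemma pval_res U V (VU : zsub V U) (s : PS d L U) x :
  pval (res (PS d L) VU s) x = pval s (pt_in VU x).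
Proof. exact: vval_res. Qed.

Lemma pval0 U x : pval (0 : PS d L U) x = 0.
Proof. by apply/colP => i; rewrite !mxE ffunE. Qed.

Lemma pvalZ U a (s : PS d L U) x : pval (a *: s) x = a x *: pval s x.
Proof. by rewrite -[a *: s]addr0 pval_linear pval0 addr0. Qed.

Lemma pvalD U (s t : PS d L U) x : pval (s + t) x = pval s x + pval t x.
Proof. by rewrite -[s]scale1r pval_linear scale1r scale1r. Qed.

Lemma pval_sum U I (r : seq I) P (F : I -> PS d L U) x :
  pval (\sum_(i <- r | P i) F i) x = \sum_(i <- r | P i) pval (F i) x.
Proof. by elim/big_rec2: _ => [|i y s _ <-]; [exact: pval0|exact: pvalD]. Qed.

Lemma pval_pt U (s : PS d L U) (x y : pts U) : sval x = sval y -> pval s x = pval s y.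
Proof. by move=> /pts_inj ->. Qed.

(** The converse rests on local generators; it is proved below for images that split
    ([pval0_vanishes]). *)
Lemma vanishes_pval U (s : PS d L U) x (Ux : U x) : vanishes_at s x -> pval s (exist _ x Ux) = 0.
Proof.
move=> [V [VU [Vx [m [a [t [a0 e]]]]]]].
rewrite (_ : exist _ x Ux = pt_in VU (exist _ x Vx)); last exact: pts_inj.
rewrite -pval_res e pval_sum big1 // => i _.
by rewrite pvalZ a0 scale0r.
Qed.
End PSTheory.

Section FibreMaps.
Variables (n n' : nat) (d d' : int) (L : fibres n) (L' : fibres n').
Variable phi : vec -> 'cV[k]_n -> 'cV[k]_n'.
Hypothesis phi_linear : forall x a v w, phi x (a *: v + w) = a *: phi x v + phi x w.
Hypothesis phi_regular : forall U (s : PS d L U), regular_vec d' (fun x => phi (sval x) (pval s x)).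
Hypothesis phi_fib : forall x v, on_cone x -> L x v -> L' x (phi x v).

Let F U (s : PS d L U) : PS d' L' U :=
  mkPS (phi_regular s) (fun x => phi_fib (zopen_cone (svalP x)) (pval_fib s x)).

Program Definition fibre_map : omor (PS d L) (PS d' L') := @OMor k (PS d L) (PS d' L') F _ _.
Next Obligation.
by move=> U a s t; apply: pval_inj => x; rewrite pval_linear !pval_mkPS pval_linear.
Qed.
Next Obligation.
by move=> U V VU s; apply: pval_inj => x; rewrite pval_res !pval_mkPS pval_res.
Qed.

Lemma pval_fibre_map U (s : PS d L U) x : pval (fibre_map U s) x = phi (sval x) (pval s x).
Proof. exact: pval_mkPS. Qed.
End FibreMaps.

(** Over [z_i <> 0] the inverse of [T] is [x_i ^- r *: C i]. Injectivity of [T] on the fibres makes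
    these local right inverses two-sided and independent of [i]. *)
Lemma oiso_constant_mx n n' d (L : fibres n) (L' : fibres n') (T : 'M[k]_(n', n)) r
    (C : 'I_7 -> 'M[poly7]_(n, n')) :
  (forall i, homog_mx r (C i)) ->
  (forall x v, on_cone x -> L x v -> L' x (T *m v)) ->
  (forall x v, on_cone x -> L x v -> T *m v = 0 -> v = 0) ->
  (forall x w i, on_cone x -> L' x w ->
     L x (evmx (C i) x *m w) /\ T *m (evmx (C i) x *m w) = x i ^+ r *: w) ->
  oiso (PS d L) (PS d L').
Proof.
move=> hC TL Tinj TC.
pose f : omor (PS d L) (PS d L') := @fibre_map _ _ d d L L' (fun _ v => T *m v)
  (fun x a v w => etrans (mulmxDr _ _ _) (congr1 (fun u => u + _) (esym (scalemxAr _ _ _))))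
  (fun U s => regular_vec_cmx T (pval_regular s)) TL.
have fE U (s : PS d L U) x : pval (f U s) x = T *m pval s x by exact: pval_fibre_map.
apply: (local_oiso (f := f)) => [U|U s x Ux].
  apply: inj_omor => s fs0; apply: pval_inj => x; rewrite pval0.
  apply: (Tinj (sval x)); [exact: zopen_cone (svalP x)|exact: pval_fib|].
  by rewrite -fE fs0 pval0.
have [[i xi] _] := zopen_cone Ux; pose V := zmeet U (chart k i).
have ci : chart k i x by split=> //; exact: zopen_cone Ux.
exists V, (@zmeetl _ _ _); split; first by split.
pose s' := res (PS d L') (@zmeetl _ U (chart k i)) s.
have rv : regular_vec d (fun y : pts V => sval y i ^ (- r%:Z) *: (evmx (C i) (sval y) *m pval s' y)).
  apply: (regular_vec_pow (d := r%:Z + d)); [exact: zmeetr|lia|].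
  by apply: regular_vec_mx; [exact: hC|reflexivity|exact: pval_regular].
have Lv y : L (sval y) (sval y i ^ (- r%:Z) *: (evmx (C i) (sval y) *m pval s' y)).
  rewrite -[_ *: _]addr0; apply: fib_linear; last exact: fib0.
  by have [] := TC _ _ i (zopen_cone (svalP y)) (pval_fib s' y).
exists (mkPS rv Lv); apply: pval_inj => y; rewrite fE pval_mkPS -scalemxAr.
have [_ ->] := TC _ _ i (zopen_cone (svalP y)) (pval_fib s' y).
have yi := chart_neq0 (svalP y).2.
by rewrite scalerA -exprnN mulVf ?scale1r // expf_neq0.
Qed.

Lemma oiso_fib n d (L L' : fibres n) :
  (forall x v, on_cone x -> L x v <-> L' x v) -> oiso (PS d L) (PS d L').
Proof.
move=> LL'; apply: (@oiso_constant_mx _ _ _ _ _ 1%:M 0 (fun _ => 1%:M)).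
- by move=> _ i j; rewrite mxE; case: eqP => _; [exact: dhomog1|exact: dhomog0].
- by move=> x v xQ Lv; rewrite mul1mx; apply/LL'.
- by move=> x v _ _; rewrite mul1mx.
move=> x w i xQ Lw; rewrite (_ : evmx 1%:M x = 1%:M) ?mul1mx ?expr0 ?scale1r; last exact: map_mx1.
by split=> //; apply/LL'.
Qed.

(** A section [s] of degree [d'] corresponds to the family [z_i^(-e) s] of sections of degree
    [d]. *)
Lemma twist_PS n d e d' (L : fibres n) : d + e = d' -> oiso (twist (PS d L) e) (PS d' L).
Proof.
move=> de; apply: oiso_sym.
have rv U i (s : PS d' L U) : regular_vec d (fun x : pts (zmeet U (chart k i)) =>
    sval x i ^ (- e) *: pval s (pt_in (@zmeetl _ _ _) x)).
  apply: (regular_vec_pow (d := d')); [exact: zmeetr|lia|].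
  by move=> j; exact: (regular_res (@zmeetl _ U (chart k i)) (pval_regular s j)).
have Lv U i (s : PS d' L U) (x : pts (zmeet U (chart k i))) :
    L (sval x) (sval x i ^ (- e) *: pval s (pt_in (@zmeetl _ _ _) x)).
  rewrite -[_ *: _]addr0; apply: fib_linear; last exact: fib0.
  exact: (pval_fib s (pt_in _ x)).
pose F U i s : PS d L _ := mkPS (rv U i s) (Lv U i s).
have FE U i s x : pval (F U i s) x = sval x i ^ (- e) *: pval s (pt_in (@zmeetl _ _ _) x).
  exact: pval_mkPS.
have FP U (s : PS d' L U) i j W (Wi : zsub W (zmeet U (chart k i))) (Wj : zsub W (zmeet U (chart k j))) :
    res (PS d L) Wi (F U i s) =
    ratio e (zsub_trans Wi (@zmeetr _ _ _)) (zsub_trans Wj (@zmeetr _ _ _)) *: res (PS d L) Wj (F U j s).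
  apply: pval_inj => x; rewrite pvalZ !pval_res !FE ratioE scalerA /=.
  rewrite (pval_pt s (y := pt_in (@zmeetl _ _ _) (pt_in Wj x))) //; congr (_ *: _).
  have xi := chart_neq0 (Wi _ (svalP x)).2; have xj := chart_neq0 (Wj _ (svalP x)).2.
  rewrite -!exprz_inv -exprzMl ?unitfE ?mulf_neq0 ?invr_eq0 //; congr (_ ^ _).
  by rewrite mulrAC divff // mul1r.
pose G U s : tsec (PS d L) e U := @TSec k (PS d L) e U (fun i => F U i s) (FP U s).
have Gl U a (s t : PS d' L U) : G U (a *: s + t) = a *: (G U s : twist (PS d L) e U) + G U t.
  apply: tsec_inj => i; apply: pval_inj => x; rewrite FE pval_linear.
  rewrite -[RHS]/(pval (rres (@zmeetl _ _ _) a *: F U i s + F U i t : PS d L _) x) pval_linear !FE.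
  by rewrite scalerDr !scalerA mulrC.
have Gr U V (VU : zsub V U) (s : PS d' L U) : G V (res (PS d' L) VU s) = res (twist (PS d L) e) VU (G U s).
  apply: tsec_inj => i; apply: pval_inj => x; rewrite FE pval_res.
  rewrite -[RHS]/(pval (res (PS d L) (zmeetS VU) (F U i s)) x) pval_res FE.
  by congr (_ *: _); exact: pval_pt.
pose f : omor (PS d' L) (twist (PS d L) e) := @OMor k (PS d' L) (twist (PS d L) e) G Gl Gr.
apply: (local_oiso (f := f)) => [U|U s x Ux].
  apply: inj_omor => s fs0; apply: pval_inj => x.
  have [[i xi] _] := zopen_cone (svalP x).
  have ci : chart k i (sval x) by split=> //; exact: zopen_cone (svalP x).
  pose y : pts (zmeet U (chart k i)) := exist _ (sval x) (conj (svalP x) ci).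
  have /eqP := congr1 (fun h : tsec (PS d L) e U => pval (h i) y) fs0.
  rewrite [X in X == _]FE (pval0 d L y) scaler_eq0 expfz_eq0 (negPf xi) andbF /= => /eqP e0.
  by rewrite pval0 -e0; exact: pval_pt.
have [[i xi] _] := zopen_cone Ux; pose V := zmeet U (chart k i).
have ci : chart k i x by split=> //; exact: zopen_cone Ux.
exists V, (@zmeetl _ _ _); split; first by split.
have rs : regular_vec d' (fun y : pts V => sval y i ^ e *: pval (s i) y).
  apply: (regular_vec_pow (d := d)); [exact: zmeetr|lia|exact: pval_regular].
have Ls (y : pts V) : L (sval y) (sval y i ^ e *: pval (s i) y).
  by rewrite -[_ *: _]addr0; apply: fib_linear; [exact: pval_fib|exact: fib0].
exists (mkPS rs Ls); apply: tsec_inj => j; apply: pval_inj => y.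
rewrite [LHS]FE pval_mkPS.
rewrite -[RHS]/(pval (res (PS d L) (zmeetS (@zmeetl _ _ _)) (s j)) y) pval_res.
have Wi : zsub (zmeet V (chart k j)) (zmeet U (chart k i)) by move=> u [].
have Wj : zsub (zmeet V (chart k j)) (zmeet U (chart k j)) by move=> u [[]].
have := congr1 (fun h => pval h y) (tvalP s Wj Wi); rewrite /= pvalZ !pval_res ratioE => e1.
rewrite (pval_pt (s j) (y := pt_in Wj y)) // e1 scalerA.
have yi := chart_neq0 (Wi _ (svalP y)).2; have yj := chart_neq0 (Wj _ (svalP y)).2.
rewrite (pval_pt (s i) (y := pt_in Wi y)) //; congr (_ *: _).
by rewrite /= -exprz_inv -exprzMl ?unitfE ?invr_eq0 // mulrC.
Qed.
End Fibres.

(** * Images of split matrices and their duals *)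

Section Images.
Variable k : closedFieldType.
Local Notation vec := ('I_7 -> k).
Local Notation poly7 := {mpoly k[7]}.
Implicit Types (U V W : zopen k).

Program Definition im_fibres m n (P : 'M[poly7]_(m, n)) : fibres k m :=
  @Fibres k m (fun x v => exists u : 'cV[k]_n, v = evmx P x *m u) _ _.
Next Obligation. by move=> m n P x /=; exists 0; rewrite mulmx0. Qed.
Next Obligation.
move=> m n P x a v w /= [u ->] [u' ->]; exists (a *: u + u').
by rewrite mulmxDr scalemxAr.
Qed.

Program Definition ker_fibres m n (P : 'M[poly7]_(m, n)) : fibres k n :=
  @Fibres k n (fun x v => evmx P x *m v = 0) _ _.
Next Obligation. by move=> m n P x /=; rewrite mulmx0. Qed.
Next Obligation.
by move=> m n P x a v w /= hv hw; rewrite mulmxDr -scalemxAr hv hw scaler0 addr0.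
Qed.

Lemma dval_sum (M : omodule k) U (p : dsec M U) V (VU : zsub V U) n
    (a : 'I_n -> regfun V) (s : 'I_n -> M V) x :
  p V VU (\sum_i a i *: s i) x = \sum_i a i x * p V VU (s i) x.
Proof.
have -> : p V VU (\sum_i a i *: s i) = \sum_i a i * p V VU (s i).
  elim/big_rec2: _ => [|i y t _ <-].
    have := dval_linear p VU 1 0 0; rewrite scale1r addr0 mul1r => e.
    by apply: (addrI (p V VU 0)); rewrite addr0 -e.
  exact: dval_linear.
exact: (hfun_sum (d := 0)).
Qed.

(* The idempotents [x_i ^- r *: (P E_i)] split the image of [P] off over the
   chart [z_i != 0]. *)
Definition splits r m n (P : 'M[poly7]_(m, n)) (E : 'I_7 -> 'M[k]_(n, m)) :=
  forall x i, on_cone x -> evmx P x *m E i *m evmx P x = x i ^+ r *: evmx P x.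

Section Split.
Variables (r : nat) (m n : nat) (P : 'M[poly7]_(m, n)) (E : 'I_7 -> 'M[k]_(n, m)).
Hypotheses (hP : homog_mx r P) (PE : splits r P E).
Variables (d e : int) (de : r%:Z + d = e).
Local Notation I := (PS e (im_fibres P)).

Lemma gen_regular U i (u : 'cV[k]_n) : zsub U (chart k i) ->
  regular_vec e (fun x : pts U => sval x i ^ d *: (evmx P (sval x) *m u)).
Proof.
move=> Ui; apply: (regular_vec_pow (d := r%:Z)) => //; first by rewrite addrC.
apply: (regular_vec_mx (r := r) (d := 0)); [exact: hP|exact: addr0|exact: regular_vec_cst].
Qed.

Lemma gen_fib U i (u : 'cV[k]_n) (x : pts U) :
  im_fibres P (sval x) (sval x i ^ d *: (evmx P (sval x) *m u)).
Proof. by exists (sval x i ^ d *: u); rewrite scalemxAr. Qed.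

Definition gen U i (Ui : zsub U (chart k i)) (u : 'cV[k]_n) : I U :=
  mkPS (gen_regular u Ui) (gen_fib i u).

Lemma pval_gen U i (Ui : zsub U (chart k i)) u x :
  pval (gen Ui u) x = sval x i ^ d *: (evmx P (sval x) *m u).
Proof. exact: pval_mkPS. Qed.

Lemma coef_regular U i (Ui : zsub U (chart k i)) (s : I U) :
  regular_vec 0 (fun x => sval x i ^ (- e) *: (E i *m pval s x)).
Proof.
apply: (regular_vec_pow (d := e)) => //; first by rewrite addNr.
exact: regular_vec_cmx (pval_regular s).
Qed.

Definition coef U i (Ui : zsub U (chart k i)) (s : I U) : {ffun 'I_n -> hfun 0 U} :=
  mkvec (coef_regular Ui s).

Lemma coefE U i (Ui : zsub U (chart k i)) (s : I U) x j :
  coef Ui s j x = sval x i ^ (- e) * (E i *m pval s x) j 0.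
Proof.
by have /colP/(_ j) := vval_mkvec (coef_regular Ui s) x; rewrite !mxE => ->.
Qed.

Lemma gen_coef U i (Ui : zsub U (chart k i)) (s : I U) :
  s = \sum_j (coef Ui s j : regfun U) *: gen Ui (delta_mx j 0).
Proof.
apply: pval_inj => x; rewrite pval_sum.
have xi := chart_neq0 (Ui _ (svalP x)).
have e1 : evmx P (sval x) *m E i *m pval s x = sval x i ^+ r *: pval s x.
  have [u ->] := pval_fib s x.
  by rewrite mulmxA PE ?scalemxAl //; exact: zopen_cone (svalP x).
transitivity (sval x i ^ (d - e) *: (evmx P (sval x) *m (E i *m pval s x))).
  rewrite mulmxA e1 scalerA [sval x i ^+ r]exprnP -expfzDr // (_ : d - e + r%:Z = 0) ?expr0z ?scale1r //.
  by lia.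
rewrite [X in evmx P _ *m X]matrix_sum_delta mulmx_sumr scaler_sumr.
apply: eq_bigr => j _; rewrite big_ord1 pvalZ pval_gen coefE -scalemxAr !scalerA.
by rewrite expfzDr // [in RHS]mulrAC; congr (_ * _ *: _); exact: mulrC.
Qed.

Lemma pval0_vanishes U (s : I U) x (Ux : U x) : pval s (exist _ x Ux) = 0 -> vanishes_at s x.
Proof.
move=> s0; have [[i xi] _] := zopen_cone Ux; pose V := zmeet U (chart k i).
have ci : chart k i x by split=> //; exact: zopen_cone Ux.
have VU : zsub V U by exact: zmeetl.
have Vi : zsub V (chart k i) by exact: zmeetr.
exists V, VU, (conj Ux ci), n, (coef Vi (res I VU s)), (fun j => gen Vi (delta_mx j 0)).
split; last exact: gen_coef.
move=> j; rewrite coefE pval_res (pval_pt s (y := exist _ x Ux)) // s0.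
by rewrite mulmx0 mxE mulr0.
Qed.

(** A generalized inverse of [P] at [x]. It depends on the chart picked, but its pairing of the
    images of [P^T] and [P] does not: on [P^T u'] and [P u] it is [u'^T P u]. *)
Definition ginv (x : vec) : 'M[k]_(n, m) :=
  if [pick i | x i != 0] is Some i then x i ^ (- r%:Z) *: E i else 0.

Lemma pair_ginv x i (c : 'cV[k]_n) (w : 'cV[k]_m) : on_cone x -> x i != 0 ->
  im_fibres P^T x c -> im_fibres P x w ->
  c^T *m ginv x *m w = x i ^ (- r%:Z) *: (c^T *m E i *m w).
Proof.
move=> xQ xi [u' ->] [u ->]; rewrite evmx_tr trmx_mul trmxK.
have key j : x j != 0 ->
    u'^T *m evmx P x *m (x j ^ (- r%:Z) *: E j) *m (evmx P x *m u) = u'^T *m evmx P x *m u.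
  move=> xj; have /(congr1 (fun A => u'^T *m A *m u)) := PE j xQ.
  rewrite -!scalemxAr -!scalemxAl -!mulmxA => ->.
  by rewrite -exprnN scalerA mulVf ?scale1r // expf_neq0.
rewrite [RHS](_ : _ = u'^T *m evmx P x *m (x i ^ (- r%:Z) *: E i) *m (evmx P x *m u)); last first.
  by rewrite -scalemxAr -scalemxAl.
rewrite key // /ginv; case: pickP => [j xj|/(_ i)]; last by rewrite xi.
exact: key.
Qed.

Lemma pair_ginv_gen x (c u : 'cV[k]_n) : on_cone x -> im_fibres P^T x c ->
  c^T *m ginv x *m (evmx P x *m u) = c^T *m u.
Proof.
move=> xQ Lc; have [[i xi] _] := xQ.
rewrite (pair_ginv xQ xi Lc); last by exists u.
have [u' ->] := Lc; rewrite evmx_tr trmx_mul trmxK.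
have /(congr1 (fun A => u'^T *m A *m u)) := PE i xQ.
rewrite -!scalemxAr -!scalemxAl -!mulmxA => ->.
by rewrite -exprnN scalerA mulVf ?scale1r // expf_neq0.
Qed.

(** The pairing of [P^T u'] with [P u] given by [u'^T P u] is perfect between the two images. For a
    pairing with values in [O], the image of [P^T] must sit in degree [r - e = - d]. *)
Lemma dual_PS d' : d' = - d -> oiso (odual I) (PS d' (im_fibres P^T)).
Proof.
move=> d'E; apply: oiso_sym; pose D := PS d' (im_fibres P^T).
have preg U V (VU : zsub V U) (c : D U) (w : I V) :
    is_regular 0 (fun x : pts V => ((pval c (pt_in VU x))^T *m ginv (sval x) *m pval w x) 0 0).
  apply: regular_local => x; have [[i xi] _] := zopen_cone (svalP x).
  pose W := zmeet V (chart k i); have WV : zsub W V by exact: zmeetl.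
  have ci : chart k i (sval x) by split=> //; exact: zopen_cone (svalP x).
  exists W, WV; split; first by split=> //; exact: svalP.
  rewrite (_ : _ \o _ = fun y => sval y i ^ (- r%:Z) *
     \sum_j (pval c (pt_in VU (pt_in WV y)) j 0 * (E i *m pval w (pt_in WV y)) j 0)).
    apply: (@regular_mul _ (- r%:Z) (d' + e)); [lia| |].
      by apply: regular_pow; exact: zmeetr.
    apply: regular_sum => j; apply: (regular_mul (erefl (d' + e))).
      exact: (regular_res WV (regular_res VU (pval_regular c j))).
    exact: (regular_res WV (regular_vec_cmx (E i) (pval_regular w) j)).
  apply/funext => y /=; have yi := chart_neq0 (svalP y).2.
  rewrite (pair_ginv (i := i) (zopen_cone (svalP y)) yi); first last.
  - exact: (pval_fib w (pt_in WV y)).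
  - exact: (pval_fib c (pt_in VU (pt_in WV y))).
  rewrite -mulmxA !mxE; congr (_ * _); apply: eq_bigr => j _.
  by rewrite mxE.
pose pr U V (VU : zsub V U) (c : D U) (w : I V) : regfun V := mkhfun (preg U V VU c w).
have prE U V (VU : zsub V U) (c : D U) (w : I V) x :
  pr U V VU c w x = ((pval c (pt_in VU x))^T *m ginv (sval x) *m pval w x) 0 0 by [].
have prl U (c : D U) V (VU : zsub V U) a (s t : I V) :
    pr U V VU c (a *: s + t) = a * pr U V VU c s + pr U V VU c t.
  apply: hfun_inj => x; rewrite prE pval_linear mulmxDr -scalemxAr mxE; congr (_ + _).
  by rewrite mxE.
have prr U (c : D U) V W (VU : zsub V U) (WV : zsub W V) (WU : zsub W U) (s : I V) :
    pr U W WU c (res I WV s) = rres WV (pr U V VU c s).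
  apply: hfun_inj => x; rewrite prE pval_res.
  rewrite -[RHS]/(pr U V VU c s (pt_in WV x)) prE /=.
  by rewrite (pval_pt c (y := pt_in VU (pt_in WV x))).
pose F U c : dsec I U := DSec (prl U c) (prr U c).
have Fl U a (s t : D U) : F U (a *: s + t) = a *: (F U s : odual I U) + F U t.
  apply: dsec_inj => V VU w; apply: hfun_inj => x.
  rewrite -[RHS]/(a (pt_in VU x) * pr U V VU s w x + pr U V VU t w x).
  rewrite -[LHS]/(pr U V VU _ w x) !prE pval_linear linearP /= !mulmxDl -!scalemxAl !mxE.
  by [].
have Fr U V (VU : zsub V U) (s : D U) : F V (res D VU s) = res (odual I) VU (F U s).
  apply: dsec_inj => W WV w; apply: hfun_inj => x.
  rewrite -[LHS]/(pr V W WV _ w x) -[RHS]/(pr U W (zsub_trans WV VU) s w x) !prE pval_res.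
  by rewrite (pval_pt s (y := pt_in (zsub_trans WV VU) x)).
pose f : omor D (odual I) := @OMor k D (odual I) F Fl Fr.
apply: (local_oiso (f := f)) => [U|U p x Ux].
  apply: inj_omor => c fc0; apply: pval_inj => x; rewrite pval0.
  have [[i xi] _] := zopen_cone (svalP x).
  pose V := zmeet U (chart k i); have VU : zsub V U by exact: zmeetl.
  have Vi : zsub V (chart k i) by exact: zmeetr.
  have ci : chart k i (sval x) by split=> //; exact: zopen_cone (svalP x).
  pose y : pts V := exist _ (sval x) (conj (svalP x) ci).
  apply/colP => j; rewrite [RHS]mxE.
  have := congr1 (fun h : dsec I U => h V VU (gen Vi (delta_mx j 0)) y) fc0.
  rewrite -[X in X = _]/(pr U V VU c _ y) prE pval_gen -scalemxAr mxE /=.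
  rewrite pair_ginv_gen; [|exact: zopen_cone (svalP x)|exact: (pval_fib c (pt_in VU y))].
  rewrite -[X in _ = X]/0 => /eqP; rewrite mulf_eq0 expfz_eq0 (negPf xi) andbF /=.
  rewrite (pval_pt c (y := x)) // => /eqP <-.
  by rewrite -colE [RHS]mxE [RHS]mxE.
have [[i xi] _] := zopen_cone Ux; pose V := zmeet U (chart k i).
have ci : chart k i x by split=> //; exact: zopen_cone Ux.
have VU : zsub V U by exact: zmeetl.
have Vi : zsub V (chart k i) by exact: zmeetr.
exists V, VU; split; first by split.
pose phi j := p V VU (gen Vi (delta_mx j 0)).
have phiE W (WV : zsub W V) (Wi : zsub W (chart k i)) (w : I W) y :
    p W (zsub_trans WV VU) w y = \sum_j sval y i ^ (- e) * (E i *m pval w y) j 0 * phi j (pt_in WV y).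
  rewrite {1}(gen_coef Wi w) dval_sum; apply: eq_bigr => j _; rewrite coefE; congr (_ * _).
  rewrite (_ : gen Wi _ = res I WV (gen Vi (delta_mx j 0))); last first.
    by apply: pval_inj => u; rewrite pval_res !pval_gen.
  by rewrite (dval_res p VU WV (zsub_trans WV VU)).
(* The generators are [x_i^d P e_j], so the vector representing [p] has [j]-th entry [x_i^(-d)]
   times the value of [p] on the [j]-th one. *)
pose c (y : pts V) : 'cV[k]_n := sval y i ^ (- d) *: \col_j phi j y.
have rc : regular_vec d' c.
  apply: (regular_vec_pow (d := 0)); [exact: Vi|lia|].
  move=> j; rewrite (_ : (fun _ => _) = phi j); first exact: hfunP.
  by apply/funext => y; rewrite mxE.
have Lc y : im_fibres P^T (sval y) (c y).
  have yi := chart_neq0 (Vi _ (svalP y)).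
  exists (sval y i ^ (- r%:Z) *: ((E i)^T *m c y)); apply/colP => j.
  rewrite -scalemxAr mulmxA evmx_tr -trmx_mul mxE [X in _ * X]mxE.
  rewrite /c mxE mxE [X in _ * X = _](_ : _ = p V (zsub_trans (@zsub_refl k V) VU) (gen Vi (delta_mx j 0)) y); last first.
    by rewrite (dval_irr _ _ VU).
  rewrite (phiE V (@zsub_refl k V) Vi) !mulr_sumr; apply: eq_bigr => l _.
  rewrite pval_gen -scalemxAr mulmxA -colE !mxE (_ : phi l (pt_in _ y) = phi l y); last exact: hfun_pt.
  rewrite !mulrA -!expfzDr // (_ : - d - e + d = - r%:Z - d); last by lia.
  by rewrite expfzDr // -!mulrA; congr (_ * _); rewrite mulrCA.
exists (mkPS rc Lc); apply: dsec_inj => W WV w; apply: hfun_inj => y.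
have Wi : zsub W (chart k i) by move=> u /WV[].
rewrite -[LHS]/(pr V W WV _ w y) -[RHS]/(p W (zsub_trans WV VU) w y) prE (phiE W WV Wi).
have yi := chart_neq0 (Wi _ (svalP y)).
rewrite (pair_ginv (i := i) (zopen_cone (svalP y)) yi); first last.
- exact: pval_fib.
- by rewrite pval_mkPS; exact: (Lc (pt_in WV y)).
rewrite pval_mkPS -mulmxA mxE mxE mulr_sumr; apply: eq_bigr => j _.
rewrite /c mxE mxE mxE mulrA mulrA -expfzDr // mulrAC; congr (_ ^ _ * _ * _).
by lia.
Qed.
End Split.

(** A vector of functions lying pointwise in the image has the local preimage [x_i^(-r) E_i s], so
    the image sheaf is determined by the images on fibres. *)
Lemma image_PS m n r d e (P : 'M[poly7]_(m, n)) (hP : forall i j, P i j \is r.-homog)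
    (de : r%:Z + d = e) (E : 'I_7 -> 'M[k]_(n, m)) : splits r P E ->
  oiso (oimage (matrix_mor hP de)) (PS e (im_fibres P)).
Proof.
move=> PE; pose f0 := matrix_mor hP de.
have f0E U (t : osum n (OQ k d) U) x : vval (f0 U t : {ffun _}) x = evmx P (sval x) *m vval t x.
  apply/colP => i; rewrite mxE ffunE hfun_sum mxE; apply: eq_bigr => j _.
  by rewrite !mxE.
have imP U (s : osum m (OQ k e) U) :
    in_image f0 s <-> forall x : pts U, im_fibres P (sval x) (vval s x).
  split=> [H x|H x Ux].
    have [V [VU [Vx [t tE]]]] := H _ (svalP x).
    exists (vval t (exist _ _ Vx)); have := f0E V t (exist _ _ Vx).
    rewrite tE vval_res /= => <-; by congr (vval s _); exact: pts_inj.
  have [[i xi] _] := zopen_cone Ux; pose V := zmeet U (chart k i).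
  have ci : chart k i x by split=> //; exact: zopen_cone Ux.
  have VU : zsub V U by exact: zmeetl.
  exists V, VU; split; first by split.
  have rt : regular_vec d (fun y : pts V => sval y i ^ (- r%:Z) *: (E i *m vval s (pt_in VU y))).
    apply: (regular_vec_pow (d := e)); [exact: zmeetr|lia|].
    apply: regular_vec_cmx => j; exact: (regular_res VU (regular_vval s j)).
  exists (mkvec rt); apply: vval_inj => y; rewrite f0E vval_mkvec vval_res.
  have yi := chart_neq0 (svalP y).2.
  have [u ->] := H (pt_in VU y).
  rewrite -scalemxAr !mulmxA PE; last exact: zopen_cone (svalP y).
  by rewrite -scalemxAl scalerA -exprnN mulVf ?scale1r // expf_neq0.
pose F U (s : oimage f0 U) : PS e (im_fibres P) U :=
  @SSec k _ (psub e (im_fibres P)) U (ssval s) (asboolT (proj1 (imP U _) (asboolW (ssvalP s)))).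
have Fl U a (s t : oimage f0 U) : F U (a *: s + t) = a *: F U s + F U t by exact: val_inj.
have Fr U V (VU : zsub V U) (s : oimage f0 U) :
  F V (res (oimage f0) VU s) = res (PS e (im_fibres P)) VU (F U s) by exact: val_inj.
pose f : omor (oimage f0) (PS e (im_fibres P)) := @OMor k (oimage f0) _ F Fl Fr.
apply: (bij_oiso (f := f)) => [U s t /(congr1 val) /= e1|U s]; first exact: val_inj.
have Is : in_image f0 (ssval s) by apply/imP => x; exact: pval_fib.
by exists (@SSec k _ (image_subsheaf f0) U (ssval s) (asboolT Is)); exact: val_inj.
Qed.
End Images.

(** * Identities for left multiplication by split octonions *)

Section Octonions.
Variable R : comNzRingType.
Implicit Types (x y v : nat -> R).

(* Left multiplication in the split octonions, in Zorn's vector matrix form: the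
   entries of [y] are (alpha, Xi, Upsilon, beta), where Xi and Upsilon are vectors
   of length 3, and [y] maps (a, U, W, b) to
   (alpha a + Xi.W, alpha U + b Xi + Upsilon x W,
    a Upsilon + beta W - Xi x U, beta b + Upsilon.U). *)
Definition oct_mul y v : seq R :=
  [:: y 0%N * v 0%N + y 1%N * v 4%N + y 2%N * v 5%N + y 3%N * v 6%N;
      y 0%N * v 1%N + v 7%N * y 1%N + (y 5%N * v 6%N - y 6%N * v 5%N);
      y 0%N * v 2%N + v 7%N * y 2%N + (y 6%N * v 4%N - y 4%N * v 6%N);
      y 0%N * v 3%N + v 7%N * y 3%N + (y 4%N * v 5%N - y 5%N * v 4%N);
      v 0%N * y 4%N + y 7%N * v 4%N - (y 2%N * v 3%N - y 3%N * v 2%N);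
      v 0%N * y 5%N + y 7%N * v 5%N - (y 3%N * v 1%N - y 1%N * v 3%N);
      v 0%N * y 6%N + y 7%N * v 6%N - (y 1%N * v 2%N - y 2%N * v 1%N);
      y 7%N * v 7%N + y 4%N * v 1%N + y 5%N * v 2%N + y 6%N * v 3%N].

Definition oct_mx y : 'M[R]_8 :=
  \matrix_(i, j) nth 0 (nth [::]
    [:: [:: y 0%N; 0; 0; 0; y 1%N; y 2%N; y 3%N; 0];
        [:: 0; y 0%N; 0; 0; 0; - y 6%N; y 5%N; y 1%N];
        [:: 0; 0; y 0%N; 0; y 6%N; 0; - y 4%N; y 2%N];
        [:: 0; 0; 0; y 0%N; - y 5%N; y 4%N; 0; y 3%N];
        [:: y 4%N; 0; y 3%N; - y 2%N; y 7%N; 0; 0; 0];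
        [:: y 5%N; - y 3%N; 0; y 1%N; 0; y 7%N; 0; 0];
        [:: y 6%N; y 2%N; - y 1%N; 0; 0; 0; y 7%N; 0];
        [:: 0; y 4%N; y 5%N; y 6%N; 0; 0; 0; y 7%N]] i) j.

Definition coords n (v : 'cV[R]_n.+1) (j : nat) : R := v (inord j) 0.

Lemma coordsE n (v : 'cV[R]_n.+1) j : v j 0 = coords v j.
Proof. by rewrite /coords inord_val. Qed.

Lemma oct_mxE y (v : 'cV[R]_8) i : (oct_mx y *m v) i 0 = nth 0 (oct_mul y (coords v)) i.
Proof.
rewrite mxE; under eq_bigr => j _ do rewrite mxE coordsE.
rewrite !big_ord_recr big_ord0 /=.
by case: i => i /=; do 8?[case: i => [|i]] => //= _; ring.
Qed.

Lemma coords_oct y (v : 'cV[R]_8) j : (j < 8)%N ->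
  coords (oct_mx y *m v) j = nth 0 (oct_mul y (coords v)) j.
Proof. by move=> hj; rewrite /coords oct_mxE inordK. Qed.

Definition oct_conj y (i : nat) : R :=
  if i == 0%N then y 7%N else if i == 7%N then y 0%N else - y i.

Definition oct_norm y : R := y 0%N * y 7%N - (y 1%N * y 4%N + y 2%N * y 5%N + y 3%N * y 6%N).

Definition oct_trace x y : R := x 0%N * y 0%N + x 7%N * y 7%N +
  (x 1%N * y 4%N + x 2%N * y 5%N + x 3%N * y 6%N) +
  (x 4%N * y 1%N + x 5%N * y 2%N + x 6%N * y 3%N).

Lemma eq_mulmx_col m n (A B : 'M[R]_(m, n)) : (forall v : 'cV_n, A *m v = B *m v) -> A = B.
Proof.
move=> e; apply/matrixP => i j; have /colP/(_ i) := e (delta_mx j 0).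
by rewrite -!colE !mxE.
Qed.

(** [oct_trace x y] is the trace of the product of [x] and [y], and the identity is the polarized
    form of [oct_mx_norm]. Both survive the lack of associativity because the octonions are
    alternative. *)
Lemma oct_mx_trace x y :
  oct_mx x *m oct_mx y + oct_mx (oct_conj y) *m oct_mx (oct_conj x) = (oct_trace x y)%:M.
Proof.
apply: eq_mulmx_col => v; rewrite mulmxDl -!mulmxA mul_scalar_mx; apply/colP => i.
rewrite mxE !oct_mxE mxE coordsE /=.
case: i => i /=; do 8?[case: i => [|i]] => //= _;
  rewrite !coords_oct //= /oct_conj /oct_trace /=; ring.
Qed.

Lemma oct_mx_norm x : oct_mx x *m oct_mx (oct_conj x) = (oct_norm x)%:M.
Proof.
apply: eq_mulmx_col => v; rewrite -!mulmxA mul_scalar_mx; apply/colP => i.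
rewrite !oct_mxE mxE coordsE /=.
case: i => i /=; do 8?[case: i => [|i]] => //= _;
  rewrite !coords_oct //= /oct_conj /oct_norm /=; ring.
Qed.

(** The hyperbolic pairs [(z_1, z_2)], [(z_3, z_4)], [(z_5, z_6)] become the matching entries of Xi
    and Upsilon, and the opposite diagonal entries make the trace zero. *)
Definition imag (z : nat -> R) : nat -> R :=
  nth 0 [:: z 0%N; z 1%N; z 3%N; z 5%N; z 2%N; z 4%N; z 6%N; - z 0%N].

Lemma oct_mxN x y : (forall i, (i < 8)%N -> y i = - x i) -> oct_mx y = - oct_mx x.
Proof.
move=> e; apply/matrixP => i j; rewrite !mxE.
case: i => i /=; do 8?[case: i => [|i]] => //= _;
case: j => j /=; do 8?[case: j => [|j]] => //= _; rewrite ?oppr0 ?opprK ?e ?opprK //.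
Qed.

Lemma imag_conj z : oct_mx (oct_conj (imag z)) = - oct_mx (imag z).
Proof.
apply: oct_mxN => i; do 8?[case: i => [|i]] => //= _; rewrite /oct_conj /imag /= ?opprK //.
Qed.

Lemma oct_mx_sqr z : oct_mx (imag z) *m oct_mx (imag z) =
  (z 0%N ^+ 2 + z 1%N * z 2%N + z 3%N * z 4%N + z 5%N * z 6%N)%:M.
Proof.
have := oct_mx_norm (imag z); rewrite imag_conj mulmxN => /eqP.
rewrite eqr_oppLR => /eqP ->; rewrite -raddfN; congr _%:M.
rewrite /oct_norm /imag /=; ring.
Qed.

(** Obtained from [oct_mx_trace] by multiplying with [x] on the right. For [x] of norm zero only the
    term proportional to [oct_mx x] is left, which is the source of the splittings of [M]. *)
Lemma oct_mx_sandwich x y : oct_mx x *m oct_mx y *m oct_mx x =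
  oct_trace x y *: oct_mx x - oct_norm x *: oct_mx (oct_conj y).
Proof.
have /(congr1 (mulmx^~ (oct_mx x))) := oct_mx_trace x y.
rewrite mulmxDl mul_scalar_mx => <-.
have e : oct_mx (oct_conj x) *m oct_mx x = (oct_norm x)%:M.
  have := oct_mx_norm (oct_conj x).
  rewrite (_ : oct_mx (oct_conj (oct_conj x)) = oct_mx x); last first.
    apply/matrixP => i j; rewrite !mxE.
    case: i => i /=; do 8?[case: i => [|i]] => //= _;
    case: j => j /=; do 8?[case: j => [|j]] => //= _; rewrite /oct_conj /= ?opprK //.
  by move=> ->; congr _%:M; rewrite /oct_norm /oct_conj /=; ring.
by rewrite -[oct_mx (oct_conj y) *m _ *m _]mulmxA e mul_mx_scalar addrK.
Qed.
End Octonions.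

(** * The matrix [M] and its splittings *)

Section SpinorMatrix.
Variable k : closedFieldType.
Local Notation vec := ('I_7 -> k).
Local Notation poly7 := {mpoly k[7]}.
Implicit Types (x : vec).

Definition zc x (n : nat) : k := x (inord n).

Definition spin_mx : 'M[poly7]_8 := oct_mx (imag (zvar k)).

Lemma spin_homog : homog_mx 1 spin_mx.
Proof.
move=> i j; rewrite mxE /imag.
case: i => i /=; do 8?[case: i => [|i]] => //= _;
case: j => j /=; do 8?[case: j => [|j]] => //= _;
by rewrite ?rpredN; first [exact: dhomog0|exact: zvar_homog].
Qed.

Lemma spin_ev x : evmx spin_mx x = oct_mx (imag (zc x)).
Proof.
apply/matrixP => i j; rewrite !mxE /imag.
case: i => i /=; do 8?[case: i => [|i]] => //= _;
case: j => j /=; do 8?[case: j => [|j]] => //= _;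
by rewrite ?mevalN ?meval0 ?mevalN ?mevalXU.
Qed.

(** Octonions of norm zero dual to the coordinates: the trace of their product with [imag x] is
    [x_i]. For [z_0] this is a diagonal idempotent, since the imaginary octonion of [z_0] would give
    [2 x_0]. *)
Definition spin_unit (i : 'I_7) (j : nat) : k := (j == nth 0 [:: 0; 4; 1; 5; 2; 6; 3] i)%N%:R.

Definition spin_inv (i : 'I_7) : 'M[k]_8 := oct_mx (spin_unit i).

Lemma zcE x i : x i = zc x i.
Proof. by rewrite /zc inord_val. Qed.

Lemma spin_unit_trace x i : oct_trace (imag (zc x)) (spin_unit i) = x i.
Proof.
rewrite zcE /oct_trace /imag /spin_unit.
by case: i => i /=; do 7?[case: i => [|i]] => //= _; ring.
Qed.

Lemma spin_unit_norm i : oct_norm (spin_unit i) = 0.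
Proof.
rewrite /oct_norm /spin_unit.
by case: i => i /=; do 7?[case: i => [|i]] => //= _; ring.
Qed.

Lemma imag_norm x : on_cone x -> oct_norm (imag (zc x)) = 0.
Proof.
move=> [_]; rewrite quadricE -/(zc x _) => qx; rewrite -oppr0 -qx.
by rewrite /oct_norm /imag /zc /=; ring.
Qed.

Lemma spin_sqr x : on_cone x -> evmx spin_mx x *m evmx spin_mx x = 0.
Proof.
by move=> [_]; rewrite quadricE spin_ev oct_mx_sqr => ->; rewrite raddf0.
Qed.

Lemma spin_splits : splits 1 spin_mx spin_inv.
Proof.
move=> x i xQ; rewrite spin_ev oct_mx_sandwich spin_unit_trace imag_norm //.
by rewrite scale0r subr0.
Qed.

(** The roles of the two factors are exchanged: over the chart, [M] is injective on the image of the
    constant matrix [E_i]. This gives uniqueness of coefficients in the local frames of S. *)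
Lemma spin_splits' x i : spin_inv i *m evmx spin_mx x *m spin_inv i = x i *: spin_inv i.
Proof.
rewrite spin_ev oct_mx_sandwich spin_unit_norm scale0r subr0; congr (_ *: _).
by rewrite -spin_unit_trace /oct_trace; ring.
Qed.

(** By the trace identity [spin_inv i] is, up to conjugation, a homotopy between [x_i] and 0 on the
    complex with differential [M]. *)
Lemma spin_ker x (v : 'cV[k]_8) i : evmx spin_mx x *m v = 0 ->
  x i *: v = evmx spin_mx x *m (spin_inv i *m v).
Proof.
rewrite spin_ev => Mv; have /(congr1 (mulmx^~ v)) := oct_mx_trace (imag (zc x)) (spin_unit i).
rewrite mulmxDl imag_conj mulmxN mulNmx -!mulmxA Mv mulmx0 subr0 => ->.
by rewrite mul_scalar_mx spin_unit_trace.
Qed.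

Lemma spin_ker_im x (v : 'cV[k]_8) : on_cone x ->
  ker_fibres spin_mx x v <-> im_fibres spin_mx x v.
Proof.
move=> xQ; split=> /= [Mv|[u ->]]; last by rewrite mulmxA spin_sqr // mul0mx.
have [[i xi] _] := xQ; exists ((x i)^-1 *: (spin_inv i *m v)).
by rewrite -scalemxAr -spin_ker // scalerA mulVf ?scale1r.
Qed.

(* Gram matrix of the bilinear form of the norm: left multiplication by an
   imaginary octonion is skew-adjoint. *)
Definition oct_gram : 'M[k]_8 := \matrix_(i, j)
  if (i == 0 :> nat) && (j == 7 :> nat) || (i == 7 :> nat) && (j == 0 :> nat) then 1 else
  if (0 < i < 7)%N && (0 < j < 7)%N && ((i + 3 == j) || (j + 3 == i))%N then -1 else 0.

Lemma oct_gramE (v : 'cV[k]_8) i : (oct_gram *m v) i 0 =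
  nth 0 [:: coords v 7; - coords v 4; - coords v 5; - coords v 6;
            - coords v 1; - coords v 2; - coords v 3; coords v 0] i.
Proof.
rewrite mxE; under eq_bigr => j _ do rewrite mxE coordsE.
rewrite !big_ord_recr big_ord0 /=.
by case: i => i /=; do 8?[case: i => [|i]] => //= _; ring.
Qed.

Lemma coords_gram (v : 'cV[k]_8) i : (i < 8)%N -> coords (oct_gram *m v) i =
  nth 0 [:: coords v 7; - coords v 4; - coords v 5; - coords v 6;
            - coords v 1; - coords v 2; - coords v 3; coords v 0] i.
Proof. by move=> hi; rewrite /coords oct_gramE inordK. Qed.

Lemma oct_gram_sqr : oct_gram *m oct_gram = 1%:M.
Proof.
apply: eq_mulmx_col => v; rewrite -mulmxA mul1mx; apply/colP => i.
rewrite oct_gramE coordsE.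
by case: i => i /=; do 8?[case: i => [|i]] => //= _; rewrite coords_gram //= opprK.
Qed.

Lemma oct_gram_tr : oct_gram^T = oct_gram.
Proof.
apply/matrixP => i j; rewrite !mxE.
case: i => i /=; do 8?[case: i => [|i]] => //= _;
by case: j => j /=; do 8?[case: j => [|j]].
Qed.

Lemma spin_tr x : (evmx spin_mx x)^T *m oct_gram = - (oct_gram *m evmx spin_mx x).
Proof.
apply/matrixP => i j; rewrite spin_ev mxE.
have G l : (oct_gram *m oct_mx (imag (zc x))) l j = (oct_gram *m col j (oct_mx (imag (zc x)))) l 0.
  by rewrite !mxE; apply: eq_bigr => m _; rewrite [X in _ = _ * X]mxE.
rewrite [RHS]mxE G oct_gramE.
rewrite (_ : \sum_l _ = (oct_gram *m oct_mx (imag (zc x))) j i); last first.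
  rewrite mxE; apply: eq_bigr => l _; rewrite mulrC [X in _ * X]mxE; congr (_ * _).
  by rewrite -{1}oct_gram_tr mxE.
rewrite !mxE.
under eq_bigr => l _ do rewrite mxE.
rewrite !big_ord_recr big_ord0 /= /coords !mxE.
case: i => i /=; do 8?[case: i => [|i]] => //= hi;
case: j {G} => j /=; do 8?[case: j => [|j]] => //= hj; rewrite ?inordK //= /imag /=; ring.
Qed.
End SpinorMatrix.

(** * Imaginary octonions annihilated by a null one *)

Section NullOctonions.
Variable R : comNzRingType.
Implicit Types (z v : nat -> R).

(* Imaginary octonions annihilated by the null imaginary octonion [imag z]; in
   the coordinates [(W, - U)] they are the rows of the matrix A. *)
Definition null_rows z : seq (seq R) :=
  [::
      [:: - (z 0%N * z 1%N); - (z 1%N ^+ 2); - (z 1%N * z 3%N) - z 0%N * z 6%N;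
          z 0%N * z 4%N - z 1%N * z 5%N; z 0%N ^+ 2; 0; 0; z 0%N * z 1%N];
      [:: - (z 0%N * z 3%N); - (z 1%N * z 3%N) + z 0%N * z 6%N; - (z 3%N ^+ 2);
          - (z 0%N * z 2%N) - z 3%N * z 5%N; 0; z 0%N ^+ 2; 0; z 0%N * z 3%N];
      [:: - (z 0%N * z 5%N); - (z 0%N * z 4%N) - z 1%N * z 5%N;
          z 0%N * z 2%N - z 3%N * z 5%N; - (z 5%N ^+ 2); 0; 0; z 0%N ^+ 2; z 0%N * z 5%N];
      [:: - (z 2%N * z 3%N); z 0%N * z 3%N + z 2%N * z 6%N; 0; - (z 2%N ^+ 2); 0;
          z 0%N * z 2%N - z 3%N * z 5%N; z 3%N ^+ 2; z 2%N * z 3%N];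
      [:: - (z 4%N * z 5%N); - (z 4%N ^+ 2); z 2%N * z 4%N + z 0%N * z 5%N; 0; z 5%N ^+ 2; 0;
          z 0%N * z 4%N - z 1%N * z 5%N; z 4%N * z 5%N];
      [:: - (z 3%N * z 6%N); z 6%N ^+ 2; 0; z 0%N * z 3%N - z 2%N * z 6%N; - (z 3%N ^+ 2);
          z 1%N * z 3%N + z 0%N * z 6%N; 0; z 3%N * z 6%N];
      [:: z 2%N * z 5%N; z 2%N * z 4%N - z 0%N * z 5%N; - (z 2%N ^+ 2); 0; 0; z 5%N ^+ 2;
          - (z 0%N * z 2%N) - z 3%N * z 5%N; - (z 2%N * z 5%N)];
      [:: z 1%N * z 6%N; 0; z 6%N ^+ 2; - (z 0%N * z 1%N) - z 4%N * z 6%N;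
          z 1%N * z 3%N - z 0%N * z 6%N; - (z 1%N ^+ 2); 0; - (z 1%N * z 6%N)];
      [:: - (z 1%N * z 4%N); 0; z 0%N * z 1%N - z 4%N * z 6%N; z 4%N ^+ 2;
          z 0%N * z 4%N + z 1%N * z 5%N; 0; - (z 1%N ^+ 2); z 1%N * z 4%N];
      [:: - (z 0%N * z 2%N); z 0%N ^+ 2; 0; 0; - (z 2%N ^+ 2);
          - (z 2%N * z 4%N) - z 0%N * z 5%N; z 0%N * z 3%N - z 2%N * z 6%N; z 0%N * z 2%N];
      [:: z 0%N * z 4%N; 0; - (z 0%N ^+ 2); 0; z 2%N * z 4%N - z 0%N * z 5%N; z 4%N ^+ 2;
          z 0%N * z 1%N + z 4%N * z 6%N; - (z 0%N * z 4%N)];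
      [:: - (z 0%N * z 6%N); 0; 0; z 0%N ^+ 2; - (z 0%N * z 3%N) - z 2%N * z 6%N;
          z 0%N * z 1%N - z 4%N * z 6%N; - (z 6%N ^+ 2); z 0%N * z 6%N]].

Lemma null_rows_mul z (r i : nat) :
  z 0%N ^+ 2 + z 1%N * z 2%N + z 3%N * z 4%N + z 5%N * z 6%N = 0 -> (r < 12)%N -> (i < 8)%N ->
  nth 0 (oct_mul (imag z) (nth 0 (nth [::] (null_rows z) r))) i = 0.
Proof.
move=> qz; have Hq : z 0%N ^+ 2 = - (z 1%N * z 2%N + z 3%N * z 4%N + z 5%N * z 6%N).
  by apply/eqP; rewrite -addr_eq0 -qz !addrA.
rewrite /imag; do 12?[case: r => [|r]] => //= _; do 8?[case: i => [|i]] => //= _; ring: Hq.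
Qed.

(* For each [i], three entries [(r, c, s)] of the matrix A, in distinct rows and
   columns, which equal [(-1)^s z_i^2] and are such that all the other entries in
   the same rows and columns [c] vanish. *)
Definition minor (i : nat) : seq (nat * nat * bool) := nth [::]
  [:: [:: (0, 0, false); (1, 1, false); (2, 2, false)];
      [:: (0, 3, false); (7, 1, true); (8, 2, true)];
      [:: (3, 5, false); (6, 4, false); (9, 0, true)];
      [:: (1, 4, false); (3, 2, false); (5, 0, true)];
      [:: (4, 3, false); (8, 5, true); (10, 1, false)];
      [:: (2, 5, false); (4, 0, false); (6, 1, false)];
      [:: (5, 3, true); (7, 4, true); (11, 2, true)]]%N i.

(* [(s, a, b)] stands for [(-1)^s z_a] times the [b]-th coordinate of [imag z * v]. *)
Definition syzygy (i l : nat) : seq (bool * nat * nat) := nth [::] (nth [::]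
  [:: [:: [::(false, 0, 0)]; [::(false, 1, 0); (false, 0, 1)];
          [::(false, 3, 0); (false, 0, 2)]; [::(false, 5, 0); (false, 0, 3)]; [::];
          [::]; [::]; [::(true, 0, 0)]];
      [:: [::(true, 1, 1)]; [::]; [::(true, 6, 1); (true, 1, 6)];
          [::(false, 4, 1); (false, 1, 5)]; [::(false, 1, 0); (false, 0, 1)]; [::];
          [::]; [::(false, 1, 1)]];
      [:: [::(false, 2, 4)]; [::(true, 0, 4); (false, 2, 7)]; [::]; [::]; [::];
          [::(false, 2, 3); (false, 5, 4)]; [::(true, 2, 2); (true, 3, 4)];
          [::(true, 2, 4)]];
      [:: [::(true, 3, 2)]; [::(false, 6, 2); (false, 3, 6)]; [::];
          [::(true, 2, 2); (true, 3, 4)]; [::]; [::(false, 3, 0); (false, 0, 2)];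
          [::]; [::(false, 3, 2)]];
      [:: [::(false, 4, 5)]; [::]; [::(true, 0, 5); (false, 4, 7)]; [::];
          [::(true, 4, 3); (true, 5, 5)]; [::]; [::(false, 4, 1); (false, 1, 5)];
          [::(true, 4, 5)]];
      [:: [::(true, 5, 3)]; [::(true, 4, 3); (true, 5, 5)];
          [::(false, 2, 3); (false, 5, 4)]; [::]; [::]; [::];
          [::(false, 5, 0); (false, 0, 3)]; [::(false, 5, 3)]];
      [:: [::(false, 6, 6)]; [::]; [::]; [::(true, 0, 6); (false, 6, 7)];
          [::(false, 6, 2); (false, 3, 6)]; [::(true, 6, 1); (true, 1, 6)]; [::];
          [::(true, 6, 6)]]]%N i) l.

Definition proj_coords v : seq R := [:: v 4%N; v 5%N; v 6%N; - v 1%N; - v 2%N; - v 3%N].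

Lemma minor_syzygy z v (i l : nat) : v 0%N + v 7%N = 0 -> (i < 7)%N -> (l < 8)%N ->
  z i ^+ 2 * v l = \sum_(t <- minor i)
      (-1) ^+ t.2 * nth 0 (proj_coords v) t.1.2 * nth 0 (nth [::] (null_rows z) t.1.1) l +
    \sum_(t <- syzygy i l) (-1) ^+ t.1.1 * z t.1.2 * nth 0 (oct_mul (imag z) v) t.2.
Proof.
move=> v07; have Hv : v 7%N = - v 0%N by apply/eqP; rewrite -addr_eq0 addrC v07.
rewrite /imag; do 7?[case: i => [|i]] => //= _; do 8?[case: l => [|l]] => //= _;
rewrite unlock /= ?Hv; ring.
Qed.
End NullOctonions.

(** * The kernel of the trace and the matrix A *)

Section Tango.
Variable k : closedFieldType.
Local Notation vec := ('I_7 -> k).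
Local Notation poly7 := {mpoly k[7]}.
Local Notation A := (tango_matrix k).
Implicit Types (x : vec).

(* The imaginary octonions annihilated by [x]: the sum of the coordinates 0 and 7 is
   the trace. *)
Program Definition null_fibres : fibres k 8 := @Fibres k 8
  (fun x v => evmx (spin_mx k) x *m v = 0 /\ coords v 0 + coords v 7 = 0) _ _.
Next Obligation. by move=> x /=; rewrite mulmx0 /coords !mxE addr0. Qed.
Next Obligation.
move=> x a v w /= [Mv tv] [Mw tw]; rewrite mulmxDr -scalemxAr Mv Mw scaler0 addr0.
split=> //; rewrite /coords !mxE -!/(coords _ _) addrACA -mulrDr.
by rewrite tv tw mulr0 addr0.
Qed.

Definition tango_proj : 'M[k]_(6, 8) := \matrix_(i, j)
  if (i < 3)%N then (j == (i + 4)%N :> nat)%:R else - (j == (i - 2)%N :> nat)%:R.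

Lemma tango_projE (v : 'cV[k]_8) i : (tango_proj *m v) i 0 = nth 0 (proj_coords (coords v)) i.
Proof.
rewrite mxE; under eq_bigr => j _ do rewrite mxE coordsE.
rewrite !big_ord_recr big_ord0 /=.
by case: i => i /=; do 6?[case: i => [|i]] => //= _; ring.
Qed.

Definition null_mx : 'M[poly7]_(8, 12) := \matrix_(l, r) nth 0 (nth [::] (null_rows (zvar k)) r) l.

Lemma null_mx_homog : homog_mx 2 null_mx.
Proof.
move=> l r; rewrite mxE.
have h1 a : zvar k a ^+ 2 \is 2.-homog.
  by rewrite expr2; apply: (@dhomogM _ _ _ 1 _ 1); exact: zvar_homog.
have h2 a b : zvar k a * zvar k b \is 2.-homog.
  by apply: (@dhomogM _ _ _ 1 _ 1); exact: zvar_homog.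
case: r => r /=; do 12?[case: r => [|r]] => //= _;
by case: l => l /=; do 8?[case: l => [|l]] => //= _; rewrite ?(dhomog0, rpredD, rpredB, rpredN, h1, h2).
Qed.

Lemma null_ev x l r : evmx null_mx x l r = nth 0 (nth [::] (null_rows (zc x)) r) l.
Proof.
rewrite !mxE; case: r => r /=; do 12?[case: r => [|r]] => //= _;
case: l => l /=; do 8?[case: l => [|l]] => //= _;
by rewrite ?(mevalD, mevalB, mevalN, mevalM, rmorphXn, mevalXU, meval0).
Qed.

Lemma coords_null_ev x (r : 'I_12) j : (j < 8)%N ->
  coords (col r (evmx null_mx x)) j = nth 0 (nth [::] (null_rows (zc x)) r) j.
Proof. by move=> hj; rewrite /coords mxE null_ev inordK. Qed.

Lemma eq_oct_mul (R : comNzRingType) (y v w : nat -> R) :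
  (forall j, (j < 8)%N -> v j = w j) -> oct_mul y v = oct_mul y w.
Proof. by move=> e; rewrite /oct_mul !e. Qed.

Lemma null_mx_null x (r : 'I_12) : on_cone x -> null_fibres x (col r (evmx null_mx x)).
Proof.
move=> [_]; rewrite quadricE -!/(zc x _) => qx; split.
  rewrite spin_ev; apply/colP => i; rewrite oct_mxE mxE.
  rewrite (@eq_oct_mul _ _ _ (nth 0 (nth [::] (null_rows (zc x)) r))); last first.
    by move=> j hj; rewrite coords_null_ev.
  exact: null_rows_mul.
rewrite !coords_null_ev //.
by case: r => r /=; do 12?[case: r => [|r]] => //= _; rewrite ?subrr ?addNr.
Qed.

(** The signed partial permutation matrix at the pivots of [minor i]: the block of A there is a
    permuted diagonal matrix with entries [z_i^2] up to sign, so this is its inverse times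
    [z_i^2]. *)
Definition tango_inv (i : 'I_7) : 'M[k]_(6, 12) :=
  \sum_(t <- minor i) (-1) ^+ t.2 *: delta_mx (inord t.1.2) (inord t.1.1).

Lemma minor_bound (i : 'I_7) t : t \in minor i -> (t.1.1 < 12)%N && (t.1.2 < 6)%N.
Proof.
have /allP H : all (fun t => (t.1.1 < 12)%N && (t.1.2 < 6)%N) (minor i); last exact: H.
by case: i => i /=; do 7?[case: i => [|i]].
Qed.

Lemma null_split x i v : null_fibres x v ->
  x i ^+ 2 *: v = evmx null_mx x *m ((tango_inv i)^T *m (tango_proj *m v)).
Proof.
move=> [Mv tv]; apply/colP => l; rewrite mxE coordsE zcE.
rewrite (minor_syzygy (zc x) tv (ltn_ord i) (ltn_ord l)).
rewrite [X in _ + X]big1 ?addr0 => [|t _]; last first.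
  rewrite (_ : nth 0 _ _ = 0) ?mulr0 //.
  have [lt|ge] := ltnP t.2 8; last by rewrite nth_default.
  have /colP/(_ (Ordinal lt)) := Mv; rewrite spin_ev oct_mxE mxE; exact.
rewrite /tango_inv linear_sum /= mulmx_suml mulmx_sumr summxE.
apply: eq_big_seq => t /minor_bound/andP[ht1 ht2].
rewrite linearZ /= trmx_delta -scalemxAl -scalemxAr mxE -mulrA; congr (_ * _).
rewrite mxE (bigD1 (inord t.1.1)) //= big1 ?addr0 => [|r ne]; last first.
  by rewrite [X in _ * X]mxE big1 ?mulr0 // => c _; rewrite mxE (negPf ne) mul0r.
rewrite null_ev inordK // mulrC; congr (_ * _).
rewrite [RHS]mxE (bigD1 (inord t.1.2)) //= big1 ?addr0 => [|c ne]; last first.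
  by rewrite mxE (negPf ne) andbF mul0r.
by rewrite mxE !eqxx mul1r tango_projE inordK.
Qed.

Lemma tango_proj_null x : tango_proj *m evmx null_mx x = (evmx A x)^T.
Proof.
apply/matrixP => c r; rewrite [LHS](_ : _ = (tango_proj *m col r (evmx null_mx x)) c 0); last first.
  by rewrite !mxE; apply: eq_bigr => j _; rewrite [X in _ = _ * X]mxE.
rewrite tango_projE /proj_coords !coords_null_ev // !mxE.
case: r => r /=; do 12?[case: r => [|r]] => //= _;
case: c => c /=; do 6?[case: c => [|c]] => //= _;
by rewrite ?(mevalD, mevalB, mevalN, mevalM, rmorphXn, mevalXU, meval0) /= ?(opprB, opprD, opprK, oppr0) -!/(zc _ _); ring.
Qed.

Lemma null_inv x i : on_cone x ->
  evmx null_mx x *m (tango_inv i)^T *m (evmx A x)^T = x i ^+ 2 *: evmx null_mx x.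
Proof.
move=> xQ; apply/matrixP => l r.
have /colP/(_ l) := null_split i (null_mx_null r xQ).
rewrite mxE [X in _ * X]mxE => e; rewrite [RHS]mxE e -tango_proj_null !mulmxA.
by rewrite colE !mulmxA -colE [RHS]mxE.
Qed.

Lemma tango_splits : splits 2 A tango_inv.
Proof.
move=> x i xQ; apply: trmx_inj; rewrite !trmx_mul linearZ /= mulmxA.
have := congr1 (mulmx tango_proj) (null_inv i xQ).
by rewrite !mulmxA -scalemxAr tango_proj_null.
Qed.

Lemma null_im x v : on_cone x -> null_fibres x v <-> im_fibres null_mx x v.
Proof.
move=> xQ; split=> [Nv|[u ->]].
  have [[i xi] _] := xQ.
  exists ((x i ^+ 2)^-1 *: ((tango_inv i)^T *m (tango_proj *m v))).
  by rewrite -scalemxAr -null_split // scalerA mulVf ?scale1r // expf_neq0.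
rewrite (_ : evmx _ _ *m u = \sum_r u r 0 *: col r (evmx null_mx x)).
  elim/big_rec: _ => [|r w _ Nw]; first exact: fib0.
  by apply: fib_linear => //; exact: null_mx_null.
apply/colP => l; rewrite mxE summxE; apply: eq_bigr => r _.
by rewrite !mxE mulrC.
Qed.

(** [null_split] recovers a null octonion from its six projected coordinates, and the projection
    turns [null_mx] into the transpose of A. *)
Lemma null_PS d : oiso (PS d null_fibres) (PS d (im_fibres A^T)).
Proof.
apply: (@oiso_constant_mx _ _ _ _ _ _ tango_proj 2
  (fun i => null_mx *m map_mx (@mpolyC 7 k) (tango_inv i)^T)) => [i l r|x v xQ|x v xQ Nv Tv|x w i xQ].
- rewrite mxE rpred_sum // => j _; rewrite [X in _ * X]mxE mulrC mul_mpolyC.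
  by apply: dhomogZ; exact: null_mx_homog.
- by move=> /null_im -/(_ xQ)[u ->]; exists u; rewrite mulmxA tango_proj_null evmx_tr.
- have [[i xi] _] := xQ; have := null_split i Nv; rewrite Tv !mulmx0 => /eqP.
  by rewrite scaler_eq0 expf_eq0 (negPf xi) andbF /= => /eqP.
have -> : evmx (null_mx *m map_mx (@mpolyC 7 k) (tango_inv i)^T) x = evmx null_mx x *m (tango_inv i)^T.
  rewrite /evmx map_mxM -map_mx_comp; congr (_ *m _).
  by apply/matrixP => r c; rewrite !mxE /= mevalC.
move=> [u ->]; rewrite evmx_tr mulmxA null_inv // -scalemxAl; split.
  rewrite -[_ *: _]addr0; apply: fib_linear; last exact: fib0.
  by apply/null_im => //; exists u.
by rewrite -scalemxAr mulmxA tango_proj_null.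
Qed.

End Tango.

(** * Cohomology of the kernel of [M] *)

Section SpinorCohomology.
Variable k : closedFieldType.
Local Notation vec := ('I_7 -> k).
Local Notation poly7 := {mpoly k[7]}.
Implicit Types (U V W : zopen k).

Lemma coboundary_omor (A B : omodule k) (f : omor A B) p (c : cochain A p) t :
  coboundary (fun t => f _ (c t)) t = f _ (coboundary c t).
Proof.
by rewrite /coboundary omor_sum; apply: eq_bigr => j _; rewrite omorZ omor_res.
Qed.

Lemma coboundaryB (A : omodule k) p (c d : cochain A p) t :
  coboundary (fun t => c t - d t) t = coboundary c t - coboundary d t.
Proof.
by rewrite /coboundary -sumrB; apply: eq_bigr => j _; rewrite resD resN scalerBr.
Qed.

Lemma PS_coboundaryE n d (L : fibres k n) p (c : cochain (PS d L) p) t (x : pts (zcoord k t)) :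
  pval (coboundary c t) x = \sum_(j < p.+2) (-1) ^+ j *: pval (c (t \o lift j)) (pt_in (zface j) x).
Proof.
rewrite /coboundary pval_sum; apply: eq_bigr => j _; rewrite pvalZ pval_res regfun_signE.
by congr (_ *: _); exact: pval_pt.
Qed.

Lemma coboundary_coboundary n d (L : fibres k n) p (c : cochain (PS d L) p) t :
  coboundary (coboundary c) t = 0.
Proof.
apply: pval_inj => x; rewrite pval0 PS_coboundaryE.
(* At a fixed point the values form a cochain in a fixed vector space, extended by 0 to the tuples
   whose open set misses the point; [cob_cob] applies to it. *)
pose F (s : 'I_p.+1 -> 'I_7) : 'cV[k]_n :=
  if pselect (zcoord k s (sval x)) is left h then pval (c s) (exist _ (sval x) h) else 0.
apply: etrans (cob_cob F t); rewrite {1}/cob; apply: eq_bigr => j _; congr (_ *: _).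
rewrite PS_coboundaryE; apply: eq_bigr => i _; congr (_ *: _).
rewrite /F; case: pselect => [h|[]]; first exact: pval_pt.
exact: (svalP (pt_in (zface i) (pt_in (zface j) x))).
Qed.

Definition all_fibres n : fibres k n :=
  @Fibres k n (fun _ _ => True) (fun=> I) (fun _ _ _ _ _ _ => I).

Lemma all_cohomology n d i : (0 < i < 5)%N -> cohomology_vanishes (PS d (all_fibres n)) i.
Proof.
case: i => // p hp c dc.
pose cj j : cochain (OQ k d) p.+1 := fun t => ssval (c t) j.
have dcj j t : coboundary (cj j) t = 0.
  apply: hfun_inj => x; rewrite OQ_coboundaryE.
  have /colP/(_ j) := congr1 (fun s => pval s x) (dc t).
  rewrite PS_coboundaryE pval0 summxE mxE => e; apply: etrans e; apply: eq_bigr => l _.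
  by rewrite !mxE.
have b_ex j := OQ_cohomology hp (dcj j).
pose b j := sval (cid (b_ex j)).
have bE j : forall t, cj j t = coboundary (b j) t := svalP (cid (b_ex j)).
have rb s : regular_vec d (fun x => \col_j b j s x).
  move=> j; rewrite (_ : (fun _ => _) = b j s); first exact: hfunP.
  by apply/funext => x; rewrite mxE.
exists (fun s => mkPS (L := all_fibres n) (rb s) (fun=> I)) => t; apply: pval_inj => x.
rewrite PS_coboundaryE; apply/colP => j; rewrite mxE [LHS](_ : _ = cj j t x) // bE.
rewrite OQ_coboundaryE summxE; apply: eq_bigr => l _.
by rewrite mxE pval_mkPS mxE.
Qed.

Local Notation M := (spin_mx k).
Local Notation K d := (PS d (ker_fibres M)).
Local Notation O8 d := (PS d (all_fibres 8)).

Lemma ker_incl_linear : forall (x : vec) a (v w : 'cV[k]_8), (fun _ : vec => id) x (a *: v + w) =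
  a *: (fun _ : vec => id) x v + (fun _ : vec => id) x w.
Proof. by []. Qed.

Definition ker_incl d : omor (K d) (O8 d) :=
  @fibre_map k 8 8 d d (ker_fibres M) (all_fibres 8) (fun _ => id) ker_incl_linear
    (fun U s => pval_regular s) (fun _ _ _ _ => I).

Lemma pval_ker_incl d U (s : K d U) x : pval (ker_incl d U s) x = pval s x.
Proof. exact: pval_fibre_map. Qed.

Lemma ker_incl_inj d U : injective (ker_incl d U).
Proof. by move=> s t e; apply: pval_inj => x; rewrite -!pval_ker_incl e. Qed.

Definition spin_mul d e (de : 1%:Z + d = e) : omor (O8 d) (K e) :=
  @fibre_map k 8 8 d e (all_fibres 8) (ker_fibres M) (fun x v => evmx M x *m v)
    (fun x a v w => etrans (mulmxDr _ _ _) (congr1 (fun u => u + _) (esym (scalemxAr _ _ _))))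
    (fun U s => regular_vec_mx (spin_homog k) de (pval_regular s))
    (fun x v xQ _ => etrans (mulmxA _ _ _) (etrans (congr1 (mulmx^~ v) (spin_sqr xQ)) (mul0mx _ _))).

Lemma pval_spin_mul d e (de : 1%:Z + d = e) U (s : O8 d U) x :
  pval (spin_mul de U s) x = evmx M (sval x) *m pval s x.
Proof. exact: pval_fibre_map. Qed.

Lemma spin_mul_ker d e (de : 1%:Z + d = e) U (s : O8 d U) :
  spin_mul de U s = 0 -> exists s', ker_incl d U s' = s.
Proof.
move=> s0; have Ms x : ker_fibres M (sval x) (pval s x).
  by rewrite /= -(pval_spin_mul de) s0 pval0.
exists (mkPS (pval_regular s) Ms); apply: pval_inj => x.
by rewrite pval_ker_incl pval_mkPS.
Qed.

Lemma spin_mul_surj d e (de : 1%:Z + d = e) U i (s : K e U) : zsub U (chart k i) ->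
  exists s', spin_mul de U s' = s.
Proof.
move=> Ui.
have rs : regular_vec d (fun x => sval x i ^ (- 1) *: (spin_inv k i *m pval s x)).
  apply: (regular_vec_pow (d := e)) => //; first by rewrite -de addKr.
  exact: regular_vec_cmx (pval_regular s).
exists (mkPS (L := all_fibres 8) rs (fun=> I)); apply: pval_inj => x.
have xi := chart_neq0 (Ui _ (svalP x)).
rewrite pval_spin_mul pval_mkPS -scalemxAr -spin_ker; last exact: (pval_fib s x).
by rewrite scalerA exprN1 mulVf ?scale1r.
Qed.

Lemma spin_mx_sqr : M *m M = (quadric k)%:M.
Proof. exact: oct_mx_sqr. Qed.

(* A vector [P] of forms representing [s] satisfies [M P = q g] for some [g], whence
   [P = M g] because [M^2 = q]. *)
Lemma spin_global d (s : K d (zfull k)) :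
  exists2 g : 'cV[poly7]_8, (if d is Posz n.+1 then homog_mx n g else g = 0) &
    forall x, pval s x = evmx M (sval x) *m evmx g (sval x).
Proof.
have gl j := global_regular (ssval s j).
pose P j := s2val (cid2 (gl j)).
have hP j : if d is Posz n then is_true (P j \is n.-homog) else P j = 0 := s2valP (cid2 (gl j)).
have PE j : forall x, ssval s j x = (P j).@[sval x] := s2valP' (cid2 (gl j)).
pose Pv : 'cV[poly7]_8 := \col_j P j.
have PvE x : pval s x = evmx Pv (sval x) by apply/colP => j; rewrite !mxE PE.
have MP i : exists g, (M *m Pv) i 0 = g * quadric k.
  apply: (@quadric_dvd k _ 0%MM) => x xQ _.
  pose y : pts (zfull k) := exist _ x xQ.
  have /colP/(_ i) : evmx M x *m evmx Pv x = 0 by rewrite -(PvE y); exact: (pval_fib s y).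
  by rewrite [RHS]mxE => <-; rewrite /evmx -map_mxM [RHS]mxE.
have /choice[g gE] := MP; pose gv : 'cV[poly7]_8 := \col_j g j.
have Pg : Pv = M *m gv.
  have : M *m (M *m Pv) = quadric k *: (M *m gv).
    rewrite scalemxAr; congr (_ *m _); apply/colP => i.
    by rewrite gE !mxE mulrC.
  rewrite mulmxA spin_mx_sqr mul_scalar_mx => e; apply/colP => i.
  by have /colP/(_ i) := e; rewrite !mxE => /(mulfI (quadric_neq0 k)).
(* The entries of [M] are linear, so only the component of degree [n - 1] of [g] matters. For
   [n = 0] there is none and [P] vanishes, whence [h^0(S) = 0]. *)
have hom n : (forall j, P j \is n.-homog) -> forall i,
    P i = \sum_j M i j * (if (1 <= n)%N then pihomog mdeg (n - 1) (g j) else 0).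
  move=> hn i; rewrite -[LHS](pihomog_dE (mf := mdeg) (hn i)).
  have /colP/(_ i) := Pg; rewrite [Pv _ _]mxE [(_ *m _) _ _]mxE => ->.
  rewrite raddf_sum /=; apply: eq_bigr => j _; rewrite [gv _ _]mxE mulrC.
  by rewrite (pihomogM _ _ (spin_homog k i j)); case: ifP => _; rewrite ?mulr0 // mulrC.
have ev (h : 'cV[poly7]_8) : Pv = M *m h -> forall x, pval s x = evmx M (sval x) *m evmx h (sval x).
  by move=> e x; rewrite PvE e /evmx map_mxM.
case: d s gl @P hP PE @Pv PvE MP @gv Pg hom ev gE => [[|n]|n] s gl P hP PE Pv PvE MP gv Pg hom ev gE.
- exists 0 => //; apply: ev; apply/colP => i; rewrite mulmx0 !mxE (hom 0%N) // big1 // => j _.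
  by rewrite mulr0.
- exists (\col_j pihomog mdeg n (g j)).
    by move=> i j; rewrite mxE; exact: pihomogP.
  apply: ev; apply/colP => i; rewrite [Pv _ _]mxE [RHS]mxE (hom n.+1) //; apply: eq_bigr => j _.
  by rewrite [X in _ = _ * X]mxE subn1.
- by exists 0 => //; apply: ev; apply/colP => i; rewrite mulmx0 !mxE hP.
Qed.

(** Surjectivity on global sections of [O(d)^8 -> S(d + 1)]: this starts the dimension shifting, in
    degree 1. *)
Lemma spin_global_mul d e (de : 1%:Z + d = e) (s : K e (zfull k)) :
  exists s', spin_mul de _ s' = s.
Proof.
have [g hg sE] := spin_global s.
have rg : regular_vec d (fun x : pts (zfull k) => evmx g (sval x)).
  move=> j; case: e de s sE hg => [[|n]|n] de s sE hg; last 1 first.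
  - rewrite (_ : (fun _ => _) = fun=> 0); first exact: regular0.
    by apply/funext => x; rewrite hg !mxE meval0.
  - rewrite (_ : (fun _ => _) = fun=> 0); first exact: regular0.
    by apply/funext => x; rewrite hg !mxE meval0.
  have -> : d = n by lia.
  rewrite (_ : (fun _ => _) = fun x => (g j 0).@[sval x]); first exact: regular_poly.
  by apply/funext => x; rewrite !mxE.
exists (mkPS (L := all_fibres 8) rg (fun=> I)); apply: pval_inj => x.
by rewrite pval_spin_mul pval_mkPS sE.
Qed.

Lemma zcoord_chart p (t : 'I_p.+1 -> 'I_7) : zsub (zcoord k t) (chart k (t ord0)).
Proof. by move=> x [xQ xt]; split. Qed.

(* Dimension shifting along 0 -> S(d) -> O(d)^8 -> S(d + 1) -> 0. *)
Lemma spin_cohomology d i : (0 < i < 5)%N -> cohomology_vanishes (K d) i.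
Proof.
case: i => // p; elim: p d => [|p IH] d hp c dc.
  have [t|b bE] := all_cohomology hp (c := fun t => ker_incl d _ (c t)).
    by rewrite coboundary_omor dc omor0.
  pose e := 1%:Z + d; have de : 1%:Z + d = e by [].
  pose w : cochain (K e) 0 := fun s => spin_mul de _ (b s).
  have dw t : coboundary w t = 0.
    rewrite coboundary_omor -bE; apply: pval_inj => x.
    by rewrite pval_spin_mul pval_ker_incl pval0; exact: (pval_fib (c t) x).
  pose V i := zcoord k (fun _ : 'I_1 => i).
  have cov : covers V (zfull k).
    split=> [i|x xQ]; first exact: zsub_full.
    by have [[i xi] _] := xQ; exists i.
  (* In degree 1 the connecting map produces a 0-cocycle [w], that is a global section of
     [S(d + 1)]. Its lift [u] to [O(d)^8] is subtracted from [b]. *)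
  have [i j W Wi Wj|s sE] := sec_glue cov (f := fun i => w (fun=> i)).
    apply: pval_inj => x; rewrite !pval_res.
    pose t (l : 'I_2) := if l == ord0 then j else i.
    have xt : zcoord k t (sval x).
      split=> [|l]; first exact: zopen_cone (svalP x).
      rewrite /t; case: ifP => _; [case: (Wj _ (svalP x))|case: (Wi _ (svalP x))] => _ h; exact: (h ord0).
    pose y : pts (zcoord k t) := exist _ (sval x) xt.
    have := congr1 (fun s : K e (zcoord k t) => pval s y) (dw t).
    rewrite PS_coboundaryE !big_ord_recl big_ord0 addr0 expr0 expr1 scale1r scaleN1r pval0.
    have t0 : t \o lift ord0 = fun=> i by apply/funext.
    have t1 : t \o lift (lift ord0 ord0) = fun=> j.
      by apply/funext => l; rewrite (ord1 l) /t /=.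
    move/eqP; rewrite subr_eq0 => /eqP.
    move: (zface _) (zface _); rewrite t0 t1 => z0 z1 e1.
    by apply: etrans (etrans e1 _); exact: pval_pt.
  have [u uE] := spin_global_mul de s.
  pose b' : cochain (O8 d) 0 := fun t => b t - res (O8 d) (@zsub_full k _) u.
  have b'ker t : spin_mul de _ (b' t) = 0.
    have tE : t = fun=> t ord0 by apply/funext => l; rewrite ord1.
    rewrite /b' omorD omorN omor_res uE -[spin_mul de _ (b t)]/(w t).
    rewrite tE -(sE (t ord0) (@zsub_full k _)) subrr //.
  pose a t := sval (cid (spin_mul_ker (b'ker t))).
  have aE t : ker_incl d _ (a t) = b' t := svalP (cid (spin_mul_ker (b'ker t))).
  exists a => t; apply: ker_incl_inj; rewrite -coboundary_omor bE.
  rewrite (_ : (fun t => ker_incl d _ (a t)) = b'); last by apply: functional_extensionality_dep.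
  rewrite coboundaryB [X in _ - X](_ : _ = 0) ?subr0 //.
  apply: pval_inj => x; rewrite PS_coboundaryE !big_ord_recl big_ord0 addr0 expr0 expr1 scale1r scaleN1r pval0.
  by rewrite !pval_res; apply/eqP; rewrite subr_eq0; apply/eqP; exact: pval_pt.
have [t|b bE] := all_cohomology hp (c := fun t => ker_incl d _ (c t)).
  by rewrite coboundary_omor dc omor0.
pose e := 1%:Z + d; have de : 1%:Z + d = e by [].
pose w : cochain (K e) p.+1 := fun s => spin_mul de _ (b s).
have dw t : coboundary w t = 0.
  rewrite coboundary_omor -bE; apply: pval_inj => x.
  by rewrite pval_spin_mul pval_ker_incl pval0; exact: (pval_fib (c t) x).
(* By induction [w] is a coboundary. Its primitive lifts to [O(d)^8] because each [zcoord s] lies in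
   one chart, and the coboundary of the lift corrects [b] into a cochain of the kernel. *)
have [v vE] := IH e (ltnW hp) w dw.
pose y s := sval (cid (spin_mul_surj de (v s) (@zcoord_chart _ s))).
have yE s : spin_mul de _ (y s) = v s := svalP (cid (spin_mul_surj de (v s) (@zcoord_chart _ s))).
pose b' : cochain (O8 d) p.+1 := fun t => b t - coboundary y t.
have b'ker t : spin_mul de _ (b' t) = 0.
  rewrite /b' omorD omorN -coboundary_omor -[spin_mul de _ (b t)]/(w t) vE.
  by rewrite (_ : (fun t => spin_mul de _ (y t)) = v) ?subrr //; apply: functional_extensionality_dep.
pose a t := sval (cid (spin_mul_ker (b'ker t))).
have aE t : ker_incl d _ (a t) = b' t := svalP (cid (spin_mul_ker (b'ker t))).
exists a => t; apply: ker_incl_inj; rewrite -coboundary_omor bE.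
rewrite (_ : (fun t => ker_incl d _ (a t)) = b'); last by apply: functional_extensionality_dep.
by rewrite coboundaryB coboundary_coboundary subr0.
Qed.
End SpinorCohomology.

(** * Global sections, duality and local freeness of S *)

Section SpinorBundle.
Variable k : closedFieldType.
Local Notation vec := ('I_7 -> k).
Local Notation poly7 := {mpoly k[7]}.
Local Notation M := (spin_mx k).
Local Notation K d := (PS d (ker_fibres M)).
Implicit Types (U V W : zopen k).

Lemma spin_h0 : h0_eq (K 0) 0.
Proof.
exists (fun i : 'I_0 => 0) => s; exists [ffun _ => 0]; split=> [|c _]; last by apply/ffunP => -[].
rewrite big_ord0; have [g hg sE] := spin_global s.
by apply: pval_inj => x; rewrite sE hg pval0 /evmx raddf0 mulmx0.
Qed.

Lemma basis_on_cone (f : nat -> k) : (exists2 i, (i < 7)%N & f i != 0) ->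
  f 0%N ^+ 2 + f 1%N * f 2%N + f 3%N * f 4%N + f 5%N * f 6%N = 0 ->
  on_cone (fun i : 'I_7 => f i).
Proof.
move=> [i i7 fi] qf; split; first by exists (Ordinal i7).
by rewrite quadricE !inordK.
Qed.

Lemma spin_ev_nat (f : nat -> k) : evmx M (fun i : 'I_7 => f i) = oct_mx (imag f).
Proof.
rewrite spin_ev; congr oct_mx; apply/funext => j; rewrite /imag /zc.
by do 8?[case: j => [|j]] => //=; rewrite !inordK.
Qed.

(** The points [e_1] and [e_2] of the quadric suffice: each kills four of the eight coordinates, up
    to sign. *)
Lemma spin_faithful (u : 'cV[k]_8) : (forall x, on_cone x -> evmx M x *m u = 0) -> u = 0.
Proof.
move=> H.
have h f : (exists2 i, (i < 7)%N & f i != 0) ->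
    f 0%N ^+ 2 + f 1%N * f 2%N + f 3%N * f 4%N + f 5%N * f 6%N = 0 ->
    forall i, (i < 8)%N -> nth 0 (oct_mul (imag f) (coords u)) i = 0.
  move=> f0 qf i hi; have := H _ (basis_on_cone f0 qf); rewrite spin_ev_nat => /colP/(_ (Ordinal hi)).
  by rewrite oct_mxE mxE.
pose f1 (i : nat) : k := (i == 1%N)%:R; pose f2 (i : nat) : k := (i == 2%N)%:R.
have h1 : forall i, (i < 8)%N -> nth 0 (oct_mul (imag f1) (coords u)) i = 0.
  by apply: h; [exists 1%N; rewrite ?oner_eq0|rewrite /f1 /=; ring].
have h2 : forall i, (i < 8)%N -> nth 0 (oct_mul (imag f2) (coords u)) i = 0.
  by apply: h; [exists 2%N; rewrite ?oner_eq0|rewrite /f2 /=; ring].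
apply/colP => i; rewrite mxE coordsE.
have e1 := h1 0%N isT; have e2 := h1 1%N isT; have e3 := h1 5%N isT; have e4 := h1 6%N isT.
have e5 := h2 7%N isT; have e6 := h2 2%N isT; have e7 := h2 3%N isT; have e8 := h2 4%N isT.
move: e1 e2 e3 e4 e5 e6 e7 e8; rewrite /imag /f1 /f2 /=.
rewrite !(mul0r, mul1r, mulr0, mulr1, add0r, addr0, oppr0, subr0, sub0r, opprK).
move=> e1 e2 e3 e4 e5 e6 e7 e8.
case: i => i /=; do 8?[case: i => [|i]] => //= _; try assumption; apply/eqP; rewrite -oppr_eq0; apply/eqP; assumption.
Qed.

Definition const_sec U (u : 'cV[k]_8) : PS 0 (all_fibres k 8) U :=
  mkPS (L := all_fibres k 8) (regular_vec_cst (U := U) u) (fun=> I).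

Lemma spin_h1 : h0_eq (K 1) 8.
Proof.
pose e j : K 1 (zfull k) := spin_mul k (addr0 1%:Z) _ (const_sec (zfull k) (delta_mx j 0)).
have eE j x : pval (e j) x = evmx M (sval x) *m delta_mx j 0.
  by rewrite pval_spin_mul pval_mkPS.
have sumE (c : {ffun 'I_8 -> k}) x :
    pval (\sum_i hcst (zfull k) (c i) *: e i) x = evmx M (sval x) *m \col_i c i.
  rewrite pval_sum [\col_i _]matrix_sum_delta mulmx_sumr; apply: eq_bigr => i _.
  by rewrite big_ord1 pvalZ eE -scalemxAr mxE.
exists e => s; have [g hg sE] := spin_global s.
have gc j : g j 0 = ((g j 0)@_0%MM)%:MP.
  apply/mpolyP => m; rewrite mcoeffC; have [->|m0] := eqVneq m 0%MM; first by rewrite mulr1.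
  by rewrite mulr0; apply: (dhomog_nemf_coeff (hg j 0)); rewrite /= mdeg_eq0.
exists [ffun j => (g j 0)@_0%MM]; split=> [|c cE].
  apply: pval_inj => x; rewrite sE sumE; congr (_ *m _); apply/colP => j.
  by rewrite !mxE ffunE {1}gc mevalC.
have : \col_j c j - \col_j (g j 0)@_0%MM = 0.
  apply: spin_faithful => x xQ; pose y : pts (zfull k) := exist _ x xQ.
  have := congr1 (fun s => pval s y) cE; rewrite sE sumE /= => e1.
  rewrite mulmxBr -e1 -mulmxBr (_ : evmx g x - _ = 0) ?mulmx0 //.
  by apply/colP => j; rewrite !mxE {1}gc mevalC subrr.
move/eqP; rewrite subr_eq0 => /eqP/colP e1; apply/ffunP => j.
by rewrite ffunE; have := e1 j; rewrite !mxE.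
Qed.

Lemma spin_dual : oiso (odual (K 0)) (twist (K 0) 1).
Proof.
have i1 : oiso (PS 1 (ker_fibres M)) (twist (K 0) 1) by apply: oiso_sym; exact: twist_PS.
have i2 : oiso (odual (K 0)) (odual (PS 0 (im_fibres M))).
  by apply/oiso_dual/oiso_fib => x v xQ; exact: spin_ker_im.
have i3 : oiso (odual (PS 0 (im_fibres M))) (PS 1 (im_fibres M^T)).
  exact: (dual_PS (spin_homog k) (@spin_splits k) (d := -1)).
apply: oiso_trans i2 (oiso_trans i3 (oiso_trans _ i1)); apply: oiso_sym; apply: (@oiso_constant_mx k _ _ 1 _ _ (oct_gram k) 0
  (fun _ => map_mx (@mpolyC 7 k) (oct_gram k))).
- by move=> _ i j; rewrite mxE -[_ %:MP]mulr1 mul_mpolyC; apply: dhomogZ; exact: dhomog1.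
- move=> x v xQ /(spin_ker_im _ xQ)[u ->]; exists (- (oct_gram k *m u)).
  by rewrite evmx_tr mulmxN !mulmxA spin_tr mulNmx opprK.
- move=> x v _ _ /(congr1 (mulmx (oct_gram k))).
  by rewrite mulmxA oct_gram_sqr mul1mx mulmx0.
move=> x w i xQ [u ->]; have -> : evmx (map_mx (@mpolyC 7 k) (oct_gram k)) x = oct_gram k.
  by apply/matrixP => a b; rewrite !mxE /= mevalC.
split=> /=; last by rewrite mulmxA oct_gram_sqr mul1mx expr0 scale1r.
have Gt : oct_gram k *m (evmx M x)^T = - (evmx M x *m oct_gram k).
  have := congr1 (fun A => oct_gram k *m A *m oct_gram k) (spin_tr x).
  by rewrite mulmxN mulNmx !mulmxA oct_gram_sqr mul1mx -[LHS]mulmxA oct_gram_sqr mulmx1.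
by rewrite evmx_tr [oct_gram k *m _]mulmxA Gt mulNmx mulmxN !mulmxA spin_sqr // !mul0mx oppr0.
Qed.

(** The four nonzero columns of the signed partial permutation matrix [spin_inv i]. The
    corresponding coordinates of sections are free over the chart. *)
Definition free_coord (i l : nat) : nat := nth 0 (nth [::]
  [:: [:: 0; 1; 2; 3]; [:: 0; 1; 5; 6]; [:: 4; 7; 2; 3]; [:: 0; 2; 4; 6];
      [:: 5; 7; 1; 3]; [:: 0; 3; 4; 5]; [:: 6; 7; 1; 2]] i) l.

Lemma spin_inv_eq0 i (w : 'cV[k]_8) :
  spin_inv k i *m w = 0 <-> forall l, (l < 4)%N -> coords w (free_coord i l) = 0.
Proof.
rewrite /spin_inv; split=> [H|H].
  have {}H m (hm : (m < 8)%N) : nth 0 (oct_mul (spin_unit k i) (coords w)) m = 0.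
    by have /colP/(_ (Ordinal hm)) := H; rewrite oct_mxE mxE.
  have [[e0 e1] [e2 e3]] := ((H 0%N isT, H 1%N isT), (H 2%N isT, H 3%N isT)).
  have [[e4 e5] [e6 e7]] := ((H 4%N isT, H 5%N isT), (H 6%N isT, H 7%N isT)).
  move: e0 e1 e2 e3 e4 e5 e6 e7 {H}; rewrite /spin_unit.
  case: i => i /=; do 7?[case: i => [|i]] => //= _;
  rewrite !(mul0r, mul1r, mulr0, mulr1, add0r, addr0, oppr0, subr0, sub0r, opprK);
  move=> e0 e1 e2 e3 e4 e5 e6 e7 l; do 4?[case: l => [|l]] => //= _;
  rewrite /free_coord /=; try assumption; apply/eqP; rewrite -oppr_eq0; apply/eqP; assumption.
have [[e0 e1] [e2 e3]] := ((H 0%N isT, H 1%N isT), (H 2%N isT, H 3%N isT)).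
apply/colP => m; rewrite oct_mxE mxE; move: e0 e1 e2 e3 {H}; rewrite /spin_unit /free_coord.
case: i => i /=; do 7?[case: i => [|i]] => //= _ e0 e1 e2 e3;
case: m => m /=; do 8?[case: m => [|m]] => //= _;
by rewrite ?(e0, e1, e2, e3) !(mul0r, mul1r, mulr0, mulr1, add0r, addr0, oppr0, subr0, sub0r, opprK).
Qed.

Lemma free_coord_lt i l : (free_coord i l < 8)%N.
Proof. by do 7?[case: i => [|i]]; do 4?[case: l => [|l]]; rewrite ?/free_coord ?nth_nil //= ?nth_nil. Qed.

Lemma free_coord_inj (i : 'I_7) : {in gtn 4 &, injective (free_coord i)}.
Proof.
move=> l m; case: i => i /=; do 7?[case: i => [|i]] => //= _;
by do 4?[case: l => [|l]]; do 4?[case: m => [|m]].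
Qed.

Definition unit_sec U i (Ui : zsub U (chart k i)) (u : 'cV[k]_8) : K 0 U :=
  spin_mul k (addrN 1%:Z) U (mkPS (L := all_fibres k 8)
    (regular_vec_pow (d' := -1) Ui (addr0 (-1)) (regular_vec_cst (U := U) u)) (fun=> I)).

Lemma pval_unit_sec U i (Ui : zsub U (chart k i)) (u : 'cV[k]_8) x :
  pval (unit_sec Ui u) x = (sval x i)^-1 *: (evmx M (sval x) *m u).
Proof. by rewrite pval_spin_mul pval_mkPS -scalemxAr exprN1. Qed.

Lemma spin_expand U i (Ui : zsub U (chart k i)) (s : K 0 U) x :
  pval s x = (sval x i)^-1 *: (evmx M (sval x) *m (spin_inv k i *m pval s x)).
Proof.
rewrite -spin_ker; last exact: (pval_fib s x).
by rewrite scalerA mulVf ?scale1r // (chart_neq0 (Ui _ (svalP x))).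
Qed.

(** The frame is [z_i^(-1) M E_i e_l], with [l] among the free coordinates. Since
    [E_i M E_i = z_i E_i], the coefficients of a section are its own free coordinates. *)
Lemma spin_locally_free : locally_free 4 (K 0).
Proof.
move=> x xQ; have [[i xi] _] := xQ.
have ci : chart k i x by [].
exists (chart k i); split=> //.
pose J (l : 'I_4) : 'I_8 := Ordinal (free_coord_lt i l).
pose e l : K 0 (chart k i) := unit_sec (@zsub_refl k _) (spin_inv k i *m delta_mx (J l) 0).
exists e => W WV s.
have Jinj : injective J.
  move=> l m /(congr1 val) /= e1; apply: val_inj.
  by apply: (free_coord_inj (i := i)) e1; rewrite inE /= ltn_ord.
have sumE (c : {ffun 'I_4 -> regfun W}) y : pval (\sum_l c l *: res (K 0) WV (e l)) y =
    (sval y i)^-1 *: (evmx M (sval y) *m (spin_inv k i *m \sum_l c l y *: delta_mx (J l) 0)).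
  rewrite pval_sum !mulmx_sumr scaler_sumr; apply: eq_bigr => l _.
  by rewrite pvalZ pval_res pval_unit_sec -!scalemxAr !scalerA mulrC.
have coordJ (c : {ffun 'I_4 -> regfun W}) y (l : 'I_4) :
    coords (\sum_l c l y *: delta_mx (J l) 0 : 'cV[k]_8) (free_coord i l) = c l y.
  rewrite /coords (_ : inord _ = J l); last by apply: val_inj; rewrite /= inordK ?free_coord_lt.
  rewrite summxE (bigD1 l) //= big1 ?addr0 => [|m ne]; first by rewrite !mxE !eqxx mulr1.
  by rewrite !mxE (inj_eq Jinj) eq_sym (negPf ne) mulr0.
have sJ y (l : 'I_4) : ssval s (J l) y = coords (pval s y) (free_coord i l).
  rewrite /coords (_ : inord _ = J l) ?mxE //.
  by apply: val_inj; rewrite /= inordK ?free_coord_lt.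
have key (c : {ffun 'I_4 -> regfun W}) y : (forall l, c l y = ssval s (J l) y) <->
    spin_inv k i *m (pval s y - \sum_l c l y *: delta_mx (J l) 0) = 0.
  rewrite spin_inv_eq0; split=> [H l l4|H l].
    have := H (Ordinal l4); have := coordJ c y (Ordinal l4).
    by rewrite sJ /= /coords !mxE => -> ->; rewrite subrr.
  apply/eqP; rewrite eq_sym -subr_eq0; apply/eqP; rewrite -(H l (ltn_ord l)).
  by rewrite -{1}(coordJ c y l) sJ /coords !mxE.
exists [ffun l => (ssval s (J l) : regfun W)]; split=> [|c cE].
  apply: pval_inj => y; rewrite sumE (spin_expand WV s y); congr (_ *: (_ *m _)).
  apply/eqP; rewrite -subr_eq0 -mulmxBr; apply/eqP.
  by apply/(key [ffun l => (ssval s (J l) : regfun W)]) => l; rewrite ffunE.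
apply/ffunP => l; rewrite ffunE; apply: hfun_inj => y; apply/esym; move: l; apply/key.
have yi := chart_neq0 (WV _ (svalP y)).
rewrite mulmxBr {1}cE sumE -scalemxAr !mulmxA spin_splits' -scalemxAl scalerA.
by rewrite mulVf // scale1r subrr.
Qed.
End SpinorBundle.

(** * Endomorphisms and indecomposability of S *)

Section SpinorIndecomposable.
Variable k : closedFieldType.
Local Notation vec := ('I_7 -> k).
Local Notation poly7 := {mpoly k[7]}.
Local Notation M := (spin_mx k).
Local Notation K d := (PS d (ker_fibres M)).
Implicit Types (U V W : zopen k).

Lemma coords_delta (j : 'I_8) (i : nat) : (i < 8)%N -> coords (delta_mx j 0 : 'cV[k]_8) i = (i == j)%:R.
Proof. by move=> hi; rewrite /coords mxE -val_eqE /= inordK // eqxx andbT. Qed.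

Lemma coords_diag (B : 'M[k]_8) (v : 'cV[k]_8) i : (forall s t, s != t -> B s t = 0) -> (i < 8)%N ->
  coords (B *m v) i = B (inord i) (inord i) * coords v i.
Proof.
move=> dB hi; rewrite /coords mxE (bigD1 (inord i)) //= big1 ?addr0 // => j ne.
by rewrite dB ?mul0r // eq_sym.
Qed.

(* [M(x) B M(x) = 0] says that [B] preserves the kernel of [M(x)], which is also its
   image. *)
Lemma spin_scalar (B : 'M[k]_8) :
  (forall x, on_cone x -> evmx M x *m B *m evmx M x = 0) -> exists c, B = c%:M.
Proof.
move=> H.
have h (f : nat -> k) : (exists2 i, (i < 7)%N & f i != 0) ->
    f 0%N ^+ 2 + f 1%N * f 2%N + f 3%N * f 4%N + f 5%N * f 6%N = 0 ->
    oct_mx (imag f) *m B *m oct_mx (imag f) = 0.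
  by move=> f0 qf; rewrite -spin_ev_nat H //; exact: basis_on_cone.
(* For [i] other than 0, [spin_inv i] is [M] at a coordinate point of the quadric, namely that of
   the partner [i'] of [i] in its hyperbolic pair. *)
have inv0 (i : 'I_7) : i != ord0 -> spin_inv k i *m B *m spin_inv k i = 0.
  move=> i0; pose i' := nth 0%N [:: 0; 2; 1; 4; 3; 6; 5]%N i.
  have := h (fun j => (j == i')%:R); rewrite /i' /spin_inv.
  have -> : imag (fun j => (j == nth 0%N [:: 0; 2; 1; 4; 3; 6; 5]%N i)%:R : k) = spin_unit k i.
    apply/funext => j; rewrite /imag /spin_unit; move: i0 => /=.
    case: i {i'} => i /=; do 7?[case: i => [|i]] => //= _ _;
    by do 8?[case: j => [|j]] => //=; rewrite ?oppr0 ?nth_nil.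
  apply; first by exists i'; rewrite ?eqxx ?oner_eq0 // /i'; case: i {i0 i'} => i /=; do 7?[case: i => [|i]].
  by rewrite {}/i'; move: i0; case: i => i /=; do 7?[case: i => [|i]] => //= _ _; ring.
have anti (i : 'I_7) : i != ord0 -> exists j : 'I_7, j != ord0 /\
    spin_inv k i *m spin_inv k j + spin_inv k j *m spin_inv k i = 1%:M.
  move=> i0; have c (j : 'I_7) : j != ord0 -> oct_mx (oct_conj (spin_unit k j)) = - spin_inv k j.
    move=> j0; apply: oct_mxN => m m8; rewrite /oct_conj /spin_unit; move: j0 m8.
    case: j => j /=; do 7?[case: j => [|j]] => //= _ _;
    by do 8?[case: m => [|m]] => //= _; rewrite oppr0.
  have i7 : (nth 0%N [:: 0; 2; 1; 4; 3; 6; 5]%N i < 7)%N by case: i {i0} => i /=; do 7?[case: i => [|i]].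
  exists (Ordinal i7); have j0 : Ordinal i7 != ord0.
    by move: i0; rewrite -!val_eqE /=; case: i {i7} => i /=; do 7?[case: i => [|i]].
  split=> //; have := oct_mx_trace (spin_unit k i) (spin_unit k (Ordinal i7)).
  rewrite !c // mulNmx mulmxN opprK => ->; congr _%:M; move: i0; rewrite /oct_trace /spin_unit /=.
  by case: i {i7 j0} => i /=; do 7?[case: i => [|i]] => //= _ _; ring.
have sep (s t : 'I_8) : s != t -> exists i : 'I_7, [/\ i != ord0,
    exists2 l, (l < 4)%N & free_coord i l = s & forall l, (l < 4)%N -> free_coord i l <> t].
  have /allP H1 : all (fun s => all (fun t => (s == t) || has (fun i =>
      has (fun l => free_coord i l == s) (iota 0 4) && all (fun l => free_coord i l != t) (iota 0 4))
      (iota 1 6)) (iota 0 8)) (iota 0 8) by [].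
  have io (u : 'I_8) : (u : nat) \in iota 0 8 by rewrite mem_iota /= add0n ltn_ord.
  move=> st; have /allP/(_ _ (io t)) := H1 _ (io s).
  rewrite val_eqE (negPf st) orFb => /hasP[i]; rewrite mem_iota => /andP[i1 i7].
  move=> /andP[hl /allP e2]; have [l l4 /eqP e1] := hasP hl; exists (Ordinal i7).
  split; [by rewrite -val_eqE /= -lt0n|by exists l => //; rewrite mem_iota in l4|].
  by move=> m m4 e; have := e2 m; rewrite mem_iota /= => /(_ m4)/eqP.
(* Together [inv0] and [anti] show that [B] preserves the kernel of [spin_inv i], which is spanned
   by coordinate vectors. By [sep] these subspaces separate the coordinates, so [B] is diagonal. *)
have dB s t : s != t -> B s t = 0.
  move=> /sep[i [i0 [l l4 ls] tl]].
  have Et : spin_inv k i *m (delta_mx t 0 : 'cV[k]_8) = 0.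
    apply/spin_inv_eq0 => m m4; rewrite coords_delta ?free_coord_lt //.
    by case: eqP => // /(tl m m4).
  have [j [j0 ij]] := anti i i0.
  have : spin_inv k i *m (B *m delta_mx t 0 : 'cV[k]_8) = 0.
    have e0 : spin_inv k i *m (spin_inv k j *m delta_mx t 0) = (delta_mx t 0 : 'cV[k]_8).
      have /(congr1 (mulmx^~ (delta_mx t 0 : 'cV[k]_8))) := ij.
      by rewrite mulmxDl mul1mx -!mulmxA Et mulmx0 addr0.
    by rewrite -e0 !mulmxA inv0 // !mul0mx.
  by move=> e0; have /spin_inv_eq0 /(_ l l4) := e0; rewrite ls /coords -colE mxE inord_val.
pose b (n : nat) := B (inord n) (inord n).
have rel (f : nat -> k) : (exists2 i, (i < 7)%N & f i != 0) ->
    f 0%N ^+ 2 + f 1%N * f 2%N + f 3%N * f 4%N + f 5%N * f 6%N = 0 ->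
    forall j i : 'I_8, nth 0 (oct_mul (imag f) (fun n => b n *
      nth 0 (oct_mul (imag f) (fun m => (m == j)%:R)) n)) i = 0.
  move=> f0 qf j i; have /(congr1 (mulmx^~ (delta_mx j 0 : 'cV[k]_8))) := h f f0 qf.
  rewrite mul0mx -!mulmxA => /colP/(_ i); rewrite oct_mxE [RHS]mxE => e.
  apply: etrans e; congr (nth 0 _ _); apply: esym; apply: eq_oct_mul => n n8; rewrite (coords_diag _ dB n8) coords_oct //.
  congr (_ * nth 0 _ _); apply: eq_oct_mul => m m8; rewrite coords_delta //.
have ne1 : (1 : k) != 0 := oner_neq0 k.
(* The points [e_1 + e_3], [e_1 + e_5] and [e_0 + e_1 - e_2] of the quadric give enough relations to
   link all eight diagonal entries. *)
pose f1 n : k := ((n == 1%N) || (n == 3%N))%:R; pose f2 n : k := ((n == 1%N) || (n == 5%N))%:R.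
pose f3 n : k := if n == 2%N then -1 else (n < 2)%N%:R.
have r1 := rel f1 (ex_intro2 _ _ 1%N isT ne1) (ltac:(rewrite /f1 /=; ring)).
have r2 := rel f2 (ex_intro2 _ _ 1%N isT ne1) (ltac:(rewrite /f2 /=; ring)).
have r3 := rel f3 (ex_intro2 _ _ 1%N isT ne1) (ltac:(rewrite /f3 /=; ring)).
have e54 : b 5%N - b 4%N = 0.
  by rewrite -[RHS](r1 (inord 3) (inord 0)) /imag /f1 !inordK //=; ring.
have e12 : b 1%N - b 2%N = 0.
  by rewrite -[RHS](r1 (inord 7) (inord 6)) /imag /f1 !inordK //=; ring.
have e46 : b 4%N - b 6%N = 0.
  by rewrite -[RHS](r2 (inord 2) (inord 0)) /imag /f2 !inordK //=; ring.
have e31 : b 3%N - b 1%N = 0.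
  by rewrite -[RHS](r2 (inord 7) (inord 5)) /imag /f2 !inordK //=; ring.
have e04 : b 0%N - b 4%N = 0.
  by rewrite -[RHS](r3 (inord 0) (inord 0)) /imag /f3 !inordK //=; ring.
have e17 : b 1%N - b 7%N = 0.
  by rewrite -[RHS](r3 (inord 7) (inord 1)) /imag /f3 !inordK //=; ring.
have e26 : b 2%N - b 6%N = 0.
  by rewrite -[RHS](r3 (inord 2) (inord 2)) /imag /f3 !inordK //=; ring.
have bE n : (n < 8)%N -> b n = b 4%N.
  move/subr0_eq: e54 => e54; move/subr0_eq: e12 => e12; move/subr0_eq: e46 => e46.
  move/subr0_eq: e31 => e31; move/subr0_eq: e04 => e04; move/subr0_eq: e17 => e17.
  move/subr0_eq: e26 => e26.
  by do 8?[case: n => [|n]] => //= _; rewrite ?(e54, e04, e31) -?e17 ?e12 ?e26 -?e46.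
exists (b 4%N); apply/matrixP => s t; rewrite mxE.
case: eqP => [<-|/eqP ne]; last exact: dB.
by rewrite mulr1n -(bE s (ltn_ord s)) /b inord_val.
Qed.

(** For constant [u], the images under [P] of the local sections [z_i^(-1) M u], multiplied by
    [z_i], glue to a global section of [S(1)], which is [M b] for a constant [b]. The vectors [b]
    for [u = e_j] are the columns of the matrix [B] to which [spin_scalar] applies. *)
Lemma spin_end (P : omor (K 0) (K 0)) : exists c : k, forall U (s : K 0 U) x, pval (P U s) x = c *: pval s x.
Proof.
have glob (u : 'cV[k]_8) : exists b : 'cV[k]_8, forall U i (Ui : zsub U (chart k i)) x,
    pval (P U (unit_sec Ui u)) x = (sval x i)^-1 *: (evmx M (sval x) *m b).
  have cov : covers (chart k) (zfull k).
    split=> [i|x xQ]; first exact: zsub_full.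
    by have [[i xi] _] := xQ; exists i.
  have rG i : regular_vec 1 (fun x : pts (chart k i) => sval x i ^ 1 *: pval (P _ (unit_sec (@zsub_refl k _) u)) x).
    by apply: (regular_vec_pow (d := 0)); [exact: zsub_refl|exact: addr0|exact: pval_regular].
  have LG i (x : pts (chart k i)) : ker_fibres M (sval x)
      (sval x i ^ 1 *: pval (P _ (unit_sec (@zsub_refl k _) u)) x).
    by rewrite -[_ *: _]addr0; apply: fib_linear; [exact: pval_fib|exact: fib0].
  have resU U i (Ui : zsub U (chart k i)) :
      res (K 0) Ui (unit_sec (@zsub_refl k _) u) = unit_sec Ui u.
    by apply: pval_inj => x; rewrite pval_res !pval_unit_sec.
  have PU U i (Ui : zsub U (chart k i)) x :
      pval (P _ (unit_sec (@zsub_refl k _) u)) (pt_in Ui x) = pval (P U (unit_sec Ui u)) x.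
    by rewrite -(resU U i Ui) omor_res pval_res.
  have [i j W Wi Wj|G GE] := sec_glue cov (f := fun i => mkPS (rG i) (LG i) : K 1 _).
    apply: pval_inj => x; rewrite !pval_res !pval_mkPS !PU.
    have xi := chart_neq0 (Wi _ (svalP x)); have xj := chart_neq0 (Wj _ (svalP x)).
    have -> : unit_sec Wi u = ratio 1 Wi Wj *: unit_sec Wj u.
      apply: pval_inj => y; rewrite pvalZ !pval_unit_sec ratioE scalerA expr1z.
      by rewrite mulrAC divff ?mul1r // (chart_neq0 (Wj _ (svalP y))).
    by rewrite omorZ pvalZ ratioE scalerA /= !expr1z mulrCA divff ?mulr1.
  have [g hg sE] := spin_global G.
  have gc j : g j 0 = ((g j 0)@_0%MM)%:MP.
    apply/mpolyP => m; rewrite mcoeffC; have [->|m0] := eqVneq m 0%MM; first by rewrite mulr1.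
    by rewrite mulr0; apply: (dhomog_nemf_coeff (hg j 0)); rewrite /= mdeg_eq0.
  exists (\col_j (g j 0)@_0%MM) => U i Ui x.
  have -> : \col_j (g j 0)@_0%MM = evmx g (sval x) by apply/colP => j; rewrite !mxE {2}gc mevalC.
  rewrite -PU.
  have := congr1 (fun s => pval s (pt_in Ui x)) (GE i (@zsub_full k _)).
  rewrite /= pval_res pval_mkPS sE /= => ->.
  by rewrite expr1z scalerA mulVf ?scale1r // (chart_neq0 (Ui _ (svalP x))).
pose b j := sval (cid (glob (delta_mx j 0))).
pose B : 'M[k]_8 := \matrix_(l, j) b j l 0.
have PB U i (Ui : zsub U (chart k i)) j x :
    pval (P U (unit_sec Ui (delta_mx j 0))) x = (sval x i)^-1 *: (evmx M (sval x) *m B *m delta_mx j 0).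
  rewrite (svalP (cid (glob (delta_mx j 0)))) -mulmxA; congr (_ *: (_ *m _)).
  by rewrite -colE; apply/colP => l; rewrite !mxE.
have PE U i (Ui : zsub U (chart k i)) (s : K 0 U) x :
    pval (P U s) x = (sval x i)^-1 *: (evmx M (sval x) *m B *m (spin_inv k i *m pval s x)).
  have rc := regular_vec_cmx (spin_inv k i) (pval_regular s).
  have {1}-> : s = \sum_j (mkvec rc j : regfun U) *: unit_sec Ui (delta_mx j 0).
    apply: pval_inj => y; rewrite {1}(spin_expand Ui s y) pval_sum.
    rewrite [X in evmx M _ *m X]matrix_sum_delta mulmx_sumr scaler_sumr; apply: eq_bigr => j _.
    by rewrite big_ord1 pvalZ pval_unit_sec -scalemxAr !scalerA mulrC ffunE.
  rewrite omor_sum pval_sum [X in _ *m B *m X]matrix_sum_delta mulmx_sumr scaler_sumr.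
  apply: eq_bigr => j _.
  by rewrite big_ord1 omorZ pvalZ PB -scalemxAr !scalerA mulrC ffunE.
(* Applied to unit sections, [PE] gives [M B E_i M = z_i M B]; multiplying by [M] on the right kills
   the left side, as [M^2 = 0] on the quadric. *)
have [x xQ|c Bc] := @spin_scalar B.
  have [[i xi] _] := xQ; pose y : pts (chart k i) := exist _ x (chartP xQ xi).
  have MBE : evmx M x *m B *m spin_inv k i *m evmx M x = x i *: (evmx M x *m B).
    apply: eq_mulmx_col => v; rewrite [v]matrix_sum_delta !mulmx_sumr; apply: eq_bigr => j _.
    rewrite big_ord1 -!scalemxAr; congr (_ *: _).
    have := PE _ _ (@zsub_refl k _) (unit_sec (@zsub_refl k _) (delta_mx j 0)) y.
    rewrite PB pval_unit_sec /= -!scalemxAr => /(scalerI (invr_neq0 xi)) => e.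
    by rewrite -scalemxAl e scalerA divff // scale1r !mulmxA.
  have /(congr1 (mulmx^~ (evmx M x))) := MBE.
  rewrite -mulmxA spin_sqr // mulmx0 -scalemxAl => /esym/eqP.
  by rewrite scaler_eq0 (negPf xi) /= => /eqP.
exists c => U s x; have [[i xi] xq] := zopen_cone (svalP x).
pose V := zmeet U (chart k i); have Vi : zsub V (chart k i) by exact: zmeetr.
have VU : zsub V U by exact: zmeetl.
pose y : pts V := exist _ (sval x) (conj (svalP x) (chartP (zopen_cone (svalP x)) xi)).
have xE : x = pt_in VU y by exact: pts_inj.
rewrite xE -!pval_res -omor_res (PE _ _ Vi) [in RHS](spin_expand Vi (res _ VU s) y).
by rewrite Bc mul_mx_scalar -scalemxAl !scalerA mulrC.
Qed.

(** The projection onto a direct summand is an idempotent endomorphism, hence the scalar 0 or 1. *)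
Lemma spin_indecomposable : indecomposable (K 0).
Proof.
have [U0 [s0 [x0 sx]]] : exists U (s : K 0 U) x, pval s x != 0.
  apply: contrapT => H; have /eqP : (delta_mx ord0 0 : 'cV[k]_8) = 0.
    apply: spin_faithful => x xQ; have [[i xi] _] := xQ.
    pose y : pts (chart k i) := exist _ x (chartP xQ xi).
    have : pval (unit_sec (@zsub_refl k (chart k i)) (delta_mx ord0 0)) y = 0.
      by apply: contrapT => /eqP e; case: H; exists (chart k i), (unit_sec (@zsub_refl k _) (delta_mx ord0 0)), y.
    by rewrite pval_unit_sec /= => /eqP; rewrite scaler_eq0 invr_eq0 (negPf xi) /= => /eqP.
  by move=> /eqP/colP/(_ ord0); rewrite !mxE eqxx => /eqP; rewrite oner_eq0.
split; first by move=> H; rewrite (H U0 s0) pval0 eqxx in sx.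
move=> N N' [f [g fg]].
pose pr U (t : K 0 U) : K 0 U := g U ((f U t).1, 0).
have prl U a (t t' : K 0 U) : pr U (a *: t + t') = a *: pr U t + pr U t'.
  by rewrite /pr -omor_linear omor_linear; congr (g U (_, _)); rewrite /= scaler0 addr0.
have prr U V (VU : zsub V U) (t : K 0 U) : pr V (res (K 0) VU t) = res (K 0) VU (pr U t).
  by rewrite /pr -omor_res omor_res /= res0.
have [c cP] := spin_end (@OMor k (K 0) (K 0) pr prl prr).
have prE U t x : pval (pr U t) x = c *: pval t x by exact: cP.
have prpr U (t : K 0 U) : pr U (pr U t) = pr U t.
  by rewrite /pr; have [_ ->] := fg U.
have : (c * (c - 1)) *: pval s0 x0 = 0.
  by rewrite mulrBr mulr1 scalerBl -scalerA -!prE prpr subrr.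
move/eqP; rewrite scaler_eq0 (negPf sx) orbF mulf_eq0 subr_eq0 => /orP[] /eqP c0.
  left=> V t; have [_ gf] := fg V.
  have p0 : pr V (g V (t, 0)) = 0 by apply: pval_inj => y; rewrite prE c0 scale0r pval0.
  by have := congr1 (f V) p0; rewrite /pr !gf omor0 => -[].
right=> V t; have [_ gf] := fg V.
have p0 : pr V (g V (0, t)) = g V (0, t) by apply: pval_inj => y; rewrite prE c0 scale1r.
by have := congr1 (f V) p0; rewrite /pr !gf => -[].
Qed.

Lemma spinor_bundle_spin : spinor_bundle (K 0).
Proof.
split.
- exact: spin_locally_free.
- exact: spin_indecomposable.
- move=> i t hi; apply: (cohomology_iso (oiso_sym (twist_PS _ (add0r t)))).
  exact: spin_cohomology.
- exact: spin_dual.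
split; first exact: spin_h0.
exact: h0_iso (oiso_sym (twist_PS _ (add0r 1))) (spin_h1 k).
Qed.
End SpinorIndecomposable.

(** * The morphism [O(d) -> M(d)] given by a section of [M] *)

Section TwistedSections.
Variable k : closedFieldType.
Implicit Types (U V W : zopen k) (M N : omodule k).

Lemma open_neq0_subproof m (P : {mpoly k[7]}) : P \is m.-homog ->
  zariski_open (fun x => on_cone x /\ P.@[x] != 0).
Proof.
move=> hP; exists (eq P); split=> [_ <-|x]; first by exists m.
by split=> [[xQ Px]|[xQ [_ <-]]] //; split=> //; exists P.
Qed.

Definition open_neq0 m (P : {mpoly k[7]}) (hP : P \is m.-homog) : zopen k :=
  ZOpen (open_neq0_subproof hP).

Lemma regfun_inv U (b : regfun U) (x : pts U) : b x != 0 ->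
  exists V (VU : zsub V U) (b' : regfun V), V (sval x) /\ b' * rres VU b = 1.
Proof.
move=> bx; have [V [Vx [m [n [P [Q [hP hQ mn bE]]]]]]] := hfunP b x.
pose W := zmeet (zmeet U V) (open_neq0 hP).
have WU : zsub W U by move=> y [[]].
have rQP : is_regular 0 (fun y : pts W => Q.@[sval y] / P.@[sval y]).
  by apply: (regular_frac hQ hP) => [|y [_ []]] //; rewrite -[RHS]oppr0 -mn opprB.
exists W, WU, (mkhfun rQP); have [Qx e] := bE x Vx; split.
  split; first by split=> //; exact: svalP.
  split; first exact: zopen_cone (svalP x).
  by apply: contra_neq bx => Px; rewrite e Px mul0r.
apply: hfun_inj => y; have [[Uy Vy] [_ Py]] := svalP y.
have [Qy ey] := bE (pt_in WU y) Vy.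
rewrite -[LHS]/(Q.@[sval y] / P.@[sval y] * b (pt_in WU y)) ey.
by rewrite mulrA mulfVK // divff.
Qed.

Section Local.
Variables (M : omodule k) (d : int).

Lemma tloc_subproof U l (Ul : zsub U (chart k l)) (s : M U)
    (t := fun i => ratio d (@zmeetr _ U (chart k i)) (zsub_trans (@zmeetl _ _ _) Ul) *:
      res M (@zmeetl _ _ _) s) i j W (Wi : zsub W (zmeet U (chart k i))) (Wj : zsub W (zmeet U (chart k j))) :
  res M Wi (t i) =
    ratio d (zsub_trans Wi (@zmeetr _ _ _)) (zsub_trans Wj (@zmeetr _ _ _)) *: res M Wj (t j).
Proof.
rewrite /t !resZ !(res_comp _ _ (zsub_trans Wi (@zmeetl _ _ _))) scalerA; congr (_ *: _).
apply: hfun_inj => x; rewrite -[RHS]/(ratio d _ _ x * ratio d _ _ (pt_in Wj x)).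
rewrite -[LHS]/(ratio d _ _ (pt_in Wi x)) !ratioE /=.
have xi := chart_neq0 (Wi _ (svalP x)).2; have xj := chart_neq0 (Wj _ (svalP x)).2.
have xl := chart_neq0 (Ul _ (Wi _ (svalP x)).1).
rewrite -exprzMl ?unitfE ?mulf_neq0 ?invr_eq0 //; congr (_ ^ _).
by rewrite [RHS]mulrC mulrA divfK.
Qed.

(** The trivialization of [M(d)] over the chart [z_l <> 0]: the section thought of as [s z_l^d]. *)
Definition tloc U l (Ul : zsub U (chart k l)) (s : M U) : twist M d U :=
  TSec (tloc_subproof Ul s).

Lemma tlocE U l (t : twist M d U) V (VU : zsub V U) (Vl : zsub V (chart k l))
    (Vm : zsub V (zmeet U (chart k l))) :
  res (twist M d) VU t = tloc Vl (res M Vm (tval t l)).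
Proof.
apply: tsec_inj => i; rewrite -[LHS]/(res M (zmeetS VU) (tval t i)).
have Wl : zsub (zmeet V (chart k i)) (zmeet U (chart k l)) by move=> x [/Vm].
rewrite (tvalP t (zmeetS VU) Wl) /= (res_comp _ _ Wl); congr (_ *: _).
by apply: hfun_inj => x; rewrite !ratioE.
Qed.
End Local.

Lemma twist_map_loc M N (f : omor M N) d U l (Ul : zsub U (chart k l)) (s : M U) :
  twist_map f d U (tloc d Ul s) = tloc d Ul (f U s).
Proof. by apply: tsec_inj => i /=; rewrite omorZ omor_res. Qed.

Lemma twist_map_surjective M N (f : omor M N) d : osurjective f -> osurjective (twist_map f d).
Proof.
move=> fs U t x Ux; have [[l xl] _] := zopen_cone Ux.
have [|V [VU [Vx [s sE]]]] := fs _ (tval t l) x; first by split=> //; exact: chartP (zopen_cone Ux) xl.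
have Vl : zsub V (chart k l) by move=> y /VU[].
exists V, (zsub_trans VU (@zmeetl _ _ _)); split=> //; exists (tloc d Vl s).
by rewrite twist_map_loc sE (tlocE _ _ Vl VU).
Qed.

Section TwistSection.
Variables (M : omodule k) (s : M (zfull k)) (d : int).

Definition tcoef U i (a : hfun d U) : regfun (zmeet U (chart k i)) :=
  hmul (subrr d) (hres (@zmeetl _ _ _) a) (hpow (- d) (@zmeetr _ _ _)).

Lemma tcoefE U i (a : hfun d U) x : tcoef i a x = a (pt_in (@zmeetl _ _ _) x) * sval x i ^ (- d).
Proof. by []. Qed.

Lemma tsection_subproof U (a : hfun d U) (t := fun i => tcoef i a *: res M (@zsub_full k _) s) i j W
    (Wi : zsub W (zmeet U (chart k i))) (Wj : zsub W (zmeet U (chart k j))) :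
  res M Wi (t i) =
    ratio d (zsub_trans Wi (@zmeetr _ _ _)) (zsub_trans Wj (@zmeetr _ _ _)) *: res M Wj (t j).
Proof.
rewrite /t !resZ !(res_comp _ _ (@zsub_full k _)) scalerA; congr (_ *: _).
apply: hfun_inj => x; rewrite -[RHS]/(ratio d _ _ x * tcoef j a (pt_in Wj x)).
rewrite -[LHS]/(tcoef i a (pt_in Wi x)) !tcoefE ratioE /=.
rewrite (hfun_pt a (y := pt_in (@zmeetl _ _ _) (pt_in Wj x))) // mulrCA; congr (_ * _).
have xi := chart_neq0 (Wi _ (svalP x)).2; have xj := chart_neq0 (Wj _ (svalP x)).2.
by rewrite -!exprz_inv -exprzMl ?unitfE ?mulf_neq0 ?invr_eq0 // mulrAC divff // mul1r.
Qed.

Program Definition tsection : omor (OQ k d) (twist M d) :=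
  @OMor k (OQ k d) (twist M d) (fun U a => TSec (tsection_subproof a)) _ _.
Next Obligation.
move=> U a b c; apply: tsec_inj => i /=; rewrite scalerA -scalerDl; congr (_ *: _).
apply: hfun_inj => x; set l := (@zmeetl _ _ _).
rewrite -[RHS]/(a (pt_in l x) * tcoef i b x + tcoef i c x) !tcoefE mulrA -mulrDl.
by [].
Qed.
Next Obligation.
move=> U V VU a; apply: tsec_inj => i /=; rewrite resZ (res_comp _ _ (@zsub_full k _)); congr (_ *: _).
by apply: hfun_inj => x; rewrite -[RHS]/(tcoef i a (pt_in _ x)) !tcoefE; congr (_ * _); exact: (hfun_pt a).
Qed.

(** Over the chart [z_l <> 0], sections of [O(d)] are functions times [z_l^d], which reduces the
    claim to the untwisted one. *)
Lemma tsection_exact N (p : omor M N) :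
  (forall U (t : M U), p U t = 0 <-> in_image (section_mor s) t) ->
  forall U (t : twist M d U), twist_map p d U t = 0 <-> in_image tsection t.
Proof.
move=> pk U t; split=> [pt0 x Ux|tim].
  have [[l xl] _] := zopen_cone Ux.
  have /pk : p _ (tval t l) = 0 by exact: (congr1 (fun h : tsec N d U => tval h l) pt0).
  case/(_ x); first by split=> //; exact: chartP (zopen_cone Ux) xl.
  move=> V [Vm [Vx [b bE]]].
  have Vl : zsub V (chart k l) by move=> y /Vm[].
  exists V, (zsub_trans Vm (@zmeetl _ _ _)); split=> //.
  exists (hmul (add0r d) b (hpow d Vl)); rewrite (tlocE _ _ Vl Vm) -bE.
  apply: tsec_inj => i /=; rewrite resZ (res_comp _ _ (@zsub_full k _)) scalerA; congr (_ *: _).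
  apply: hfun_inj => y; rewrite tcoefE -[RHS]/(ratio d _ _ y * b (pt_in _ y)) ratioE.
  rewrite -[X in X * _ = _]/(b (pt_in (@zmeetl _ _ _) y) * sval y l ^ d) [RHS]mulrC -mulrA; congr (_ * _).
  have yi := chart_neq0 (svalP y).2; have yl := chart_neq0 (Vl _ (svalP y).1).
  by rewrite -exprz_inv -exprzMl ?unitfE ?invr_eq0.
apply: tsec_inj => i /=; apply/pk => x [Ux xi].
have [V [VU [Vx [a aE]]]] := tim x Ux.
exists (zmeet V (chart k i)), (zmeetS VU); split; first by split.
exists (tcoef i a); exact: (congr1 (fun h : tsec M d V => tval h i) aE).
Qed.

(** If [a s] vanishes at [x] while the coefficient does not, the coefficient is invertible near [x]
    and dividing by it makes [s] vanish at [x]. *)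
Lemma tsection_injective_on_fibres : nowhere_vanishing s -> injective_on_fibres tsection.
Proof.
move=> snz U a x Ux [V [VU [Vx [n [c [t [c0 ct]]]]]]].
have [[i xi] _] := zopen_cone Ux; pose W := zmeet V (chart k i).
have Wx : W x by split=> //; exact: chartP (zopen_cone Ux) xi.
have WU : zsub W U by exact: zsub_trans (@zmeetl _ _ _) VU.
have Wi : zsub W (chart k i) by exact: zmeetr.
pose a' := res (OQ k d) VU a; pose b := tcoef i a' : regfun W.
have bE : b *: res M (@zsub_full k W) s = \sum_l rres (@zmeetl _ V (chart k i)) (c l) *: tval (t l) i.
  have := congr1 (fun h : tsec M d V => tval h i) ct; rewrite -omor_res /= -/W => ->.
  pose ev (h : tsec M d V) := tval h i.
  rewrite -[LHS]/(ev _); elim/big_rec2: _ => // l y h _ <-.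
  by [].
exists W, WU, Wx, 1%N, (fun=> b), (fun=> hpow d Wi : OQ k d W); split; last first.
  rewrite big_ord1; apply: hfun_inj => y.
  rewrite -[RHS]/(b y * sval y i ^ d) tcoefE -mulrA -expfzDr ?(chart_neq0 (Wi _ (svalP y))) //.
  by rewrite addNr expr0z mulr1; exact: (hfun_pt a).
move=> _; apply/eqP; apply: contrapT => /negP bx; case: (snz x (zopen_cone Ux)).
have [Z [ZW [b' [Zx b'b]]]] := regfun_inv bx.
exists Z, (@zsub_full k Z), Zx, n, (fun l => b' * rres ZW (rres (@zmeetl _ V (chart k i)) (c l))),
  (fun l => res M ZW (tval (t l) i)); split=> [l|].
  rewrite -[LHS]/(b' _ * c l (pt_in _ (pt_in ZW (exist _ x Zx)))).
  by rewrite (hfun_pt (c l) (y := exist _ x Vx)) // c0 mulr0.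
have := congr1 (fun h => b' *: res M ZW h) bE.
rewrite resZ (res_comp _ _ (@zsub_full k Z)) scalerA b'b scale1r => ->.
rewrite res_sum scaler_sumr; apply: eq_bigr => l _.
by rewrite resZ scalerA.
Qed.
End TwistSection.
End TwistedSections.

(** * The trace, its kernel and the monad *)

Section CayleyMonad.
Variable k : closedFieldType.
Implicit Types (U V W : zopen k).
Local Notation A := (tango_matrix k).
Local Notation K d := (PS d (ker_fibres (spin_mx k))).

Program Definition trace_mor : omor (K 0) (OQ k 0) :=
  @OMor k (K 0) (OQ k 0) (fun U s => ssval s ord0 + ssval s ord_max) _ _.
Next Obligation.
by move=> U a s t; rewrite /= !ffunE scalerDr addrACA.
Qed.
Next Obligation.
by move=> U V VU s; rewrite /= !ffunE; apply: hfun_inj.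
Qed.

Lemma trace_morE U (s : K 0 U) x :
  trace_mor U s x = coords (pval s x) 0 + coords (pval s x) 7.
Proof.
by rewrite /coords !mxE; congr (ssval s _ x + ssval s _ x); apply: val_inj; rewrite /= inordK.
Qed.

(** This local section of the image of [M] has trace [z_i], so the trace is onto over the chart
    [z_i <> 0]. *)
Lemma trace_spin_unit (x : 'I_7 -> k) (i : 'I_7) (v := evmx (spin_mx k) x *m \col_j spin_unit k i j) :
  coords v 0 + coords v 7 = x i.
Proof.
rewrite /v spin_ev /coords !oct_mxE !inordK // zcE.
rewrite (@eq_oct_mul _ _ _ (spin_unit k i)); last by move=> j hj; rewrite /coords mxE inordK.
rewrite /oct_mul /imag /spin_unit /=.
by case: i {v} => i /=; do 7?[case: i => [|i]] => //= _; ring.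
Qed.

Lemma trace_mor_surjective : osurjective trace_mor.
Proof.
move=> U t x Ux; have [[i xi] _] := zopen_cone Ux.
pose V := zmeet U (chart k i); have VU : zsub V U by exact: zmeetl.
have Vi : zsub V (chart k i) by exact: zmeetr.
exists V, VU; split; first by split=> //; exact: chartP (zopen_cone Ux) xi.
exists (rres VU t *: unit_sec Vi (\col_j spin_unit k i j)); rewrite omorZ; apply: hfun_inj => y.
rewrite -[LHS]/(t (pt_in VU y) * trace_mor V _ y) trace_morE pval_unit_sec.
have cZ j (c : k) (v : 'cV[k]_8) : coords (c *: v) j = c * coords v j by rewrite /coords mxE.
rewrite !cZ -mulrDr trace_spin_unit mulVf ?mulr1 //.
exact: chart_neq0 (Vi _ (svalP y)).
Qed.

Lemma null_spin U (s : PS 0 (im_fibres (null_mx k)) U) (x : pts U) :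
  ker_fibres (spin_mx k) (sval x) (vval (ssval s) x).
Proof. by have /null_im[] := pval_fib s x; first exact: zopen_cone (svalP x). Qed.

Definition null_to_spin U (s : PS 0 (im_fibres (null_mx k)) U) : K 0 U :=
  @SSec k _ (psub 0 (ker_fibres (spin_mx k))) U (ssval s) (asboolT (null_spin s)).

Lemma null_trace U (s : PS 0 (im_fibres (null_mx k)) U) : trace_mor U (null_to_spin s) = 0.
Proof.
apply: hfun_inj => x; rewrite trace_morE.
by have /null_im[] := pval_fib s x; first exact: zopen_cone (svalP x).
Qed.

Program Definition null_kernel : omor (PS 0 (im_fibres (null_mx k))) (okernel trace_mor) :=
  @OMor k (PS 0 (im_fibres (null_mx k))) (okernel trace_mor)
    (fun U s => @SSec k _ (kernel_subsheaf trace_mor) U (null_to_spin s) (asboolT (null_trace s))) _ _.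
Next Obligation. by move=> U a s t; do 2!apply: val_inj. Qed.
Next Obligation. by move=> U V VU s; do 2!apply: val_inj. Qed.

Lemma null_kernel_surj U (t : okernel trace_mor U) : exists s, null_kernel U s = t.
Proof.
have t0 : trace_mor U (ssval t) = 0 := asboolW (ssvalP t).
have H : forall x : pts U, im_fibres (null_mx k) (sval x) (vval (ssval (ssval t)) x).
  move=> x; apply/null_im; first exact: zopen_cone (svalP x).
  split; first exact: (pval_fib (ssval t) x).
  by rewrite -[vval _ _]/(pval (ssval t) x) -trace_morE t0.
exists (@SSec k _ (psub 0 (im_fibres (null_mx k))) U (ssval (ssval t)) (asboolT H)).
by do 2!apply: val_inj.
Qed.

Lemma null_kernel_iso : oiso (PS 0 (im_fibres (null_mx k))) (okernel trace_mor).
Proof.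
apply: (bij_oiso (f := null_kernel)); last exact: null_kernel_surj.
move=> U s t e; apply: val_inj.
exact: (congr1 (fun h : okernel trace_mor U => ssval (ssval h)) e).
Qed.

Lemma null_mx_splits : splits 2 (null_mx k) (fun i => (tango_inv k i)^T *m tango_proj k).
Proof.
move=> x i xQ; rewrite -null_inv // -!mulmxA; congr (_ *m (_ *m _)).
exact: tango_proj_null.
Qed.

(** The kernel of the trace is the image of the split matrix [null_mx], hence a subbundle: a zero
    value in [k^8] already means vanishing in its own fibre. This lets injectivity on fibres pass
    from [H(-1)] to S. *)
Lemma kernel_vanishes U (t : okernel trace_mor U) x (Ux : U x) :
  pval (ssval t) (exist _ x Ux) = 0 -> vanishes_at t x.
Proof.
have [s <-] := null_kernel_surj t => s0; apply: vanishes_omor.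
exact: (pval0_vanishes (null_mx_homog k) null_mx_splits (addrN 2%:Z) s0).
Qed.

(** Degrees: the dual of Im(A) is the image of the transpose of A inside [O(2)^6]; the twist in the
    definition of H and the present one bring it to [O^6], where the projected kernel of the trace
    lies. *)
Lemma kernel_tangoH : oiso (okernel trace_mor) (twist (tangoH k) (-1)).
Proof.
apply: oiso_trans (oiso_sym null_kernel_iso) _.
apply: (oiso_trans (N := PS 0 (null_fibres k))).
  by apply: oiso_fib => x v xQ; apply: iff_sym; exact: null_im.
apply: oiso_trans (null_PS k 0) _.
apply: oiso_trans (oiso_sym (twist_PS (d := 1) (e := -1) _ (addrN 1))) _.
apply: oiso_twist; apply: oiso_sym; rewrite /tangoH.
apply: oiso_trans (twist_PS (d := 2) (e := -1) (d' := 1) _ _) => //.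
apply: oiso_twist; apply: (oiso_trans (N := odual (PS 0 (im_fibres A)))).
  by apply/oiso_dual; exact: image_PS (@tango_splits k).
by apply: (dual_PS (@tango_matrix_homog k) (@tango_splits k) (addrN 2%:Z)); rewrite opprK.
Qed.
End CayleyMonad.

Theorem mainTheorem2 (k : closedFieldType) (s : tangoH k (zfull k))
    (F : omodule k) (p : omor (tangoH k) F)
    (s_nowhere_zero : nowhere_vanishing s)
    (F_cokernel : short_exact (section_mor s) p) :
  (exists C : omodule k, cayley_bundle C /\ oiso F (twist C 1)) /\
  (exists (S : omodule k) (f : omor (OQ k (-1)) S) (g : omor S (OQ k 0)),
     [/\ spinor_bundle S, is_monad f g &
         monad_cohomology f g (twist F (-1))]).
Proof.
suff H : exists (S : omodule k) (f : omor (OQ k (-1)) S) (g : omor S (OQ k 0)),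
    [/\ spinor_bundle S, is_monad f g & monad_cohomology f g (twist F (-1))].
  by split=> //; exists (twist F (-1)); split; [exact: H|exact: twist_twist (addNr 1)].
have [_ pk ps] := F_cokernel; have [phi [psi phiK]] := kernel_tangoH k.
pose S := PS 0 (ker_fibres (spin_mx k)); pose tau := tsection s (-1).
pose f0 U (a : OQ k (-1) U) : S U := ssval (psi U (tau U a)).
have fl U c (a b : OQ k (-1) U) : f0 U (c *: a + b) = c *: f0 U a + f0 U b.
  by rewrite /f0 !omor_linear.
have fr U V (VU : zsub V U) (a : OQ k (-1) U) : f0 V (res _ VU a) = res S VU (f0 U a).
  by rewrite /f0 !omor_res.
pose f := @OMor k (OQ k (-1)) S f0 fl fr.
exists S, f, (trace_mor k); split; first exact: spinor_bundle_spin.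
  split; last 1 first.
  - by move=> U a; exact: (asboolW (ssvalP (psi U (tau U a)))).
  (* A zero value in S first gives vanishing inside the kernel of the trace, then in [H(-1)], where
     [s] is nowhere vanishing. *)
  - move=> U a x Ux /(vanishes_pval Ux) /kernel_vanishes /(vanishes_omor phi).
    by have [_ ->] := phiK U; exact: tsection_injective_on_fibres.
  exact: trace_mor_surjective.
exists (ocomp (twist_map p (-1)) phi); split.
  move=> U t x Ux; have [V [VU [Vx [u uE]]]] := twist_map_surjective ps t Ux.
  exists V, VU; split=> //; exists (psi V u).
  exact: etrans (congr1 (twist_map p (-1) V) ((phiK V).2 u)) uE.
move=> U t; rewrite [ocomp _ _ _ _]/(twist_map p (-1) U (phi U t)) (tsection_exact pk).
(* Under the isomorphism [phi], local preimages by [f] in S correspond to local preimages by [tau]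
   in [H(-1)]. *)
have E V (VU : zsub V U) a : f V a = res S VU (ssval t) <-> tau V a = res _ VU (phi U t).
  split=> [e|e]; last by rewrite /= /f0 e -omor_res (phiK V).1.
  have {}e : psi V (tau V a) = res (okernel (trace_mor k)) VU t by exact: val_inj.
  by rewrite -omor_res -e (phiK V).2.
by split=> H x /H[V [VU [Vx [a /E aE]]]]; exists V, VU; split=> //; exists a.
Qed.
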